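(* Let $A$ be a $C_0(X)$-algebra with base map $\phi$, and suppose that $\phi$ is the complete regularization map for $\mathrm{Prim}(A)$ and that $\mathrm{Orc}(A)<\infty$. Let $x\in X_\phi$ with $J_x$ locally modular. Then either $x\in U_\phi$ or $H(x)$ has non-empty interior in $\mathrm{Prim}(A)$.
   Context: For a C$^*$-algebra $A$, $\mathrm{Prim}(A)$ is the primitive ideal space with the hull-kernel topology, $M(A)$ is the multiplier algebra and $Z(M(A))$ its centre. $A$ is a $C_0(X)$-algebra with base map $\phi$ if $X$ is a locally compact Hausdorff space and $\phi:\mathrm{Prim}(A)\to X$ is continuous; $X_\phi$ denotes the image of $\phi$ with the subspace topology. For $x\in X_\phi$ put $J_x=\bigcap\{P\in\mathrm{Prim}(A):\phi(P)=x\}$ and $H(x)=\phi^{-1}(x)$, with boundary $\partial H(x)$ and interior $U(x)$ in $\mathrm{Prim}(A)$. $J_x$ is locally modular if for each $P\in\partial H(x)$ there is a relatively open neighbourhood $V$ of $P$ in $\mathrm{Prim}(A)\setminus U(x)$ such that $A/\ker V$ is unital, where $\ker V=\bigcap_{Q\in V}Q$. Let $\theta_A:C^b(\mathrm{Prim}(A))\to Z(M(A))$ be the Dauns-Hofmann isomorphism, characterized by $\theta_A(f)a+P=f(P)(a+P)$ for $f\in C^b(\mathrm{Prim}(A))$, $a\in A$, $P\in\mathrm{Prim}(A)$. Let $\mu:C_0(X)\to Z(M(A))$, $\mu(f)=\theta_A(f\circ\phi)$, $Z'(A)=\mu(C_0(X))\cap A$, and $U_\phi=\{x\in X_\phi:J_x\not\supseteq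 Z'(A)\}$. Complete regularization: identify $P,Q\in\mathrm{Prim}(A)$ when $f(P)=f(Q)$ for all bounded continuous real-valued $f$ on $\mathrm{Prim}(A)$; the quotient set, with the weakest topology making all functions induced by such $f$ continuous, is a completely regular Hausdorff space, and the quotient map is the complete regularization map $\phi_A$. Saying $\phi$ is the complete regularization map means that $\phi=\phi_A$ with $X_\phi$ being this space (and $X$ may be taken to be $X_\phi$ if it is locally compact, or $\beta X_\phi$). Connecting order: for $P,Q\in\mathrm{Prim}(A)$ write $P\sim Q$ if $P$ and $Q$ cannot be separated by disjoint open subsets of $\mathrm{Prim}(A)$. View $\mathrm{Prim}(A)$ as a graph with $P,Q$ adjacent if $P\sim Q$; $d_A(P,Q)$ is the length of a shortest path from $P$ to $Q$ ($\infty$ if none exists). The diameter of a $\sim$-component (connected component of the graph) is the supremum of the distances between its points, with the convention that a singleton component has diameter $1$. $\mathrm{Orc}(A)\in\{1,2,\dots,\infty\}$ is the supremum of the diameters of the $\sim$-components. *)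

(* Defs.v *)
From HB Require Import structures.
From mathcomp Require Import all_boot all_order all_algebra.
From mathcomp Require Import complex.
From mathcomp Require Import all_classical all_reals all_analysis.

Set Implicit Arguments.
Unset Strict Implicit.
Unset Printing Implicit Defensive.

Import Order.TTheory GRing.Theory Num.Theory.
Import numFieldNormedType.Exports.

Local Open Scope classical_set_scope.
Local Open Scope ring_scope.
Local Open Scope complex_scope.

(* C*-algebras are not assumed to be unital, hence the multiplication is not
   the one of the (unital) rings of MathComp. *)
HB.mixin Record isCStarAlgebra (R : realType) A
    & CompleteNormedModule R[i] A := {
  cmul : A -> A -> A ;
  cstar : A -> A ;
  cmulA : associative cmul ;
  cmul_linear_l : forall b, linear (cmul^~ b) ;
  cmul_linear_r : forall a, linear (cmul a) ;
  cstarK : involutive cstar ;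
  cstar_antilinear : forall (c : R[i]) a b,
    cstar (c *: a + b) = conjc c *: cstar a + cstar b ;
  cstarM : forall a b, cstar (cmul a b) = cmul (cstar b) (cstar a) ;
  cnormM : forall a b, `|cmul a b| <= `|a| * `|b| ;
  cnorm_cstar : forall a, `|cmul (cstar a) a| = `|a| ^+ 2
}.

#[short(type="cstarAlgType")]
HB.structure Definition CStarAlgebra (R : realType) :=
  {A of isCStarAlgebra R A & CompleteNormedModule R[i] A}.

HB.mixin Record isHilbert (R : realType) H
    & CompleteNormedModule R[i] H := {
  inner : H -> H -> R[i] ;
  inner_linear_l : forall v (c : R[i]) u u',
    inner (c *: u + u') v = c * inner u v + inner u' v ;
  inner_conj : forall u v, inner v u = conjc (inner u v) ;
  inner_norm : forall u, inner u u = `|u| ^+ 2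
}.

#[short(type="hilbertType")]
HB.structure Definition Hilbert (R : realType) :=
  {H of isHilbert R H & CompleteNormedModule R[i] H}.

Section Representations.
Context {R : realType} {A : cstarAlgType R}.

Record representation (H : hilbertType R) (pi : A -> H -> H) : Prop := {
  rep_linear : forall a, linear (pi a) ;
  rep_continuous : forall a, continuous (pi a) ;
  rep_linear_l : forall v, linear (pi^~ v) ;
  repM : forall a b v, pi (cmul a b) v = pi a (pi b v) ;
  rep_star : forall a u v, inner (pi a u) v = inner u (pi (cstar a) v)
}.

Definition closed_subspace (H : hilbertType R) (M : set H) : Prop :=
  [/\ closed M, M 0 & forall (c : R[i]) u v, M u -> M v -> M (c *: u + v)].

Definition irreducible (H : hilbertType R) (pi : A -> H -> H) : Prop :=
  (exists a v, pi a v != 0) /\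
  forall M : set H, closed_subspace M ->
    (forall a v, M v -> M (pi a v)) -> M = [set 0] \/ M = setT.

Definition primitive_ideal (P : set A) : Prop :=
  exists (H : hilbertType R) (pi : A -> H -> H),
    [/\ representation pi, irreducible pi &
        P = [set a | forall v, pi a v = 0]].

End Representations.

Record Prim (R : realType) (A : cstarAlgType R) := MkPrim {
  prim_ideal : set A ;
  primP : primitive_ideal prim_ideal
}.

Section HullKernel.
Context {R : realType} {A : cstarAlgType R}.
Local Notation prim := (Prim A).

HB.instance Definition _ := gen_eqMixin prim.
HB.instance Definition _ := gen_choiceMixin prim.

Definition kernel_of (V : set prim) : set A :=
  [set a | forall Q : prim, V Q -> prim_ideal Q a].

Definition hull (I : set A) : set prim := [set P : prim | I `<=` prim_ideal P].

(* U is open when its complement F is hull-kernel closed, i.e. hull (ker F) is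
   contained in F (the other inclusion always holds). *)
Definition hk_open (U : set prim) : Prop :=
  hull (kernel_of (~` U)) `<=` ~` U.

Lemma rep0 (H : hilbertType R) (pi : A -> H -> H) :
  representation pi -> forall a, pi a 0 = 0.
Proof.
move=> rep a; have := rep_linear rep a (-1) 0 0.
by rewrite scaler0 addr0 scaleN1r addNr.
Qed.

Lemma annihilated_subspace (H : hilbertType R) (pi : A -> H -> H) (J : set A) :
  representation pi -> (forall a b, J a -> J (cmul a b)) ->
  let M := [set v | forall b, J b -> pi b v = 0] in
  closed_subspace M /\ forall a v, M v -> M (pi a v).
Proof.
move=> rep Jr M; split; last by move=> a v Mv b Jb; rewrite -(repM rep) Mv//; exact: Jr.
split.
- have -> : M = \bigcap_(b in J) (pi b @^-1` [set 0]).
    by apply/seteqP; split => v Mv b /Mv.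
  apply: closed_bigI => b _; apply: closed_comp => [v _|].
    exact: rep_continuous.
  exact/accessible_closed_set1/hausdorff_accessible/norm_hausdorff.
- by move=> b _; exact: rep0.
- by move=> c u v Mu Mv b Jb; rewrite (rep_linear rep) Mu// Mv// scaler0 addr0.
Qed.

(* Primitive ideals are prime. *)
Lemma prim_prime (P : prim) (I J : set A) :
  (forall a b, I a -> I (cmul a b)) ->
  (forall a b, J b -> J (cmul a b)) ->
  I `&` J `<=` prim_ideal P -> I `<=` prim_ideal P \/ J `<=` prim_ideal P.
Proof.
case: P => P /= [H [pi [rep [_ irr] ->]]] Ir Jl IJ.
have [MIs MIi] := annihilated_subspace rep Ir.
case: (irr _ MIs MIi) => MI; last first.
  left=> a Ia v.
  suff : [set w | forall a, I a -> pi a w = 0] v by exact.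
  by rewrite MI.
right=> b Jb v.
suff : [set w | forall a, I a -> pi a w = 0] (pi b v) by rewrite MI.
move=> a Ia /=; rewrite -(repM rep); apply: IJ; split; [exact: Ir|exact: Jl].
Qed.

Lemma prim_mulr (P : prim) a b :
  prim_ideal P a -> prim_ideal P (cmul a b).
Proof.
case: P => P /= [H [pi [rep _ ->]]] /= Pa v.
by rewrite (repM rep) Pa.
Qed.

Lemma prim_mull (P : prim) a b :
  prim_ideal P b -> prim_ideal P (cmul a b).
Proof.
case: P => P /= [H [pi [rep _ ->]]] /= Pb v.
by rewrite (repM rep) Pb (rep0 rep).
Qed.

Lemma prim_proper (P : prim) : exists a, ~ prim_ideal P a.
Proof.
case: P => P /= [H [pi [_ [[a [v /eqP av]] _] ->]]].
by exists a => /(_ v).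
Qed.

Let hk_openT : hk_open setT.
Proof.
move=> P hP _; have [a] := prim_proper P; apply; apply: hP => Q /=.
by move=> /(_ Logic.I).
Qed.

Let hk_openI : setI_closed hk_open.
Proof.
move=> U V oU oV P hP [UP VP].
have [] := @prim_prime P (kernel_of (~` U)) (kernel_of (~` V)).
- by move=> a b ka Q UQ; apply: prim_mulr; exact: ka.
- by move=> a b kb Q UQ; apply: prim_mull; exact: kb.
- move=> a [aU aV]; apply: hP => Q /= /not_andP[nU|nV]; [exact: aU|exact: aV].
- by move=> /oU; exact.
- by move=> /oV; exact.
Qed.

Let hk_open_bigU (I : Type) (f : I -> set prim) :
  (forall i, hk_open (f i)) -> hk_open (\bigcup_i f i).
Proof.
move=> fo P hP [i _ fiP]; apply: (fo i P _ fiP) => a ka; apply: hP => Q nQ.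
by apply: ka => fiQ; apply: nQ; exists i.
Qed.

HB.instance Definition _ :=
  isOpenTopological.Build prim hk_openT hk_openI hk_open_bigU.

End HullKernel.

Section CompleteRegularization.
Context (R : realType) (T : topologicalType).

Definition creg_rel (P Q : T) : bool :=
  `[< forall f : T -> R, continuous f -> bounded_fun f -> f P = f Q >].

Lemma creg_refl : reflexive creg_rel.
Proof. by move=> P; apply/asboolP. Qed.

Lemma creg_sym : symmetric creg_rel.
Proof.
by move=> P Q; apply/asboolP/asboolP => PQ f cf bf; rewrite (PQ f cf bf).
Qed.

Lemma creg_trans : transitive creg_rel.
Proof.
move=> Q P S /asboolP PQ /asboolP QS; apply/asboolP => f cf bf.
by rewrite (PQ f cf bf) (QS f cf bf).
Qed.

Canonical creg_equiv := EquivRel creg_rel creg_refl creg_sym creg_trans.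

Definition creg_quot : choiceType := {eq_quot creg_equiv}%qT.

Definition creg_map_quot (P : T) : creg_quot :=
  (\pi_({eq_quot creg_equiv}%qT) P)%qT.

(* The functions on the quotient induced by bounded continuous functions on T;
   creg carries the weakest topology making all of them continuous. *)
Definition creg_fun : Type := {g : creg_quot -> R |
  continuous (g \o creg_map_quot) /\ bounded_fun (g \o creg_map_quot)}.

Definition creg : topologicalType :=
  sup_topology (fun g : creg_fun =>
    Topological.on (initial_topology (projT1 g))).

Definition creg_map : T -> creg := creg_map_quot.

End CompleteRegularization.

Definition homeomorphism (S T : topologicalType) (h : S -> T) : Prop :=
  continuous h /\ exists g : T -> S, [/\ cancel h g, cancel g h & continuous g].

(* phi is the complete regularization map, the image of phi (with the subspace
   topology of X) being identified with the complete regularization of T. *)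
Definition is_complete_regularization (R : realType) (T X : topologicalType)
    (phi : T -> X) : Prop :=
  exists h : creg R T -> range phi,
    homeomorphism h /\ forall P, set_val (h (creg_map R P)) = phi P.

Section ConnectingOrder.
Context (R : realType) {T : topologicalType}.

Definition conn (P Q : T) : Prop :=
  ~ exists U V : set T, [/\ open U, open V, U P, V Q & U `&` V = set0].

Definition conn_path (P Q : T) (s : seq T) : Prop :=
  path (fun x y => `[< conn x y >]) P s /\ last P s = Q.

Definition conn_dist (P Q : T) : \bar R :=
  ereal_inf [set ((size s)%:R : R)%:E | s in conn_path P Q].

Definition conn_component (P : T) : set T :=
  [set Q | exists s, conn_path P Q s].

(* A singleton component has diameter 1, by convention. *)
Definition conn_diameter (C : set T) : \bar R :=
  if `[< exists P, C = [set P] >] then 1%E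
  else ereal_sup [set conn_dist z.1 z.2 | z in C `*` C].

End ConnectingOrder.

Definition Orc (R : realType) (A : cstarAlgType R) : \bar R :=
  ereal_sup (range (fun P : Prim A => conn_diameter R (conn_component P))).

Section Multipliers.
Context {R : realType} {A : cstarAlgType R}.

(* M(A) is the algebra of the double centralizers (L, R) of A. *)
Definition multiplier : set ((A -> A) * (A -> A)) :=
  [set m | [/\ linear m.1 /\ continuous m.1, linear m.2 /\ continuous m.2,
               forall a b, m.1 (cmul a b) = cmul (m.1 a) b,
               forall a b, m.2 (cmul a b) = cmul a (m.2 b) &
               forall a b, cmul (m.2 a) b = cmul a (m.1 b)]].

Definition multiplier_mul (m n : (A -> A) * (A -> A)) :=
  (m.1 \o n.1, n.2 \o m.2).

Definition multiplier_center : set ((A -> A) * (A -> A)) :=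
  [set z | multiplier z /\
     forall m, multiplier m -> multiplier_mul z m = multiplier_mul m z].

Definition multiplier_of (a : A) : (A -> A) * (A -> A) :=
  (cmul a, cmul^~ a).

(* The graph of the Dauns-Hofmann isomorphism theta_A from C^b(Prim A) to
   Z(M(A)): dauns_hofmann f z means z = theta_A f. *)
Definition dauns_hofmann (f : Prim A -> R[i]^o) (z : (A -> A) * (A -> A)) :=
  [/\ continuous f, bounded_fun f, multiplier_center z &
      forall (a : A) (P : Prim A), prim_ideal P (z.1 a - f P *: a)].

(* A / I is unital, with unit the class of e. *)
Definition unital_quotient (I : set A) : Prop :=
  exists e : A, forall a, I (cmul e a - a) /\ I (cmul a e - a).

End Multipliers.

Definition C0 (R : realType) (X : topologicalType) : set (X -> R[i]^o) :=
  [set f | continuous f /\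
     forall e : R[i], 0 < e -> compact [set x | e <= `|f x|]].

Section C0XAlgebra.
Context {R : realType} {A : cstarAlgType R} {X : topologicalType}.
Variable phi : Prim A -> X.

Definition Jx (x : X) : set A := [set a | forall P : Prim A, phi P = x -> prim_ideal P a].

Definition Hx (x : X) : set (Prim A) := phi @^-1` [set x].

Definition Ux (x : X) : set (Prim A) := interior (Hx x).

Definition locally_modular (x : X) : Prop :=
  forall P : Prim A, (closure (Hx x) `\` Ux x) P ->
    exists V : set (Prim A),
      [/\ exists2 O, open O & V = O `&` ~` Ux x,
          V P & unital_quotient (kernel_of V)].

(* mu(C_0(X)) `&` A, where mu f = theta_A (f \o phi) and A sits inside M(A)
   through multiplier_of. *)
Definition Zprime : set A :=
  [set a | exists2 f : X -> R[i]^o, C0 f &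
     dauns_hofmann (f \o phi) (multiplier_of a)].

Definition Uphi : set X :=
  [set x | range phi x /\ ~ (Zprime `<=` Jx x)].

End C0XAlgebra.

(* Main.v *)
(* Suppose that the interior of H(x) is empty, so that every point of H(x) has an
   open neighbourhood V with A / ker V unital; call such sets good. Good sets are
   stable under finite unions, and their closures are good and compact. A point
   connected to a point of an open set V lies in the closure of V, and connected
   points have the same image under phi; hence the points reached from P in H(x)
   in k steps form a compact subset of H(x) with a good neighbourhood. Since
   Orc(A) is finite, the component of P is reached in finitely many steps, and
   shrinking neighbourhoods the same number of times yields a good, closed,
   saturated neighbourhood of it. Collapsing components there gives a normal
   space, and Urysohn's lemma a continuous function on Prim(A) which is 0 at P and
   1 outside a good set. So x has a neighbourhood in X whose preimage is good, and
   for F in C_0(X) supported in it with F(x) = 1 the central multiplier theta_A(F o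
   phi) belongs to A, by the Dauns-Hofmann construction inside the unital quotient.

   The C*-algebra theory behind this (compactness of closures of good sets,
   faithfulness of the irreducible representations, the Dauns-Hofmann theorem)
   rests on irreducible representations obtained by the GNS construction from
   extreme quasi-states. A quasi-state is a functional dominated by the gauge of
   the cone generated by the squares of the unitization and a given ideal;
   extreme ones come from Zorn's lemma applied to sublinear functionals. That the
   gauge does not vanish is the positivity of T^* T for adjointable operators T. *)
Require Import Defs.
From HB Require Import structures.
From mathcomp Require Import all_boot all_order all_algebra.
From mathcomp Require Import complex.
From mathcomp Require Import all_classical all_reals all_analysis.
From mathcomp Require Import ring lra.

Set Implicit Arguments.
Unset Strict Implicit.
Unset Printing Implicit Defensive.

Import Order.TTheory GRing.Theory Num.Theory.
Import numFieldNormedType.Exports.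

Local Open Scope classical_set_scope.
Local Open Scope ring_scope.
Local Open Scope complex_scope.

(** * Equations between linear combinations *)

(** Finiteness of Orc(A) is used because in Prim(A), which need not be Hausdorff, closedness is
    obtained only for the set of points connected to a compact set: every step along a path has to
    be controlled separately, and only finitely many can be. The complete regularization enters at
    one place: bounded continuous functions on Prim(A) factor through it, which turns a Urysohn
    function on Prim(A) into an open set of X around x. On the algebraic side there is no spectrum,
    no functional calculus and no unitization. The unit is that of the adjointable operators on A,
    positivity is a norm condition, and square roots and inverses are limits of explicit iterations.
    An element 1 + x of the unitization appears only through x + x^* + x^* x = (1 + x)^* (1 + x) -
    1. Functionals are real-valued, so that Zorn's lemma applies to sublinear functionals directly;
    the complex functional is recovered from its real part. Extreme points are found through faces
    instead of a weak topology. *)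

Section LinearReflection.
Context {K : comNzRingType} {V : lmodType K}.

Inductive lin_expr := LAtom of nat | LAdd of lin_expr & lin_expr | LOpp of lin_expr
  | LScale of K & lin_expr | LZero.

Fixpoint lin_eval (env : seq V) (e : lin_expr) : V :=
  match e with
  | LAtom i => env`_i
  | LAdd e1 e2 => lin_eval env e1 + lin_eval env e2
  | LOpp e1 => - lin_eval env e1
  | LScale k e1 => k *: lin_eval env e1
  | LZero => 0
  end.

(** [eqn] instead of [==], so that [cbn] evaluates the comparison of indices in [module]. *)
Fixpoint lin_coef (e : lin_expr) (i : nat) : K :=
  match e with
  | LAtom j => if eqn j i then 1 else 0
  | LAdd e1 e2 => lin_coef e1 i + lin_coef e2 i
  | LOpp e1 => - lin_coef e1 i
  | LScale k e1 => k * lin_coef e1 i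
  | LZero => 0
  end.

Fixpoint lin_same (n : nat) (e1 e2 : lin_expr) : Prop :=
  if n is n'.+1 then lin_coef e1 n' = lin_coef e2 n' /\ lin_same n' e1 e2 else True.

Lemma lin_evalE env e : lin_eval env e = \sum_(i < size env) lin_coef e i *: env`_i.
Proof.
elim: e => [j|e1 IH1 e2 IH2|e1 IH1|k e1 IH1|] /=.
- have [jn|jn] := ltnP j (size env); last first.
    rewrite nth_default// big1// => i _; case: eqnP => [ji|]; last by rewrite scale0r.
    by move: jn; rewrite ji leqNgt ltn_ord.
  rewrite (bigD1 (Ordinal jn))//=; case: eqnP => // _; rewrite scale1r big1 ?addr0// => i ij.
  by case: eqnP => [ji|]; [case/eqP: ij; exact: val_inj|rewrite scale0r].
- by rewrite IH1 IH2 -big_split; apply: eq_bigr => i _; rewrite scalerDl.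
- by rewrite IH1 -sumrN; apply: eq_bigr => i _; rewrite scaleNr.
- by rewrite IH1 scaler_sumr; apply: eq_bigr => i _; rewrite scalerA.
- by rewrite big1// => i _; rewrite scale0r.
Qed.

(** Atoms may be dependent, so equal coefficients are only sufficient; comparing them one by one
    leaves ring or field identities in [K]. *)
Lemma lin_reflect env e1 e2 : lin_same (size env) e1 e2 ->
  lin_eval env e1 = lin_eval env e2.
Proof.
move=> e12; rewrite !lin_evalE; apply: eq_bigr => i _; congr (_ *: _).
elim: (size env) e12 i => [_ []//|n IH /= [en e12] i].
have [->//|ni] := eqVneq (i : nat) n.
have ltin : (i < n)%N by rewrite ltn_neqAle ni -ltnS ltn_ord.
exact: IH e12 (Ordinal ltin).
Qed.

End LinearReflection.

(** The structure arguments of products and of [1] are skipped, as the same term may carry different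
    instances. *)
Ltac lin_eq x y :=
  first [constr_eq x y
  | lazymatch constr:((x, y)) with
    | (@GRing.mul _ ?a ?b, @GRing.mul _ ?c ?d) => lin_eq a c; lin_eq b d
    | (@GRing.one _, @GRing.one _) => idtac
    end].

Ltac lin_find x l :=
  match l with
  | ?y :: _ => let _ := match goal with _ => lin_eq x y end in constr:(O)
  | _ :: ?l' => let n := lin_find x l' in constr:(S n)
  end.

Ltac lin_insert x l :=
  match l with
  | _ => let n := lin_find x l in l
  | _ => constr:(x :: l)
  end.

Ltac lin_atoms t l :=
  lazymatch t with
  | @GRing.add _ ?a ?b => let l1 := lin_atoms b l in lin_atoms a l1
  | @GRing.opp _ ?a => lin_atoms a l
  | @GRing.scale _ _ _ ?a => lin_atoms a l
  | @GRing.zero _ => l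
  | _ => lin_insert t l
  end.

Ltac lin_reify K t l :=
  lazymatch t with
  | @GRing.add _ ?a ?b =>
      let x := lin_reify K a l in let y := lin_reify K b l in
      constr:(@LAdd K x y)
  | @GRing.opp _ ?a => let x := lin_reify K a l in constr:(@LOpp K x)
  | @GRing.scale _ _ ?k ?a => let x := lin_reify K a l in constr:(@LScale K k x)
  | @GRing.zero _ => constr:(@LZero K)
  | _ => let n := lin_find t l in constr:(@LAtom K n)
  end.

(* Vectors are identified up to syntactic equality only. *)
Ltac module K :=
  lazymatch goal with
  | |- @eq ?T ?lhs ?rhs =>
      let l := lin_atoms rhs (@nil T) in
      let l := lin_atoms lhs l in
      let e1 := lin_reify K lhs l in
      let e2 := lin_reify K rhs l in
      refine (@lin_reflect K _ l e1 e2 _);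
      cbn [lin_same lin_coef size eqn]; repeat (split; [first [ring | by field]|]); exact Logic.I
  end.

(** * Norms and completeness *)

Section RealNorm.
Context {R : realType}.

Lemma norm_complexr (r : R) : `|r%:C| = `|r|%:C.
Proof. by rewrite normc_def /= expr0n addr0 sqrtr_sqr. Qed.

Lemma posC_real (e : R[i]) : 0 < e -> exists2 r : R, 0 < r & e = r%:C.
Proof. by case: e => a b; rewrite ltcE /= => /andP[/eqP -> a0]; exists a. Qed.

(** The norm takes values in [R[i]], where [lra] and [nra] do not apply; this is the same number in
    [R]. *)
Definition nm (V : normedModType R[i]) (v : V) : R := complex.Re `|v|.

Variable V : normedModType R[i].
Implicit Types (u v w : V) (r : R).

Lemma nmE v : `|v| = (nm v)%:C.
Proof. by rewrite /nm RRe_real// ger0_real. Qed.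

Lemma nm_ge0 v : 0 <= nm v.
Proof. by rewrite -ler0c -nmE. Qed.

Lemma nm0 : nm (0 : V) = 0.
Proof. by rewrite /nm normr0. Qed.

Lemma nm_eq0 v : nm v = 0 -> v = 0.
Proof. by move=> v0; apply/normr0_eq0; rewrite nmE v0. Qed.

Lemma nm_le0 v : nm v <= 0 -> v = 0.
Proof. by move=> v0; apply/nm_eq0/le_anti; rewrite v0 nm_ge0. Qed.

Lemma nmD u v : nm (u + v) <= nm u + nm v.
Proof. by have := ler_normD u v; rewrite !nmE -rmorphD lecR. Qed.

Lemma nmN v : nm (- v) = nm v.
Proof. by rewrite /nm normrN. Qed.

Lemma nmBC u v : nm (u - v) = nm (v - u).
Proof. by rewrite -nmN opprB. Qed.

Lemma nm_tri w u v : nm (u - v) <= nm (u - w) + nm (w - v).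
Proof. by rewrite (le_trans _ (nmD _ _))// addrA subrK. Qed.

Lemma nmZ (c : R[i]) v : nm (c *: v) = ComplexField.Normc.normc c * nm v.
Proof.
by apply: complexI; have := normrZ c v; rewrite !nmE rmorphM.
Qed.

Lemma nmZr r v : nm (r%:C *: v) = `|r| * nm v.
Proof. by rewrite nmZ /= expr0n addr0 sqrtr_sqr. Qed.

End RealNorm.

Lemma bounded_linear_continuousC {R : realType}
    (V W : normedModType R[i]) (f : V -> W) (r : R) :
  linear f -> (forall v, nm (f v) <= r * nm v) -> continuous f.
Proof.
move=> fl fr v; apply/cvgrPdist_lt => e e0.
have [e' e'0 ->] := posC_real e0.
(* [r] may be zero or negative. *)
have r1 : 0 < `|r| + 1 by rewrite ltr_wpDl.
have d0 : 0 < (e' / (`|r| + 1))%:C by rewrite ltcR divr_gt0.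
apply/nbhs_ballP; exists (e' / (`|r| + 1))%:C => //= w; rewrite -ball_normE /ball_/=.
rewrite !nmE !ltcR => h.
have -> : f v - f w = f (v - w).
  by have := fl (-1) w v; rewrite !scaleN1r addrC => <-; rewrite addrC.
apply: le_lt_trans (fr _) _; move: h; rewrite ltr_pdivlMr//.
have := nm_ge0 (v - w); have := ler_norm r; move: (nm _) => x; nra.
Qed.

Section Completeness.

(** The rate [r] is kept for the limit, since later estimates rely on it. A general numeric field
    covers both spaces over [R[i]] and [R] itself. *)
Lemma complete_seq_norm (K : numFieldType) (V : completeNormedModType K)
    (u : nat -> V) (r : nat -> K) :
  (forall n m, (n <= m)%N -> `|u m - u n| <= r n) ->
  (forall e, 0 < e -> exists n, r n < e) ->
  exists l, forall n, `|l - u n| <= r n.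
Proof.
move=> ur r0.
have rR n : r n \is Num.real.
  by apply: ger0_real; apply: le_trans (ur _ _ (leqnn n)).
have /cauchy_cvg : cauchy (u @ \oo).
  apply/cauchy_ballP => e e0.
  have [N rN] := r0 _ (divr_gt0 e0 (ltr0n K 2)).
  exists (u @` [set n | (N <= n)%N], u @` [set n | (N <= n)%N]).
    by split; exists N => // n /= Nn; exists n.
  move=> [_ _] [[n Nn <-] [m Nm <-]] /=.
  rewrite -ball_normE /ball_/=.
  have -> : u n - u m = (u n - u N) - (u m - u N) by rewrite opprB addrA subrK.
  rewrite (le_lt_trans (ler_normB _ _))// [ltRHS]splitr.
  by rewrite (le_lt_trans (lerD (ur _ _ Nn) (ur _ _ Nm)))// ltrD.
move=> /cvg_ex[l ul]; exists l => n.
rewrite real_leNgt ?normr_real//.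
apply/negP => nr.
(* A violation of the bound by [e] is contradicted by a later term within [e] of the limit. *)
pose e := `|l - u n| - r n.
have e0 : 0 < e by rewrite subr_gt0.
have /cvgrPdist_lt/(_ _ e0)[N _ Nl] := ul.
have /Nl/= lN := leq_maxl N n.
have : `|l - u n| < e + r n.
  have -> : l - u n = (l - u (maxn N n)) + (u (maxn N n) - u n) by rewrite addrA subrK.
  by rewrite (le_lt_trans (ler_normD _ _))// ltr_leD// ur// leq_maxr.
by rewrite /e subrK ltxx.
Qed.

Context {R : realType}.

Lemma cvg0_lt (r : nat -> R) : r @ \oo --> 0 -> forall e, 0 < e -> exists n, r n < e.
Proof.
move=> r0 e e0; have /cvgrPdist_lt/(_ _ e0)[N _ Nr] := r0.
exists N; have /Nr/= := leqnn N; rewrite sub0r normrN.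
by apply: le_lt_trans; exact: ler_norm.
Qed.

Lemma decreasing_null_seq : exists h : nat -> R,
  [/\ h @ \oo --> 0, forall k m, (k <= m)%N -> h m <= h k, forall k, 0 < h k &
      forall k, h k = k.+1%:R^-1].
Proof.
exists harmonic; split=> //; [exact: cvg_harmonic| |exact: harmonic_gt0].
by move=> k m km; rewrite lef_pV2 ?posrE// ler_nat.
Qed.

Lemma complete_seq (V : completeNormedModType R[i]) (u : nat -> V) (r : nat -> R) :
  (forall n m, (n <= m)%N -> nm (u m - u n) <= r n) -> r @ \oo --> 0 ->
  exists l, forall n, nm (l - u n) <= r n.
Proof.
move=> ur /cvg0_lt r0; have [|[a b]|l lP] := @complete_seq_norm _ V u (fun n => (r n)%:C).
- by move=> n m nm; rewrite nmE lecR ur.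
- rewrite ltcE/= => /andP[/eqP b0 /r0[n rn]]; exists n.
  by rewrite ltcE/= b0 eqxx.
by exists l => n; have := lP n; rewrite nmE lecR.
Qed.

(** Real and imaginary parts converge separately at rate [r]; the factor 2 stands in for the square
    root of 2. *)
Lemma complete_complex_seq (u : nat -> R[i]) (r : nat -> R) :
  (forall n m, (n <= m)%N -> ComplexField.Normc.normc (u m - u n) <= r n) ->
  r @ \oo --> 0 ->
  exists l, forall n, ComplexField.Normc.normc (l - u n) <= r n *+ 2.
Proof.
move=> ur /cvg0_lt r0.
have Rel (z : R[i]) : `|complex.Re z| <= ComplexField.Normc.normc z.
  by have := normc_ge_Re z; rewrite lecR.
have Iml (z : R[i]) : `|complex.Im z| <= ComplexField.Normc.normc z.
  by case: z => a b /=; rewrite -sqrtr_sqr ler_wsqrtr// lerDr sqr_ge0.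
have ReB (x y : R[i]) : complex.Re (x - y) = complex.Re x - complex.Re y.
  by case: x y => a b [].
have ImB (x y : R[i]) : complex.Im (x - y) = complex.Im x - complex.Im y.
  by case: x y => a b [].
have [|a aP] := @complete_seq_norm _ R (fun n => complex.Re (u n)) r _ r0.
  by move=> n m nm; rewrite -ReB; apply: le_trans (Rel _) (ur _ _ nm).
have [|b bP] := @complete_seq_norm _ R (fun n => complex.Im (u n)) r _ r0.
  by move=> n m nm; rewrite -ImB; apply: le_trans (Iml _) (ur _ _ nm).
exists (a +i* b) => n.
have := aP n; have := bP n; case: (u n) => c d /= bd ac.
have -> : (a - c) ^+ 2 + (b - d) ^+ 2 = `|a - c| ^+ 2 + `|b - d| ^+ 2.
  by rewrite !real_normK ?num_real.
have r_ge0 : 0 <= r n by apply: le_trans ac.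
have -> : r n *+ 2 = Num.sqrt ((r n *+ 2) ^+ 2).
  by rewrite sqrtr_sqr ger0_norm// mulrn_wge0.
rewrite ler_wsqrtr// mulr2n.
have := normr_ge0 (a - c); have := normr_ge0 (b - d); nra.
Qed.

End Completeness.

(** * Algebraic identities and the norm of a C^*-algebra *)

Section CStarTheory.
Context {R : realType} {A : cstarAlgType R}.
Implicit Types (a b x y : A) (c : R[i]) (r : R).

Lemma cmulDl a b x : cmul (a + b) x = cmul a x + cmul b x.
Proof. by have := cmul_linear_l x 1 a b; rewrite !scale1r. Qed.
Lemma cmulDr a b x : cmul x (a + b) = cmul x a + cmul x b.
Proof. by have := cmul_linear_r x 1 a b; rewrite !scale1r. Qed.
Lemma cmul0l x : cmul 0 x = 0.
Proof. by apply: (addrI (cmul 0 x)); rewrite -cmulDl !addr0. Qed.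
Lemma cmul0r x : cmul x 0 = 0.
Proof. by apply: (addrI (cmul x 0)); rewrite -cmulDr !addr0. Qed.
Lemma cmulZl c a x : cmul (c *: a) x = c *: cmul a x.
Proof. by have := cmul_linear_l x c a 0; rewrite !addr0 cmul0l addr0. Qed.
Lemma cmulZr c a x : cmul x (c *: a) = c *: cmul x a.
Proof. by have := cmul_linear_r x c a 0; rewrite !addr0 cmul0r addr0. Qed.
Lemma cmulNl a x : cmul (- a) x = - cmul a x.
Proof. by rewrite -scaleN1r cmulZl scaleN1r. Qed.
Lemma cmulNr a x : cmul x (- a) = - cmul x a.
Proof. by rewrite -scaleN1r cmulZr scaleN1r. Qed.
Lemma cmulBl a b x : cmul (a - b) x = cmul a x - cmul b x.
Proof. by rewrite cmulDl cmulNl. Qed.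
Lemma cmulBr a b x : cmul x (a - b) = cmul x a - cmul x b.
Proof. by rewrite cmulDr cmulNr. Qed.
Lemma cstarD a b : cstar (a + b) = cstar a + cstar b.
Proof. by have := cstar_antilinear 1 a b; rewrite rmorph1 !scale1r. Qed.
Lemma cstar0 : cstar (0 : A) = 0.
Proof. by apply: (addrI (cstar 0)); rewrite -cstarD !addr0. Qed.
Lemma cstarZ c a : cstar (c *: a) = conjc c *: cstar a.
Proof. by have := cstar_antilinear c a 0; rewrite !addr0 cstar0 addr0. Qed.
Lemma cstarZr r a : cstar (r%:C *: a) = r%:C *: cstar a.
Proof. by rewrite cstarZ conjc_real. Qed.
Lemma cstarN a : cstar (- a) = - cstar a.
Proof. by rewrite -scaleN1r cstarZ rmorphN rmorph1 scaleN1r. Qed.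
Lemma cstarB a b : cstar (a - b) = cstar a - cstar b.
Proof. by rewrite cstarD cstarN. Qed.

Lemma nmM a b : nm (cmul a b) <= nm a * nm b.
Proof. by have := cnormM a b; rewrite !nmE -rmorphM lecR. Qed.

Lemma nm_starM a : nm (cmul (cstar a) a) = nm a ^+ 2.
Proof. by apply: complexI; have := cnorm_cstar a; rewrite !nmE rmorphXn. Qed.

Lemma nm_star a : nm (cstar a) = nm a.
Proof.
have le b : nm b <= nm (cstar b).
  have := nm_ge0 b; rewrite le_eqVlt => /predU1P[<-|b0]; first exact: nm_ge0.
  by rewrite -(ler_pM2r b0) -expr2 -nm_starM nmM.
by apply: le_anti; rewrite le -{2}(cstarK a) le.
Qed.

Lemma cmul_faithful a : (forall x, cmul x a = 0) -> a = 0.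
Proof.
by move=> a0; apply/nm_eq0/eqP; rewrite -sqrf_eq0 -nm_starM a0 nm0.
Qed.

End CStarTheory.

(** * The multiplier algebra *)

Section MultiplierAlgebra.
Context {R : realType} {A : cstarAlgType R}.
Implicit Types (x y z : A).

(** A is a Hilbert module over itself for the inner product x^* y, and S is the adjoint of T for it.
    The adjointable operators are the multipliers of A and supply the unit that A may lack. *)
Definition adjoint (T S : A -> A) :=
  forall x y, cmul (cstar (S x)) y = cmul (cstar x) (T y).

Definition bounded_by (T : A -> A) (r : R) := forall x, nm (T x) <= r * nm x.

Definition adjointable (T : A -> A) : bool :=
  `[< (exists S, adjoint T S) /\ exists r, bounded_by T r >].

Lemma adjoint_sym T S : adjoint T S -> adjoint S T.
Proof.
by move=> TS x y; rewrite -[LHS]cstarK cstarM cstarK -TS cstarM cstarK.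
Qed.

Lemma cmul_ext (a b : A) : (forall x, cmul (cstar x) a = cmul (cstar x) b) -> a = b.
Proof.
move=> ab; apply/eqP; rewrite -subr_eq0; apply/eqP/cmul_faithful => x.
by rewrite cmulBr -(cstarK x) ab subrr.
Qed.

(** The products z^* y with all z determine y; moving T to the other side leaves only the linearity
    of the product. *)
Lemma adjoint_linear T S : adjoint T S -> linear T.
Proof.
move=> TS c x y; apply: cmul_ext => z.
by rewrite cmulDr cmulZr -!TS cmulDr cmulZr.
Qed.

Lemma adjoint_cmul T S x y : adjoint T S -> T (cmul x y) = cmul (T x) y.
Proof. by move=> TS; apply: cmul_ext => z; rewrite cmulA -!TS cmulA. Qed.

(** |S x|^2 = |x^* T (S x)| <= |x| r |S x|, and |S x| cancels. *)
Lemma adjoint_bounded T S r : 0 <= r ->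
  adjoint T S -> bounded_by T r -> bounded_by S r.
Proof.
move=> r0 TS Tr x; have := nm_ge0 (S x); rewrite le_eqVlt => /predU1P[<-|Sx0].
  by rewrite mulr_ge0// nm_ge0.
rewrite -(ler_pM2r Sx0) -expr2 -nm_starM TS (le_trans (nmM _ _))// nm_star.
by rewrite (le_trans (ler_wpM2l (nm_ge0 x) (Tr _)))// mulrA (mulrC (nm x)).
Qed.

Lemma bounded_by_ge0 T r : bounded_by T r -> bounded_by T `|r|.
Proof.
by move=> Tr x; rewrite (le_trans (Tr x))// ler_wpM2r ?nm_ge0// ler_norm.
Qed.

Lemma adjointable_submod : submod_closed adjointable.
Proof.
split=> [|c T T']; rewrite /in_mem /=.
  apply/asboolP; split; first by exists 0 => x y; rewrite cstar0 cmul0l cmul0r.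
  by exists 0 => x; rewrite nm0 mul0r.
move=> /asboolP[[S TS] [r Tr]] /asboolP[[S' TS'] [r' Tr']].
apply/asboolP; split.
  exists (fun x => conjc c *: S x + S' x) => x y.
  rewrite cstarD cstarZ conjcK cmulDl cmulZl TS TS'.
  by rewrite [(_ + _)%R y]/(c *: T y + T' y) cmulDr cmulZr.
exists (ComplexField.Normc.normc c * r + r') => x.
rewrite [(_ + _)%R x]/(c *: T x + T' x) (le_trans (nmD _ _))// nmZ.
rewrite mulrDl lerD// -mulrA ler_wpM2l//.
by case: (c) => a b /=; exact: sqrtr_ge0.
Qed.

HB.instance Definition _ :=
  GRing.isSubmodClosed.Build R[i] (A -> A) adjointable adjointable_submod.

Record mult : Type := Mult { mult_fun :> A -> A ; _ : mult_fun \in adjointable }.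
HB.instance Definition _ := [isSub of mult for mult_fun].
HB.instance Definition _ := gen_eqMixin mult.
HB.instance Definition _ := gen_choiceMixin mult.
HB.instance Definition _ := [SubChoice_isSubLmodule of mult by <:].

End MultiplierAlgebra.
Arguments mult {R} A.

Section MultiplierRing.
Context {R : realType} {A : cstarAlgType R}.
Local Notation M := (mult A).
Implicit Types (S T : M) (r s t : R) (c : R[i]).

Lemma mult_ext S T : (forall x, S x = T x) -> S = T.
Proof. by move=> ST; apply/val_inj/funext. Qed.

Lemma multP T : exists S : A -> A, adjoint T S.
Proof. by have /asboolP[] : adjointable T := valP T. Qed.

Lemma mult_bounded T : exists2 r, 0 < r & bounded_by T r.
Proof.
have /asboolP[_ [r Tr]] : adjointable T := valP T.
exists (`|r| + 1).
  by rewrite ltr_wpDl.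
move=> x; rewrite (le_trans (bounded_by_ge0 Tr x))// ler_wpM2r ?nm_ge0//.
by rewrite lerDl.
Qed.

Definition mult_adj T : A -> A := sval (cid (multP T)).

Lemma mult_adjP T : adjoint T (mult_adj T).
Proof. exact: (svalP (cid (multP T))). Qed.

Lemma mult_linear T : linear T.
Proof. exact: adjoint_linear (@mult_adjP T). Qed.

HB.instance Definition _ T :=
  GRing.isLinear.Build R[i] A A *:%R (mult_fun T) (mult_linear T).

Lemma mult_adj_subproof T : mult_adj T \in adjointable.
Proof.
have [r r0 Tr] := mult_bounded T; apply/asboolP; split.
  by exists T; apply/adjoint_sym/mult_adjP.
by exists r; exact: adjoint_bounded (ltW r0) (@mult_adjP T) Tr.
Qed.

Definition mstar T : M := Mult (mult_adj_subproof T).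

Lemma mstarP T x y : cmul (cstar (mstar T x)) y = cmul (cstar x) (T y).
Proof. exact: mult_adjP. Qed.

Lemma mstar_uniq T S :
  (forall x y, cmul (cstar (S x)) y = cmul (cstar x) (T y)) -> mstar T = S.
Proof.
move=> TS; apply: mult_ext => x; apply: cmul_ext => y.
by apply: (can_inj (@cstarK R A)); rewrite !cstarM cstarK mstarP TS.
Qed.

Lemma mult_one_subproof : id \in @adjointable R A.
Proof.
by apply/asboolP; split; [exists id|exists 1 => x; rewrite mul1r].
Qed.

Lemma mult_mul_subproof S T : (S : A -> A) \o T \in adjointable.
Proof.
have [r r0 Sr] := mult_bounded S; have [s s0 Ts] := mult_bounded T.
apply/asboolP; split.
  by exists (mstar T \o mstar S) => x y /=; rewrite !mstarP.
exists (r * s) => x /=; apply: (le_trans (Sr _)).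
by rewrite -mulrA; apply: ler_wpM2l (Ts x); exact: ltW.
Qed.

Definition mult_one : M := Mult mult_one_subproof.
Definition mult_mul S T : M := Mult (mult_mul_subproof S T).

HB.instance Definition _ := @GRing.Zmodule_isPzRing.Build M
  mult_one mult_mul
  (fun S T U => @mult_ext (mult_mul S (mult_mul T U)) (mult_mul (mult_mul S T) U) (fun x => erefl))
  (fun T => @mult_ext (mult_mul mult_one T) T (fun x => erefl))
  (fun T => @mult_ext (mult_mul T mult_one) T (fun x => erefl))
  (fun S T U => @mult_ext (mult_mul (S + T) U) (mult_mul S U + mult_mul T U) (fun x => erefl))
  (fun S T U => @mult_ext (mult_mul S (T + U)) (mult_mul S T + mult_mul S U)
     (fun x => linearD S (T x) (U x))).

Lemma mulE S T x : (S * T) x = S (T x). Proof. by []. Qed.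
Lemma addE S T x : (S + T) x = S x + T x. Proof. by []. Qed.
Lemma oppE T x : (- T) x = - T x. Proof. by []. Qed.
Lemma scaleE c T x : (c *: T) x = c *: T x. Proof. by []. Qed.
Lemma oneE x : (1 : M) x = x. Proof. by []. Qed.

Lemma mscaleAl c S T : (c *: S) * T = c *: (S * T).
Proof. exact: mult_ext. Qed.
Lemma mscaleAr c S T : S * (c *: T) = c *: (S * T).
Proof. by apply: mult_ext => x; rewrite !(mulE, scaleE) linearZ. Qed.

Lemma mstarK : involutive mstar.
Proof. by move=> T; apply: mstar_uniq => x y; rewrite -[LHS]cstarK cstarM cstarK -mstarP cstarM cstarK. Qed.
Lemma mstarD S T : mstar (S + T) = mstar S + mstar T.
Proof. by apply: mstar_uniq => x y; rewrite !addE cstarD cmulDl cmulDr !mstarP. Qed.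
Lemma mstarZ c T : mstar (c *: T) = conjc c *: mstar T.
Proof. by apply: mstar_uniq => x y; rewrite !scaleE cstarZ conjcK cmulZl cmulZr mstarP. Qed.
Lemma mstarZr r T : mstar (r%:C *: T) = r%:C *: mstar T.
Proof. by rewrite mstarZ conjc_real. Qed.
Lemma mstarM S T : mstar (S * T) = mstar T * mstar S.
Proof. by apply: mstar_uniq => x y; rewrite !mulE !mstarP. Qed.
Lemma mstar1 : mstar 1 = 1. Proof. exact: mstar_uniq. Qed.
Lemma mstarN T : mstar (- T) = - mstar T.
Proof. by rewrite -scaleN1r mstarZ rmorphN rmorph1 scaleN1r. Qed.
Lemma mstarB S T : mstar (S - T) = mstar S - mstar T.
Proof. by rewrite mstarD mstarN. Qed.
Lemma mstar0 : mstar 0 = 0.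
Proof. by rewrite -[in LHS](subrr 0) mstarB subrr. Qed.

Lemma mult_of_subproof (a : A) : cmul a \in adjointable.
Proof.
apply/asboolP; split; last by exists (nm a) => x; exact: nmM.
by exists (cmul (cstar a)) => x y; rewrite cstarM cstarK cmulA.
Qed.

Definition mult_of (a : A) : M := Mult (mult_of_subproof a).

Lemma mult_ofE a x : mult_of a x = cmul a x. Proof. by []. Qed.
Lemma mult_ofD a b : mult_of (a + b) = mult_of a + mult_of b.
Proof. by apply: mult_ext => x; rewrite addE !mult_ofE cmulDl. Qed.
Lemma mult_ofZ c a : mult_of (c *: a) = c *: mult_of a.
Proof. by apply: mult_ext => x; rewrite scaleE !mult_ofE cmulZl. Qed.
Lemma mult_ofN a : mult_of (- a) = - mult_of a.
Proof. by rewrite -scaleN1r mult_ofZ scaleN1r. Qed.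
Lemma mult_of0 : mult_of 0 = 0.
Proof. by rewrite -(scale0r 0) mult_ofZ scale0r. Qed.
Lemma mult_ofM a b : mult_of (cmul a b) = mult_of a * mult_of b.
Proof. by apply: mult_ext => x; rewrite mulE !mult_ofE cmulA. Qed.
Lemma mstar_of a : mstar (mult_of a) = mult_of (cstar a).
Proof. by apply: mstar_uniq => x y; rewrite !mult_ofE cstarM cstarK cmulA. Qed.
Lemma mult_cmul T x y : T (cmul x y) = cmul (T x) y.
Proof. exact: adjoint_cmul (@mult_adjP T). Qed.
Lemma mul_mult_of T a : T * mult_of a = mult_of (T a).
Proof. by apply: mult_ext => x; rewrite mulE !mult_ofE mult_cmul. Qed.

(** Upper bounds take the place of the operator norm; [0 <= r] allows them to be multiplied. *)
Definition bnd T r := 0 <= r /\ bounded_by T r.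

Lemma bnd_ex T : exists2 r, 0 < r & bnd T r.
Proof. by have [r r0 Tr] := mult_bounded T; exists r => //; split=> //; exact: ltW. Qed.
Lemma bndW r s T : bnd T r -> r <= s -> bnd T s.
Proof.
move=> [r0 Tr] rs; split; first exact: le_trans rs.
by move=> x; rewrite (le_trans (Tr x))// ler_wpM2r ?nm_ge0.
Qed.
Lemma bnd1 : bnd 1 1.
Proof. by split=> // x; rewrite mul1r. Qed.
Lemma bndD S T r s : bnd S r -> bnd T s -> bnd (S + T) (r + s).
Proof.
move=> [r0 Sr] [s0 Ts]; split; first exact: addr_ge0.
by move=> x; rewrite addE (le_trans (nmD _ _))// mulrDl lerD.
Qed.
Lemma bndM S T r s : bnd S r -> bnd T s -> bnd (S * T) (r * s).
Proof.
move=> [r0 Sr] [s0 Ts]; split; first exact: mulr_ge0.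
by move=> x; rewrite mulE (le_trans (Sr _))// -mulrA ler_wpM2l.
Qed.
Lemma bndZ s T r : bnd T r -> bnd (s%:C *: T) (`|s| * r).
Proof.
move=> [r0 Tr]; split; first exact: mulr_ge0.
by move=> x; rewrite scaleE nmZr -mulrA ler_wpM2l.
Qed.
Lemma bndN T r : bnd T r -> bnd (- T) r.
Proof. by move=> [r0 Tr]; split=> // x; rewrite oppE nmN. Qed.
Lemma bndB S T r s : bnd S r -> bnd T s -> bnd (S - T) (r + s).
Proof. by move=> Sr /bndN; exact: bndD. Qed.
Lemma bnd_star T r : bnd T r -> bnd (mstar T) r.
Proof. by move=> [r0 Tr]; split=> //; exact: adjoint_bounded (@mult_adjP T) _. Qed.
(** By the C^*-identity of A, |T x|^2 = |x^* (T^* T x)|. *)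
Lemma bnd_cstar T r : 0 <= r -> bnd (mstar T * T) (r ^+ 2) -> bnd T r.
Proof.
move=> r0 [_ Tr]; split=> // x.
rewrite -ler_sqr ?nnegrE ?mulr_ge0 ?nm_ge0// -nm_starM.
have -> : cmul (cstar (T x)) (T x) = cmul (cstar x) ((mstar T * T) x).
  by rewrite mulE -(mstarP (mstar T)) mstarK.
rewrite (le_trans (nmM _ _))// nm_star exprMn expr2 (expr2 (nm x)).
by rewrite mulrA [leRHS]mulrC ler_wpM2l ?nm_ge0// -expr2 Tr.
Qed.
Lemma bnd0_eq T : bnd T 0 -> T = 0.
Proof.
by move=> [_ T0]; apply: mult_ext => x; apply: nm_le0; rewrite -(mul0r (nm x)).
Qed.
Lemma bnd_of a : bnd (mult_of a) (nm a).
Proof. by split; [exact: nm_ge0|move=> x; exact: nmM]. Qed.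
(** Evaluate at a^*, where |a a^*| = |a|^2. *)
Lemma bnd_of_le a r : bnd (mult_of a) r -> nm a <= r.
Proof.
move=> [r0 ar]; have := nm_ge0 a; rewrite le_eqVlt => /predU1P[<-//|a0].
have := ar (cstar a); rewrite mult_ofE -[X in cmul X _](cstarK a) nm_starM nm_star.
by rewrite expr2 ler_pM2r.
Qed.

End MultiplierRing.

(** * Square roots and positive multipliers *)

Section Positivity.
Context {R : realType} {A : cstarAlgType R}.
Local Notation M := (mult A).
Implicit Types (S T U : M) (r s t : R) (c : R[i]) (a b : A).

Lemma bnd_lim T (C : R) (d : nat -> R) :
  d @ \oo --> 0 -> (forall n, bnd T (C * d n)) -> T = 0.
Proof.
move=> d0 Td; apply: bnd0_eq; split=> // x; rewrite mul0r.
have Cd : (fun n => C * d n * nm x) @ \oo --> (0 : R).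
  rewrite -(mul0r (nm x)) -(mulr0 C); apply: cvgMl; exact: cvgMr.
rewrite -(cvg_lim _ Cd)//; apply: limr_ge; first by apply/cvg_ex; exists 0.
by near=> n; have [_] := Td n; apply.
Unshelve. all: by end_near. Qed.

(** Pointwise limits suffice: the adjoints converge at the same rate, and their limit is adjoint to
    the limit of the sequence. *)
Lemma mult_complete (T : nat -> M) (d : nat -> R) :
  (forall n m, (n <= m)%N -> bnd (T m - T n) (d n)) -> d @ \oo --> 0 ->
  exists U, forall n, bnd (U - T n) (d n).
Proof.
move=> Td d0.
have /choice[U UP] : forall x, exists l, forall n, nm (l - T n x) <= d n * nm x.
  move=> x; apply: (complete_seq (r := fun n => d n * nm x)) => [n m nm|].
    by have [_] := Td _ _ nm; apply.
  by rewrite -(mul0r (nm x)); exact: cvgMl.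
have /choice[V VP] : forall x, exists l, forall n, nm (l - mstar (T n) x) <= d n * nm x.
  move=> x; apply: (complete_seq (r := fun n => d n * nm x)) => [n m nm|].
    by have /bnd_star := Td _ _ nm; rewrite mstarB => -[_]; apply.
  by rewrite -(mul0r (nm x)); exact: cvgMl.
have d_ge0 n : 0 <= d n by have [] := Td _ _ (leqnn n).
have UV : adjoint U V.
  move=> x y; apply/eqP; rewrite -subr_eq0; apply/eqP/nm_le0.
  have K : (fun n => d n * (2 * nm x * nm y)) @ \oo --> (0 : R).
    by rewrite -(mul0r (2 * nm x * nm y)); exact: cvgMl.
  rewrite -(cvg_lim _ K)//; apply: limr_ge; first by apply/cvg_ex; exists 0.
  near=> n.
  have -> : cmul (cstar (V x)) y - cmul (cstar x) (U y) =
            cmul (cstar (V x - mstar (T n) x)) y - cmul (cstar x) (U y - T n y).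
    by rewrite cstarB cmulBl cmulBr mstarP; module R[i].
  rewrite (le_trans (nmD _ _))// nmN.
  have h1 := ler_wpM2r (nm_ge0 y) (VP x n).
  have h2 := ler_wpM2l (nm_ge0 x) (UP y n).
  have := nmM (cstar (V x - mstar (T n) x)) y.
  have := nmM (cstar x) (U y - T n y).
  rewrite !nm_star; lra.
have Uadj : U \in adjointable.
  apply/asboolP; split; first by exists V.
  have [r r0 [_ Tr]] := bnd_ex (T 0); exists (d 0 + r) => x.
  rewrite mulrDl -[U x](subrK (T 0 x)) (le_trans (nmD _ _))// lerD//.
by exists (Mult Uadj) => n; split=> // x; exact: UP.
Unshelve. all: by end_near. Qed.

(** Here 1 - u is the square root of 1 - w: the equation reads u = (u^2 + w) / 2 and is solved by
    iteration from 0. Every iterate is a polynomial in w, hence the commutation clause. *)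
Lemma mult_sqrt_aux (w : M) : bnd w 1 -> mstar w = w ->
  exists u, [/\ mstar u = u, (1 - u) * (1 - u) = 1 - w, bnd u 1 &
                forall z, GRing.comm z w -> GRing.comm z u].
Proof.
move=> w1 ws.
pose u := fix u n := if n is n'.+1 then (2^-1)%:C *: (u n' * u n' + w) else 0.
(* The same iteration for the scalar w = 1. Its increments dominate those of [u], and it converges,
   being increasing and at most 1; so [u] converges even when w has norm 1. *)
pose r := fix r n : R := if n is n'.+1 then (r n' ^+ 2 + 1) / 2 else 0.
have us n : mstar (u n) = u n.
  by elim: n => [|n IH] /=; rewrite ?mstar0// mstarZr mstarD mstarM IH ws.
have uc z n : GRing.comm z w -> GRing.comm z (u n).
  move=> zw; elim: n => [|n IH] /=; first exact: commr0.
  rewrite /GRing.comm mscaleAl mscaleAr; congr (_ *: _).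
  by apply: commrD => //; exact: commrM.
have r01 n : 0 <= r n <= 1.
  by elim: n => [|n] /=; [rewrite lexx ler01|nra].
have unr n : bnd (u n) (r n).
  elim: n => [|n IH] /=; first by split=> // x; rewrite nm0 mul0r.
  apply: bndW (bndZ _ (bndD (bndM IH IH) w1)) _.
  by rewrite ger0_norm ?invr_ge0// mulrC.
have du n : bnd (u n.+1 - u n) (r n.+1 - r n).
  elim: n => [|n IH].
    by rewrite !subr0 -[X in bnd X]/((2^-1)%:C *: (0 * 0 + w)) mul0r add0r;
       apply: bndW (bndZ _ w1) _; rewrite /= ger0_norm ?invr_ge0//; lra.
  have -> : u n.+2 - u n.+1 = (2^-1)%:C *: ((u n.+1 - u n) * (u n.+1 + u n)).
    have c : u n * u n.+1 = u n.+1 * u n by apply: (uc _ n.+1); apply: commr_sym; apply: uc.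
    rewrite -[u n.+2]/((2^-1)%:C *: (u n.+1 * u n.+1 + w)).
    rewrite -[X in _ - X]/((2^-1)%:C *: (u n * u n + w)) -scalerBr; congr (_ *: _).
    by rewrite mulrBl !mulrDr c; module R[i].
  apply: bndW (bndZ _ (bndM IH (bndD (unr _) (unr _)))) _.
  rewrite ger0_norm ?invr_ge0// -[r n.+2]/((r n.+1 ^+ 2 + 1) / 2).
  by rewrite -{4}[r n.+1]/((r n ^+ 2 + 1) / 2); lra.
have rmono : nondecreasing_seq r.
  apply/nondecreasing_seqP => n.
  by have [+ _] := du n; rewrite subr_ge0.
have umr n m : (n <= m)%N -> bnd (u m - u n) (r m - r n).
  move=> /subnK <-; elim: (m - n)%N => [|k IH].
    by rewrite add0n !subrr; split=> // x; rewrite nm0 mul0r.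
  have -> : u (k.+1 + n)%N - u n = (u (k + n).+1 - u (k + n)%N) + (u (k + n)%N - u n).
    by rewrite addrA subrK.
  by apply: bndW (bndD (du _) IH) _; rewrite addSn addrA subrK.
have rcvg : cvgn r.
  by apply: nondecreasing_is_cvgn => //; exists 1 => _ [n _ <-]; case/andP: (r01 n).
pose d n := limn r - r n.
have d0 : d @ \oo --> 0.
  by rewrite -(subrr (limn r)); apply: cvgB => //; exact: cvg_cst.
have [|U Ud] := mult_complete (T := u) (d := d) _ d0.
  move=> n m nm; apply: bndW (umr _ _ nm) _.
  by rewrite /d lerD2r; exact: nondecreasing_cvgn_le.
have d1 n : 0 <= d n by have [] := Ud n.
have U1 : bnd U 1.
  split=> // x; rewrite mul1r.
  have K : (fun n => d n * nm x + nm x) @ \oo --> nm x.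
    by rewrite -[X in _ --> X]add0r -(mul0r (nm x)); apply: cvgD; [exact: cvgMl|exact: cvg_cst].
  rewrite -(cvg_lim _ K)//; apply: limr_ge; first by apply/cvg_ex; exists (nm x).
  near=> n; rewrite -[U x](subrK (u n x)) (le_trans (nmD _ _))// lerD//.
    by have [_] := Ud n; apply.
  have [_ /(_ x)] := unr n; have /andP[_] := r01 n; have := nm_ge0 x; nra.
exists U; split=> //.
- apply/eqP; rewrite -subr_eq0; apply/eqP/(bnd_lim (C := 2) d0) => n.
  have -> : mstar U - U = mstar (U - u n) - (U - u n).
    by rewrite mstarB us; module R[i].
  by apply: bndW (bndB (bnd_star (Ud n)) (Ud n)) _; lra.
- have E : U - (2^-1)%:C *: (U * U + w) = 0.
    have dS : (fun n => d n.+1 + d n) @ \oo --> (0 : R).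
      by rewrite -(addr0 0); apply: cvgD => //; rewrite -cvg_shiftS in d0.
    apply: (bnd_lim (C := 1) dS) => n.
    have -> : U - (2^-1)%:C *: (U * U + w) =
       (U - u n.+1) - (2^-1)%:C *: ((U - u n) * U + u n * (U - u n)).
      rewrite mulrBl mulrBr -[u n.+1]/((2^-1)%:C *: (u n * u n + w)); module R[i].
    have := bndB (Ud n.+1) (bndZ 2^-1 (bndD (bndM (Ud n) U1) (bndM (unr n) (Ud n)))).
    move/bndW; apply; rewrite ger0_norm ?invr_ge0//.
    by have /andP[_] := r01 n; have := d1 n; nra.
  have E2 : 2%:R%:C *: U = U * U + w.
    move/eqP: E; rewrite subr_eq0 => /eqP{1}->.
    by rewrite scalerA -rmorphM/= divff// scale1r.
  have -> : w = 2%:R%:C *: U - U * U by rewrite E2 addrC addKr.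
  by rewrite mulrBl mul1r mulrBr mulr1; module R[i].
- move=> z zw; have [C C0 zC] := bnd_ex z.
  apply/eqP; rewrite -subr_eq0; apply/eqP/(bnd_lim (C := 2 * C) d0) => n.
  have -> : z * U - U * z = z * (U - u n) - (U - u n) * z.
    by rewrite mulrBr mulrBl (uc z n zw); module R[i].
  by apply: bndW (bndB (bndM zC (Ud n)) (bndM (Ud n) zC)) _; lra.
Unshelve. all: by end_near. Qed.

End Positivity.

Section Positivity.
Context {R : realType} {A : cstarAlgType R}.
Local Notation M := (mult A).
Implicit Types (S T U : M) (r t : R) (c : R[i]) (a b : A).

Lemma commZr (c : R[i]) S T : GRing.comm S T -> GRing.comm S (c *: T).
Proof. by rewrite /GRing.comm mscaleAl mscaleAr => ->. Qed.

(** S is the real part of z = S + i T, and z^* z = S^2 + T^2 since S and T commute. This serves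
    wherever monotonicity of the norm on positive elements would be invoked. *)
Lemma bnd_summand S T r : mstar S = S -> mstar T = T -> GRing.comm S T ->
  0 <= r -> bnd (S * S + T * T) (r ^+ 2) -> bnd S r.
Proof.
move=> Ss Ts ST r0 STr; pose z := S + 'i%C *: T.
have zs : mstar z = S - 'i%C *: T.
  rewrite mstarD mstarZ Ss Ts; congr (_ + _).
  by rewrite -scaleNr; congr (_ *: _); apply/eqP; rewrite eq_complex/= oppr0 !eqxx.
have zr : bnd z r.
  apply: bnd_cstar => //; rewrite zs.
  have -> : (S - 'i%C *: T) * z = S * S + T * T; last by [].
  rewrite /z mulrBl !mulrDr !mscaleAl !mscaleAr ST.
  have i2 : 'i%C *: ('i%C *: (T * T)) = - (T * T).
    by rewrite scalerA -expr2 sqr_i scaleN1r.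
  by rewrite i2; module R[i].
have -> : S = (2^-1)%:C *: (z + mstar z).
  by rewrite zs /z; module R[i].
apply: bndW (bndZ _ (bndD zr (bnd_star zr))) _.
by rewrite ger0_norm ?invr_ge0//; lra.
Qed.

(** For self-adjoint T the bound says that the spectrum lies in [0, 2 t]. In this form stability
    under sums is the triangle inequality, whereas positivity of squares needs a proof. *)
Definition pos T := mstar T = T /\ exists t, bnd (t%:C *: (1 : M) - T) t.

Lemma pos_ge T t : bnd (t%:C *: (1 : M) - T) t ->
  forall s, t <= s -> bnd (s%:C *: (1 : M) - T) s.
Proof.
move=> Tt s ts; have -> : s%:C *: (1 : M) - T = (s - t)%:C *: (1 : M) + (t%:C *: (1 : M) - T).
  by module R[i].
by apply: bndW (bndD (bndZ _ bnd1) Tt) _; rewrite ger0_norm ?subr_ge0//; lra.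
Qed.

Lemma posD S T : pos S -> pos T -> pos (S + T).
Proof.
move=> [Ss [s S1]] [Ts [t T1]]; split; first by rewrite mstarD Ss Ts.
exists (s + t); apply: bndW (_ : bnd _ (s + t)) _ => //.
have -> : (s + t)%:C *: (1 : M) - (S + T) = (s%:C *: (1 : M) - S) + (t%:C *: (1 : M) - T).
  by module R[i].
exact: bndD.
Qed.

Lemma posZ r T : 0 <= r -> pos T -> pos (r%:C *: T).
Proof.
move=> r0 [Ts [t Tt]]; split; first by rewrite mstarZr Ts.
exists (r * t); have -> : (r * t)%:C *: (1 : M) - r%:C *: T = r%:C *: (t%:C *: (1 : M) - T).
  by module R[i].
by apply: bndW (bndZ _ Tt) _; rewrite ger0_norm.
Qed.

Lemma pos0 : pos 0.
Proof.
split; first exact: mstar0.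
by exists 0; rewrite subr0 scale0r; split=> // x; rewrite nm0 mul0r.
Qed.

Lemma pos_of_bnd r T : mstar T = T -> bnd T r -> pos (r%:C *: (1 : M) - T).
Proof.
move=> Ts Tr; split; first by rewrite mstarB mstarZr mstar1 Ts.
by exists r; rewrite opprB addrC subrK.
Qed.

(** After division by t, 1 - T / t has norm at most 1, and [mult_sqrt_aux] gives u with (1 - u)^2 =
    T / t. *)
Lemma pos_sqrt T : pos T -> exists S, [/\ mstar S = S, S * S = T, pos S &
  forall z, GRing.comm z T -> GRing.comm z S].
Proof.
move=> [Ts [t0 T0]]; pose t := `|t0| + 1.
have t_gt0 : 0 < t by rewrite /t ltr_wpDl.
have Tt : bnd (t%:C *: (1 : M) - T) t.
  by apply: pos_ge T0 _ _; rewrite /t ler_wpDr// ler_norm.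
have tV : (t^-1)%:C *: (t%:C *: (1 : M) : M) = 1.
  by rewrite scalerA -rmorphM/= mulVf ?scale1r// gt_eqF.
have [||u [us uu u1 uc]] := @mult_sqrt_aux R A (1 - (t^-1)%:C *: T).
- have -> : 1 - (t^-1)%:C *: T = (t^-1)%:C *: (t%:C *: (1 : M) - T).
    by rewrite scalerBr tV.
  by apply: bndW (bndZ _ Tt) _; rewrite ger0_norm ?invr_ge0 ?(ltW t_gt0)// mulVf// gt_eqF.
- by rewrite mstarB mstar1 mstarZr Ts.
pose q := Num.sqrt t; have qq : q * q = t by rewrite -expr2 sqr_sqrtr// ltW.
have q0 : 0 <= q by exact: sqrtr_ge0.
have u's : mstar (1 - u) = 1 - u by rewrite mstarB mstar1 us.
exists (q%:C *: (1 - u)); split.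
- by rewrite mstarZr u's.
- rewrite mscaleAl mscaleAr uu scalerA -rmorphM/= qq opprB addrC subrK scalerA.
  by rewrite -rmorphM/= divff ?scale1r// gt_eqF.
- by apply: posZ => //; rewrite -[X in X - u]scale1r; exact: pos_of_bnd.
- move=> z zT; apply/commZr/commrB; first exact: commr1.
  by apply: uc; apply: commrB; [exact: commr1|exact: commZr].
Qed.

(** For w = S / r of norm at most 1, write 1 - w^2 = v^2 with v = 1 - u. Then v^2 + w^2 = 1 forces
    |v| <= 1, so |1 - w^2| <= 1. *)
Lemma pos_sqr S : mstar S = S -> pos (S * S).
Proof.
move=> Ss; have [r r0 Sr] := bnd_ex S; split; first by rewrite mstarM Ss.
pose w := (r^-1)%:C *: S; have ws : mstar w = w by rewrite mstarZr Ss.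
have w1 : bnd (w * w) 1.
  have : bnd w 1.
    apply: bndW (bndZ _ Sr) _.
    by rewrite ger0_norm ?invr_ge0 ?(ltW r0)// mulVf// gt_eqF.
  by move=> /[dup] h /(bndM h); rewrite mulr1.
have [|u [us uu u1 uc]] := mult_sqrt_aux w1; first by rewrite mstarM ws.
have u's : mstar (1 - u) = 1 - u by rewrite mstarB mstar1 us.
have wu : GRing.comm w (1 - u).
  by apply: commrB; [exact: commr1|apply: uc; apply: commrM].
have u'1 : bnd (1 - u) 1.
  apply: (bnd_summand u's ws (commr_sym wu) ler01).
  by rewrite uu expr1n subrK; exact: bnd1.
exists (r ^+ 2).
have -> : (r ^+ 2)%:C *: (1 : M) - S * S = (r ^+ 2)%:C *: ((1 - u) * (1 - u)).
  rewrite uu scalerBr /w mscaleAl mscaleAr !scalerA -!rmorphM/=.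
  by rewrite -mulrA -invfM mulrA divff ?scale1r// mulf_neq0// gt_eqF.
apply: bndW (bndZ _ (bndM u'1 u'1)) _.
by rewrite ger0_norm ?mulr1// exprn_ge0 ?ltW.
Qed.

(** With p^2 = r - S and q^2 = r + S one has S^2 + (p q)^2 = r^2. *)
Lemma bnd_pos_summand S r : pos (r%:C *: (1 : M) - S) -> pos (r%:C *: (1 : M) + S) ->
  mstar S = S -> 0 <= r -> bnd S r.
Proof.
move=> /pos_sqrt[p [ps pp _ pc]] /pos_sqrt[q [qs qq _ qc]] Ss r0.
have Sp : GRing.comm S p.
  by apply: pc; apply: commrB => //; apply: commZr; exact: commr1.
have Sq : GRing.comm S q.
  by apply: qc; apply: commrD => //; apply: commZr; exact: commr1.
have pq : GRing.comm p q.
  apply: qc; apply: commrD; first by apply: commZr; exact: commr1.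
  exact: commr_sym.
apply: (@bnd_summand _ (p * q)) => //.
- by rewrite mstarM ps qs.
- exact: commrM.
have -> : p * q * (p * q) = (p * p) * (q * q).
  by rewrite -!mulrA (mulrA q) -pq !mulrA.
rewrite pp qq mulrBl !mulrDr !mscaleAl !mscaleAr !mulr1 !mul1r !scalerA.
have -> : forall x : M, S * S + (x + r%:C *: S - (r%:C *: S + S * S)) = x.
  by move=> x; module R[i].
by rewrite -rmorphM -expr2; apply: bndW (bndZ _ bnd1) _; rewrite mulr1 ger0_norm ?sqr_ge0.
Qed.

(** The square roots p of S and q of - S commute and p^2 + q^2 = 0, so [bnd_summand] bounds p by
    0. *)
Lemma pos_anti S : pos S -> pos (- S) -> S = 0.
Proof.
move=> /pos_sqrt[p [ps pp _ pc]] /pos_sqrt[q [qs qq _ qc]].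
have pq : GRing.comm p q.
  by apply: qc; apply: commrN; rewrite -pp; exact: commrM.
suff p0 : p = 0 by rewrite -pp p0 mulr0.
apply/bnd0_eq/(bnd_summand ps qs pq) => //.
by rewrite pp qq subrr; split; rewrite ?expr0n// => x; rewrite nm0 mul0r.
Qed.

Lemma cstar_eq0 T : mstar T * T = 0 -> T = 0.
Proof.
move=> T0; apply/bnd0_eq/bnd_cstar => //; rewrite T0.
by split; rewrite ?expr0n// => x; rewrite nm0 mul0r.
Qed.

(** Writing T = s - i t with s and t self-adjoint, the sum is 2 (s^2 + t^2). *)
Lemma pos_cstar_sum T : pos (mstar T * T + T * mstar T).
Proof.
pose s := (2^-1)%:C *: (T + mstar T).
pose t := 'i%C *: ((2^-1)%:C *: (T - mstar T)).
have ss : mstar s = s by rewrite mstarZr mstarD mstarK addrC.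
have ci : conjc 'i%C = - 'i%C :> R[i].
  by apply/eqP; rewrite eq_complex/= oppr0 !eqxx.
have ts : mstar t = t.
  by rewrite mstarZ mstarZr ci mstarB mstarK /t; module R[i].
have -> : mstar T * T + T * mstar T = 2%:R%:C *: (s * s + t * t).
  have tt : t * t = - (((2^-1)%:C *: (T - mstar T)) * ((2^-1)%:C *: (T - mstar T))).
    by rewrite /t mscaleAl mscaleAr scalerA -expr2 sqr_i scaleN1r.
  rewrite tt /s !mscaleAl !mscaleAr !mulrBl !mulrDl !mulrBr !mulrDr.
  by module R[i].
apply: posZ; first exact: ler0n.
by apply: posD; exact: pos_sqr.
Qed.

(* For z := p T^*, both z^* z = -(T T^* )^2 and z z^* = -p^4 are negative,
   whereas their sum is positive. *)
Lemma neg_cstar_eq0 p T : mstar p = p -> mstar T * T = - (p * p) -> T = 0.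
Proof.
move=> ps Tp; pose z := p * mstar T.
have zs : mstar z = T * p by rewrite mstarM mstarK ps.
have zz : mstar z * z = - ((T * mstar T) * (T * mstar T)).
  by rewrite zs /z !mulrA -(mulrA T p p) -[p * p]opprK -Tp mulrN !mulNr !mulrA.
have zz' : z * mstar z = - ((p * p) * (p * p)).
  by rewrite zs /z !mulrA -(mulrA p _ T) Tp mulrN !mulNr !mulrA.
have := pos_cstar_sum z; rewrite zz zz' => h.
have pp : pos ((p * p) * (p * p)) by apply: pos_sqr; rewrite mstarM ps.
have tt : pos ((T * mstar T) * (T * mstar T)) by apply: pos_sqr; rewrite mstarM mstarK.
have p40 : (p * p) * (p * p) = 0.
  apply: pos_anti => //; have -> : - (p * p * (p * p)) =
    (- (T * mstar T * (T * mstar T)) - p * p * (p * p)) + T * mstar T * (T * mstar T).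
    by module R[i].
  exact: posD.
have p20 : p * p = 0 by apply: cstar_eq0; rewrite mstarM ps.
by apply: cstar_eq0; rewrite Tp p20 oppr0.
Qed.

(** For H = T^* T, B = |H| and g = B - H, twice the negative part of H, the identity H g = - B g
    makes (T g)^* (T g) the negative of a square. So T g = 0 by [neg_cstar_eq0], then H g = B g = 0
    and g^2 = 0. *)
Theorem pos_cstar T : pos (mstar T * T).
Proof.
pose H := mstar T * T; have Hs : mstar H = H by rewrite mstarM mstarK.
have [B [Bs BB Bpos Bc]] := pos_sqrt (pos_sqr Hs).
have [m [ms mm _ mc]] := pos_sqrt Bpos.
have HB : GRing.comm H B by apply: Bc; exact: commrM.
pose g := B - H; have gs : mstar g = g by rewrite mstarB Bs Hs.
have Hm : GRing.comm H m by exact: mc.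
have Bm : GRing.comm B m by exact: mc.
have gm : GRing.comm m g by apply: commrB; exact: commr_sym.
have gg : (H + B) * g = 0.
  by rewrite /g mulrDl !mulrBr BB HB; module R[i].
have mgs : mstar (m * g) = m * g by rewrite mstarM ms gs gm.
have Tg : mstar (T * g) * (T * g) = - ((m * g) * (m * g)).
  apply/eqP; rewrite -subr_eq0 opprK mstarM gs -!mulrA (mulrA (mstar T)) -/H.
  have -> : m * (g * (m * g)) = g * (B * g).
    by rewrite -mm -!mulrA mulrA gm -!mulrA.
  by rewrite -mulrDr -mulrDl gg mulr0.
have Tg0 := neg_cstar_eq0 mgs Tg.
have mg0 : m * g = 0.
  apply: cstar_eq0; rewrite mgs; apply/eqP; rewrite -oppr_eq0 -Tg Tg0.
  by rewrite mulr0.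
have Bg : B * g = 0 by rewrite -mm -mulrA mg0 mulr0.
have Hg : H * g = 0 by rewrite /H -mulrA Tg0 mulr0.
have g2 : g * g = 0 by rewrite {1}/g mulrBl Bg Hg subrr.
have g0 : g = 0 by apply: cstar_eq0; rewrite gs.
by rewrite -/H; move/eqP: g0; rewrite subr_eq0 => /eqP <-.
Qed.

Lemma neumann (z : M) r : r < 1 -> bnd z r ->
  exists S, [/\ (1 - z) * S = 1, S * (1 - z) = 1 &
                forall T, GRing.comm T z -> GRing.comm T S].
Proof.
move=> r1 zr; have [r0 _] := zr.
pose S := fix S n : M := if n is n'.+1 then 1 + z * S n' else 0.
have Sc T n : GRing.comm T z -> GRing.comm T (S n).
  move=> Tz; elim: n => [|n IH] /=; first exact: commr0.
  by apply: commrD; [exact: commr1|exact: commrM].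
have dS n : bnd (S n.+1 - S n) (r ^+ n).
  elim: n => [|n IH].
    have -> : S 1%N - S 0%N = 1 by rewrite /= mulr0 addr0 subr0.
    exact: bnd1.
  have -> : S n.+2 - S n.+1 = z * (S n.+1 - S n).
    rewrite -[S n.+2]/(1 + z * S n.+1) -[X in _ - X]/(1 + z * S n) mulrBr.
    by module R[i].
  by rewrite exprS; exact: bndM.
have r1' : 0 < 1 - r by rewrite subr_gt0.
(* The tail of the geometric series from rank n on. *)
pose d n := r ^+ n / (1 - r).
have d0 : d @ \oo --> 0.
  rewrite -(mul0r (1 - r)^-1); apply: cvgMl; apply: cvg_expr.
  by rewrite ger0_norm.
have [n m nm|U Ud] := mult_complete (T := S) (d := d) _ d0.
  apply: (@bndW _ _ ((r ^+ n - r ^+ m) / (1 - r))); last first.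
    by rewrite ler_pM2r ?invr_gt0// gerBl exprn_ge0.
  rewrite -(subnK nm); elim: (m - n)%N => [|k IH].
    by rewrite add0n !subrr mul0r; split=> // x; rewrite nm0 mul0r.
  have -> : S (k.+1 + n)%N - S n = (S (k + n).+1 - S (k + n)%N) + (S (k + n)%N - S n).
    by rewrite addSn; module R[i].
  apply: bndW (bndD (dS _) IH) _; rewrite addSn exprS.
  rewrite le_eqVlt; apply/orP; left; apply/eqP; field; lra.
have d_ge0 n : 0 <= d n by have [] := Ud n.
have Uc T : GRing.comm T z -> GRing.comm T U.
  move=> Tz; have [C C0 TC] := bnd_ex T.
  apply/eqP; rewrite -subr_eq0; apply/eqP/(bnd_lim (C := 2 * C) d0) => n.
  have -> : T * U - U * T = T * (U - S n) - (U - S n) * T.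
    by rewrite mulrBr mulrBl (Sc T n Tz); module R[i].
  by apply: bndW (bndB (bndM TC (Ud n)) (bndM (Ud n) TC)) _; lra.
have zU : (1 - z) * U = 1.
  apply/eqP; rewrite -subr_eq0; apply/eqP/(bnd_lim (C := 2) d0) => n.
  have -> : (1 - z) * U - 1 = (U - S n.+1) - z * (U - S n).
    rewrite -[S n.+1]/(1 + z * S n) mulrBl mul1r mulrBr; module R[i].
  apply: bndW (bndB (Ud n.+1) (bndM zr (Ud n))) _.
  have -> : d n.+1 = r * d n by rewrite /d exprS mulrA.
  have := d_ge0 n; nra.
exists U; split=> //.
suff UzE : GRing.comm (1 - z) U by rewrite -UzE.
apply: Uc; apply: commr_sym; apply: commrB; [exact: commr1|by []].
Qed.

(** If |t - (T - d)| <= t, put L = t + d: then T / L = 1 - z with |z| <= t / L < 1, and the Neumann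
    series applies. *)
Lemma mult_inverse T d : 0 < d -> pos (T - d%:C *: (1 : M)) ->
  exists S, [/\ T * S = 1, S * T = 1 & forall z, GRing.comm z T -> GRing.comm z S].
Proof.
move=> d0 [Ts [t0 Tt0]]; pose t := `|t0|; pose L := t + d.
have Tt : bnd (t%:C *: (1 : M) - (T - d%:C *: (1 : M))) t.
  by apply: pos_ge Tt0 _ _; exact: ler_norm.
have L0 : 0 < L by rewrite /L /t ltr_wpDl.
have LN : L != 0 by rewrite gt_eqF.
pose z := (L^-1)%:C *: (t%:C *: (1 : M) - (T - d%:C *: (1 : M))).
have zE : 1 - z = (L^-1)%:C *: T.
  have -> : (1 : M) = (L^-1)%:C *: (L%:C *: (1 : M)).
    by rewrite scalerA -rmorphM/= mulVf// scale1r.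
  by rewrite /z /L rmorphD; module R[i].
have [||S [zS Sz Sc]] := @neumann z (t / L).
- by rewrite ltr_pdivrMr// mul1r /L ltrDl.
- by apply: bndW (bndZ _ Tt) _; rewrite ger0_norm ?invr_ge0 ?(ltW L0)// mulrC.
exists ((L^-1)%:C *: S); split.
- by rewrite mscaleAr -mscaleAl -zE.
- by rewrite mscaleAl -mscaleAr -zE.
- move=> U UT; apply/commZr/Sc; apply: commZr; apply: commrB.
    by apply: commZr; exact: commr1.
  by apply: commrB => //; apply: commZr; exact: commr1.
Qed.

End Positivity.

(** * Extreme dominated functionals *)

Section ExtremeFunctional.
Context {R : realType} {V : lmodType R[i]}.
Implicit Types (f g p q : V -> R) (a x y : V) (r t l : R).

Definition rlinear f :=
  (forall x y, f (x + y) = f x + f y) /\ forall r x, f (r%:C *: x) = r * f x.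

Definition sublinear q :=
  (forall x y, q (x + y) <= q x + q y) /\
  forall r x, 0 <= r -> q (r%:C *: x) = r * q x.

Definition dominated f q := forall x, f x <= q x.

(* In terms of dominated functionals: those below q form a face of those below p. *)
Definition face p q := forall g g' l,
  rlinear g -> rlinear g' -> dominated g p -> dominated g' p -> 0 < l < 1 ->
  (forall x, l * g x + (1 - l) * g' x <= q x) -> dominated g q.

Lemma rlinearN f x : rlinear f -> f (- x) = - f x.
Proof.
by move=> [_ fZ]; rewrite -scaleN1r -(mulN1r (f x)) -fZ rmorphN rmorph1.
Qed.

Lemma sublinear0 q : sublinear q -> q 0 = 0.
Proof. by move=> [_ qZ]; rewrite -(scale0r 0) -(rmorph0 (real_complex R)) qZ// mul0r. Qed.

Lemma sublinear_ge q x : sublinear q -> - q (- x) <= q x.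
Proof.
by move=> qs; have [qD _] := qs; rewrite -subr_ge0 opprK -(sublinear0 qs) -(subrr x) qD.
Qed.

(** The modification of q from the proof of the Hahn-Banach theorem: the linear functionals below it
    are those g below q with g a = q a, that is, those of maximal value at a. *)
Definition steepest q a x := inf [set q (x + t%:C *: a) - t * q a | t in [set t | 0 <= t]].

Section Steepest.
Variables (q : V -> R) (a : V).
Hypothesis qs : sublinear q.

Lemma steepest_has_inf x :
  has_inf [set q (x + t%:C *: a) - t * q a | t in [set t | 0 <= t]].
Proof.
have [qD qZ] := qs; split; first by exists (q (x + 0%:C *: a) - 0 * q a), 0 => /=.
exists (- q (- x)) => _ [t /= t0 <-].
rewrite -qZ// lerBrDr addrC lerBlDr.
have {1}-> : t%:C *: a = (x + t%:C *: a) - x by module R[i].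
exact: qD.
Qed.

Lemma steepest_le x t : 0 <= t -> steepest q a x <= q (x + t%:C *: a) - t * q a.
Proof.
by move=> t0; apply: ge_inf; [have [] := steepest_has_inf x|exists t].
Qed.

Lemma le_steepest x r : (forall t, 0 <= t -> r <= q (x + t%:C *: a) - t * q a) ->
  r <= steepest q a x.
Proof.
move=> rq; apply: lb_le_inf; first by have [] := steepest_has_inf x.
by move=> _ [t t0 <-]; exact: rq.
Qed.

Lemma steepest_le_self : dominated (steepest q a) q.
Proof.
move=> x; rewrite (le_trans (steepest_le x (lexx 0)))//.
by rewrite scale0r addr0 mul0r subr0.
Qed.

Lemma steepestN : steepest q a (- a) <= - q a.
Proof.
rewrite (le_trans (steepest_le _ ler01))// scale1r addNr sublinear0//.
by rewrite mul1r add0r.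
Qed.

Lemma steepest_sublinear : sublinear (steepest q a).
Proof.
have [qD qZ] := qs; split=> [x y|].
  rewrite -lerBlDr; apply: le_steepest => t t0; rewrite lerBlDl -lerBlDr.
  apply: le_steepest => s s0; rewrite lerBlDr.
  rewrite (le_trans (steepest_le _ (addr_ge0 t0 s0)))//.
  have -> : x + y + (t + s)%:C *: a = (x + t%:C *: a) + (y + s%:C *: a).
    by rewrite rmorphD; module R[i].
  by have := qD (x + t%:C *: a) (y + s%:C *: a); lra.
have le r x : 0 < r -> steepest q a (r%:C *: x) <= r * steepest q a x.
  move=> r0; rewrite -ler_pdivrMl//; apply: le_steepest => t t0.
  rewrite ler_pdivrMl// (le_trans (steepest_le _ (mulr_ge0 (ltW r0) t0)))//.
  have -> : r%:C *: x + (r * t)%:C *: a = r%:C *: (x + t%:C *: a).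
    by rewrite rmorphM; module R[i].
  by rewrite qZ ?(ltW r0)// mulrBr mulrA.
move=> r x; rewrite le_eqVlt => /predU1P[<-|r0].
  rewrite scale0r mul0r; apply/le_anti/andP; split.
    by rewrite -(sublinear0 qs) steepest_le_self.
  by apply: le_steepest => t t0; rewrite add0r qZ// subrr.
apply/le_anti; rewrite le//= -ler_pdivlMl// (le_trans _ (le _ _ _)) ?invr_gt0//.
by rewrite scalerA -rmorphM/= mulVf ?gt_eqF// scale1r.
Qed.

Lemma steepest_greatest g : rlinear g -> dominated g q -> g a = q a ->
  dominated g (steepest q a).
Proof.
move=> [gD gZ] gq ga x; apply: le_steepest => t t0.
by rewrite lerBrDr -ga -gZ -gD.
Qed.

Lemma steepest_face p : face p q -> face p (steepest q a).
Proof.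
move=> qf g g' l gl gl' gp gp' /andP[l0 l1] h.
have hq x : l * g x + (1 - l) * g' x <= q x := le_trans (h x) (steepest_le_self x).
have gq : dominated g q by apply: (qf g g' l) => //; rewrite l0.
have gq' : dominated g' q.
  apply: (qf g' g (1 - l)) => //; first by rewrite subr_gt0 l1 gtrBl.
  by move=> x; have := hq x; lra.
apply: steepest_greatest => //; apply/le_anti; rewrite gq/=.
have := le_trans (h (- a)) steepestN; rewrite !rlinearN//.
have := gq' a; nra.
Qed.

End Steepest.

(** A minimal sublinear functional carrying a face below [steepest p a] is linear, so its face is a
    single point, which is then extreme; lying below [steepest p a] forces the value p a at a. *)
Lemma extreme_functional p a : sublinear p -> exists f,
  [/\ rlinear f, dominated f p, f a = p a &
      forall g g' l, rlinear g -> rlinear g' -> dominated g p -> dominated g' p ->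
        0 < l < 1 -> (forall x, f x = l * g x + (1 - l) * g' x) -> f = g].
Proof.
move=> ps; pose q0 := steepest p a.
have q0s : sublinear q0 by exact: steepest_sublinear.
have q0f : face p q0 by apply: steepest_face.
pose T := {q | [/\ sublinear q, face p q & dominated q q0]}.
pose rel (s t : T) := `[< dominated (sval t) (sval s) >].
have [|||A Atot|[q [qs qf qq0]] qmin] := @Zorn T rel.
- by move=> t; apply/asboolP => x.
- move=> r s t /asboolP rs /asboolP st; apply/asboolP => x.
  exact: le_trans (st x) (rs x).
- move=> [s Hs] [t Ht] /asboolP st /asboolP ts; apply: eq_exist.
  by apply/funext => x; apply/le_anti; rewrite st ts.
- have [A0|/set0P[t0 At0]] := eqVneq A set0.
    by exists (exist _ q0 (And3 q0s q0f (fun x => lexx _))) => s; rewrite A0.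
  pose I x := inf [set sval s x | s in A].
  have lb x : has_inf [set sval s x | s in A].
    split; first by exists (sval t0 x), t0.
    exists (- q0 (- x)) => _ [[s [ss sf s0]] As <-] /=.
    by rewrite (le_trans _ (sublinear_ge _ ss))// lerN2.
  have Ile s x : A s -> I x <= sval s x.
    by move=> As; apply: ge_inf; [have [] := lb x|exists s].
  have leI r x : (forall s, A s -> r <= sval s x) -> r <= I x.
    move=> h; apply: lb_le_inf; first by have [] := lb x.
    by move=> _ [s As <-]; exact: h.
  have Is : sublinear I.
    split=> [x y|r x r0].
      rewrite -lerBlDr; apply: (leI) => s As; rewrite lerBlDl -lerBlDr.
      apply: (leI) => t At; rewrite lerBlDr.
      have [/asboolP st|/asboolP ts] := Atot _ _ As At.
        rewrite (le_trans (Ile _ _ At))//; have [[tD _] _ _] := svalP t.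
        by have := tD x y; have := st x; lra.
      rewrite (le_trans (Ile _ _ As))//; have [[sD _] _ _] := svalP s.
      by have := sD x y; have := ts y; lra.
    move: r0; rewrite le_eqVlt => /predU1P[<-|r0].
      have t00 (s : T) : sval s 0 = 0 by have [/sublinear0 s0 _ _] := svalP s.
      rewrite scale0r mul0r; apply/le_anti/andP; split.
        by rewrite -(t00 t0) Ile.
      by apply: (leI) => s _; rewrite t00.
    have sZ (s : T) y : sval s (r%:C *: y) = r * sval s y.
      by have [[_ sZ] _ _] := svalP s; rewrite sZ// ltW.
    apply/le_anti/andP; split.
      by rewrite -ler_pdivrMl//; apply: (leI) => s As; rewrite ler_pdivrMl// -sZ Ile.
    by apply: (leI) => s As; rewrite sZ ler_pM2l// Ile.
  have If : face p I.
    move=> g g' l gl gl' gp gp' l01 h x; apply: (leI) => s As.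
    have [_ sf _] := svalP s; apply: (sf g g' l) => // y.
    exact: le_trans (h y) (Ile _ _ As).
  have I0 : dominated I q0.
    move=> x; rewrite (le_trans (Ile _ _ At0))//.
    by have [_ _] := svalP t0; apply.
  by exists (exist _ I (And3 Is If I0)) => s As; apply/asboolP => x; exact: Ile.
(* Minimality; taking t = 1 in the infimum then gives q x + q y <= q (x + y). *)
have qE b : steepest q b = q.
  have h : [/\ sublinear (steepest q b), face p (steepest q b) & dominated (steepest q b) q0].
    split; [exact: steepest_sublinear|exact: steepest_face|].
    by move=> x; rewrite (le_trans (steepest_le_self _ qs x)).
  suff /qmin/(congr1 sval) : rel (exist _ q (And3 qs qf qq0)) (exist _ _ h) by [].
  by apply/asboolP => x; exact: steepest_le_self.
have [qD qZ] := qs.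
have qDE x y : q (x + y) = q x + q y.
  apply/le_anti; rewrite qD/= -lerBrDr -{1}(qE y).
  by have := steepest_le y qs x ler01; rewrite scale1r mul1r.
have qN x : q (- x) = - q x.
  by apply/eqP; rewrite -addr_eq0 -qDE addNr sublinear0.
have ql : rlinear q.
  split=> // r x; have [r0|r0] := leP 0 r; first exact: qZ.
  have := qZ (- r) x; rewrite oppr_ge0 => /(_ (ltW r0)).
  by rewrite rmorphN scaleNr qN mulNr => /oppr_inj.
have qp : dominated q p.
  by move=> x; rewrite (le_trans (qq0 x))// steepest_le_self.
exists q; split=> //.
  apply/le_anti; rewrite qp/= -lerN2 -rlinearN// (le_trans (qq0 _))//.
  exact: steepestN.
move=> g g' l gl gl' gp gp' l01 h.
have gq : dominated g q by apply: (qf g g' l) => // x; rewrite h.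
apply/funext => x; apply/le_anti; rewrite gq andbT.
by rewrite -lerN2 -!rlinearN.
Qed.

End ExtremeFunctional.

(** * Completion of a semi-inner product space *)

Section ComplexModulus.
Context {R : realType}.
Implicit Types (z w : R[i]) (a b c e r t : R).

Definition cabs z : R := ComplexField.Normc.normc z.

Lemma cabsE z : `|z| = (cabs z)%:C. Proof. by []. Qed.
Lemma cabs_ge0 z : 0 <= cabs z.
Proof. by case: z => a b; exact: sqrtr_ge0. Qed.
Lemma cabs0 : cabs 0 = 0. Proof. exact: ComplexField.Normc.normc0. Qed.
Lemma cabsD z w : cabs (z + w) <= cabs z + cabs w.
Proof. exact: le_normcD. Qed.
Lemma cabsM z w : cabs (z * w) = cabs z * cabs w.
Proof. exact: ComplexField.Normc.normcM. Qed.
Lemma cabsN z : cabs (- z) = cabs z. Proof. exact: normcN. Qed.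
Lemma cabsJ z : cabs (conjc z) = cabs z.
Proof. by case: z => a b /=; rewrite /cabs/= sqrrN. Qed.
Lemma cabs_eq0 z : cabs z = 0 -> z = 0.
Proof. exact: ComplexField.Normc.eq0_normc. Qed.
Lemma cabsr r : cabs r%:C = `|r|.
Proof. by apply: complexI; rewrite -cabsE norm_complexr. Qed.
Lemma cabsi : cabs 'i%C = 1.
Proof. by rewrite /cabs/= expr0n add0r expr1n sqrtr1. Qed.
Lemma Re_le_cabs z : `|complex.Re z| <= cabs z.
Proof. by have := normc_ge_Re z; rewrite lecR. Qed.
Lemma cabs_le z : cabs z <= `|complex.Re z| + `|complex.Im z|.
Proof.
rewrite {1}[z]complexE (le_trans (cabsD _ _))// cabsM cabsi mul1r !cabsr.
by rewrite lexx.
Qed.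

(** Identities on completions are proved with errors linear in e; the restriction e <= 1 lets
    quadratic errors be absorbed. *)
Lemma cabs_small z K : (forall e, 0 < e <= 1 -> cabs z <= K * e) -> z = 0.
Proof.
move=> zK; apply/cabs_eq0/le_anti; rewrite cabs_ge0 andbT.
have K0 : 0 <= K by have := zK 1; rewrite mulr1 ltr01 lexx => /(_ isT); apply: le_trans (cabs_ge0 z).
rewrite leNgt; apply/negP => z0.
pose e := Num.min 1 (cabs z / (K + 1) / 2).
have e0 : 0 < e by rewrite lt_min ltr01/= !divr_gt0// ltr_wpDl.
have /zK : 0 < e <= 1 by rewrite e0 ge_min lexx.
apply/negP; rewrite -ltNge.
have e2 : e <= cabs z / (K + 1) / 2 by rewrite ge_min lexx orbT.
have K1 : 0 < K + 1 by rewrite ltr_wpDl.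
have : (K + 1) * e <= cabs z / 2.
  by rewrite mulrC -ler_pdivlMr// (le_trans e2)// mulrAC.
have := e0; nra.
Qed.

Lemma discriminant_le a b c : 0 <= a -> 0 <= c ->
  (forall t, 0 <= a + 2 * t * b + t ^+ 2 * c) -> b ^+ 2 <= a * c.
Proof.
move=> a0 c0 h; have [cz|cn] := eqVneq c 0.
  have [->|bn] := eqVneq b 0; first by rewrite expr0n mulr_ge0.
  (* With c = 0 and b nonzero the value at this t would be -1. *)
  have := h (- (a + 1) / (2 * b)).
  have -> : 2 * (- (a + 1) / (2 * b)) * b = - (a + 1) by field.
  rewrite cz mulr0 addr0; lra.
have cp : 0 < c by rewrite lt_neqAle eq_sym cn.
have := h (- b / c).
have -> : a + 2 * (- b / c) * b + (- b / c) ^+ 2 * c = (a * c - b ^+ 2) / c by field.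
by rewrite pmulr_lge0 ?invr_gt0// subr_ge0.
Qed.

Lemma phase z : exists2 w, cabs w = 1 & complex.Re (w * z) = cabs z.
Proof.
have [->|zn] := eqVneq z 0.
  by exists 1; [rewrite -(rmorph1 (real_complex R)) cabsr normr1|rewrite mulr0 cabs0].
have z0 : cabs z != 0 by apply: contra_neq zn; exact: cabs_eq0.
exists ((cabs z)^-1%:C * conjc z).
  by rewrite cabsM cabsJ cabsr ger0_norm ?invr_ge0 ?cabs_ge0// mulVf.
rewrite -mulrA (mulrC _ z) -sqr_normc cabsE -rmorphXn -rmorphM/=.
by rewrite expr2 mulrA mulVf// mul1r.
Qed.

End ComplexModulus.

Record semi_inner (R : realType) (V : lmodType R[i]) := SemiInner {
  si_form :> V -> V -> R[i] ;
  si_linear : forall (c : R[i]) u v w,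
    si_form (c *: u + v) w = c * si_form u w + si_form v w ;
  si_conj : forall u v, si_form v u = conjc (si_form u v) ;
  si_ge0 : forall v, 0 <= complex.Re (si_form v v) }.

Section SemiInner.
Context {R : realType} {V : lmodType R[i]} (s : semi_inner V).
Implicit Types (u v w : V) (c : R[i]) (r t e C : R).

Lemma siDl u v w : s (u + v) w = s u w + s v w.
Proof. by have := si_linear s 1 u v w; rewrite scale1r mul1r. Qed.
Lemma si0l w : s 0 w = 0.
Proof. by apply: (addrI (s 0 w)); rewrite -siDl !addr0. Qed.
Lemma siZl c u w : s (c *: u) w = c * s u w.
Proof. by have := si_linear s c u 0 w; rewrite !addr0 si0l addr0. Qed.
Lemma siDr u v w : s w (u + v) = s w u + s w v.
Proof. by rewrite si_conj siDl rmorphD/= -!si_conj. Qed.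
Lemma siZr c u w : s w (c *: u) = conjc c * s w u.
Proof. by rewrite si_conj siZl rmorphM/= -si_conj. Qed.

Definition seminorm v : R := Num.sqrt (complex.Re (s v v)).

Lemma seminorm_ge0 v : 0 <= seminorm v. Proof. exact: sqrtr_ge0. Qed.
Lemma seminorm_sqr v : seminorm v ^+ 2 = complex.Re (s v v).
Proof. by rewrite sqr_sqrtr// si_ge0. Qed.
Lemma siE v : s v v = (seminorm v ^+ 2)%:C.
Proof.
rewrite seminorm_sqr; have := si_conj s v v; case: (s v v) => a b [] /eqP.
by rewrite -subr_eq0 opprK -mulr2n mulrn_eq0/= => /eqP ->.
Qed.
Lemma seminormZ c v : seminorm (c *: v) = cabs c * seminorm v.
Proof.
apply/eqP; rewrite -(@eqrXn2 _ 2)// ?mulr_ge0 ?cabs_ge0 ?seminorm_ge0//.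
rewrite -(inj_eq (@complexI R)) -siE siZl siZr exprMn rmorphM/= -siE mulrA.
by rewrite -sqr_normc cabsE rmorphXn.
Qed.
Lemma seminorm_sqrD u v :
  seminorm (u + v) ^+ 2 = seminorm u ^+ 2 + 2 * complex.Re (s u v) + seminorm v ^+ 2.
Proof.
rewrite !seminorm_sqr siDl !siDr (si_conj _ u v).
by case: (s u u) (s u v) (s v v) => [a b] [c d] [e f] /=; ring.
Qed.

Definition antilinear (phi : V -> R[i]^o) :=
  forall c u v, phi (c *: u + v) = conjc c * phi u + phi v.

Lemma antilinearD phi u v : antilinear phi -> phi (u + v) = phi u + phi v.
Proof. by move=> pl; have := pl 1 u v; rewrite scale1r rmorph1 mul1r. Qed.
Lemma antilinear0 phi : antilinear phi -> phi 0 = 0.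
Proof. by move=> pl; apply: (addrI (phi 0)); rewrite -antilinearD// !addr0. Qed.
Lemma antilinearZ phi c u : antilinear phi -> phi (c *: u) = conjc c * phi u.
Proof. by move=> pl; have := pl c u 0; rewrite !addr0 antilinear0// addr0. Qed.

(** Rotating v by a phase makes phi v real and nonnegative without changing the seminorm of v. *)
Lemma antilinear_bound phi C : antilinear phi ->
  (forall v, complex.Re (phi v) <= C * seminorm v) ->
  forall v, cabs (phi v) <= C * seminorm v.
Proof.
move=> pl h v; have [w w1 <-] := phase (phi v).
have := h (conjc w *: v); rewrite antilinearZ// conjcK seminormZ cabsJ w1 mul1r.
by [].
Qed.

Lemma si_antilinear u : antilinear (s u).
Proof. by move=> c v w; rewrite siDr siZr. Qed.

Lemma si_CS u v : cabs (s u v) <= seminorm u * seminorm v.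
Proof.
apply: (antilinear_bound (si_antilinear u)) => {}v.
have h := discriminant_le (sqr_ge0 (seminorm u)) (sqr_ge0 (seminorm v))
  (b := complex.Re (s u v)).
apply: le_trans (ler_norm _) _.
rewrite -ler_sqr ?nnegrE ?mulr_ge0 ?seminorm_ge0// real_normK ?num_real// exprMn.
apply: h => t; have := sqr_ge0 (seminorm (u + t%:C *: v)).
rewrite seminorm_sqrD seminormZ siZr conjc_real cabsr exprMn real_normK ?num_real//.
by case: (s u v) => a b /=; rewrite mul0r subr0 mulrA.
Qed.

End SemiInner.

Section Completion.
Context {R : realType} {V : lmodType R[i]} (s : semi_inner V).
Implicit Types (u v w : V) (c : R[i]) (r t e C : R).
Local Notation n := (seminorm s).

Definition bounded_antilinear (phi : V -> R[i]^o) : bool :=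
  `[< antilinear phi /\ exists C, forall v, cabs (phi v) <= C * n v >].

Lemma bounded_antilinear_submod : submod_closed bounded_antilinear.
Proof.
split=> [|c phi psi]; rewrite /in_mem /=.
  apply/asboolP; split; first by move=> c u v; rewrite /= mulr0 addr0.
  by exists 0 => v; rewrite mul0r cabs0.
move=> /asboolP[pl [C pC]] /asboolP[ql [D qD]]; apply/asboolP; split.
  move=> d u v.
  rewrite -[LHS]/(c * phi _ + psi _) -[RHS]/(_ * (c * phi _ + psi _) + (c * phi _ + psi _)).
  by rewrite pl ql !mulrDr !mulrA (mulrC c) addrACA.
exists (cabs c * C + D) => v; rewrite -[X in cabs X]/(c * phi v + psi v).
by rewrite (le_trans (cabsD _ _))// mulrDl lerD// cabsM -mulrA ler_wpM2l// cabs_ge0.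
Qed.

HB.instance Definition _ :=
  GRing.isSubmodClosed.Build R[i] (V -> R[i]^o) bounded_antilinear
    bounded_antilinear_submod.

(* Taking all bounded antilinear functionals as the points of the completion
   builds the Riesz representation theorem into the construction. *)
Record completion : Type := Completion {
  completion_fun :> V -> R[i]^o ; _ : completion_fun \in bounded_antilinear }.
HB.instance Definition _ := [isSub of completion for completion_fun].
HB.instance Definition _ := gen_eqMixin completion.
HB.instance Definition _ := gen_choiceMixin completion.
HB.instance Definition _ := [SubChoice_isSubLmodule of completion by <:].
Implicit Types (phi psi : completion).

Lemma completion_ext phi psi : (forall v, phi v = psi v) -> phi = psi.
Proof. by move=> pq; apply/val_inj/funext. Qed.

Lemma completionP phi :
  antilinear phi /\ exists C, forall v, cabs (phi v) <= C * n v.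
Proof. by have /asboolP : bounded_antilinear phi := valP phi. Qed.

Lemma caddE phi psi v : (phi + psi) v = phi v + psi v. Proof. by []. Qed.
Lemma coppE phi v : (- phi) v = - phi v. Proof. by []. Qed.
Lemma cscaleE c phi v : (c *: phi) v = c * phi v. Proof. by []. Qed.
Lemma czeroE v : (0 : completion) v = 0. Proof. by []. Qed.

Definition cnorm phi : R := inf [set C | 0 <= C /\ forall v, cabs (phi v) <= C * n v].

Lemma cnorm_has_inf phi :
  has_inf [set C | 0 <= C /\ forall v, cabs (phi v) <= C * n v].
Proof.
have [_ [C pC]] := completionP phi; split; last by exists 0 => r [].
exists `|C|; split=> // v; rewrite (le_trans (pC v))// ler_wpM2r ?seminorm_ge0//.
exact: ler_norm.
Qed.

Lemma cnorm_le phi C : 0 <= C -> (forall v, cabs (phi v) <= C * n v) -> cnorm phi <= C.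
Proof. by move=> C0 pC; apply: ge_inf; [have [] := cnorm_has_inf phi|]. Qed.

Lemma cnorm_ge0 phi : 0 <= cnorm phi.
Proof. by apply: lb_le_inf; [have [] := cnorm_has_inf phi|move=> r []]. Qed.

Lemma le_cnorm phi v : cabs (phi v) <= cnorm phi * n v.
Proof.
have := seminorm_ge0 s v; rewrite le_eqVlt => /predU1P[n0|n0].
  have [_ [C /(_ v)]] := completionP phi.
  by rewrite -n0 !mulr0.
rewrite -ler_pdivrMr//; apply: lb_le_inf; first by have [] := cnorm_has_inf phi.
by move=> C [_ pC]; rewrite ler_pdivrMr.
Qed.

Lemma cnormD phi psi : cnorm (phi + psi) <= cnorm phi + cnorm psi.
Proof.
apply: cnorm_le; first by rewrite addr_ge0 ?cnorm_ge0.
move=> v; rewrite caddE (le_trans (cabsD _ _))// mulrDl.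
by rewrite lerD ?le_cnorm.
Qed.

Lemma cnormZ_le c phi : cnorm (c *: phi) <= cabs c * cnorm phi.
Proof.
apply: cnorm_le; first by rewrite mulr_ge0 ?cabs_ge0 ?cnorm_ge0.
by move=> v; rewrite cscaleE cabsM -mulrA ler_wpM2l ?cabs_ge0// le_cnorm.
Qed.

Lemma cnormZ c phi : cnorm (c *: phi) = cabs c * cnorm phi.
Proof.
apply/le_anti; rewrite cnormZ_le/=.
have [->|cn] := eqVneq c 0; first by rewrite cabs0 mul0r cnorm_ge0.
have c0 : 0 < cabs c.
  by rewrite lt_neqAle cabs_ge0 andbT eq_sym; apply: contra_neq cn => /cabs_eq0.
have := cnormZ_le c^-1 (c *: phi); rewrite scalerA mulVf// scale1r => h.
rewrite mulrC -ler_pdivlMr//= (le_trans h)// mulrC.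
by rewrite (_ : cabs c^-1 = (cabs c)^-1)//; exact: ComplexField.Normc.normcV.
Qed.

Lemma cnorm_eq0 phi : cnorm phi = 0 -> phi = 0.
Proof.
move=> p0; apply: completion_ext => v; apply/cabs_eq0/le_anti.
by rewrite cabs_ge0 andbT; have := le_cnorm phi v; rewrite p0 mul0r.
Qed.

Let cnormDC phi psi : (cnorm (phi + psi))%:C <= (cnorm phi)%:C + (cnorm psi)%:C.
Proof. by rewrite -rmorphD lecR cnormD. Qed.

Let cnormZC c phi : (cnorm (c *: phi))%:C = `|c| * (cnorm phi)%:C.
Proof. by rewrite cnormZ cabsE -rmorphM. Qed.

Let cnorm_eq0C phi : (cnorm phi)%:C = 0 -> phi = 0.
Proof. by move=> /complexI/cnorm_eq0. Qed.

HB.instance Definition _ := @Lmodule_isNormed.Build R[i] completion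
  (fun phi => (cnorm phi)%:C) cnormDC cnormZC cnorm_eq0C.

Lemma nm_cnorm phi : nm phi = cnorm phi. Proof. by []. Qed.

Lemma completion_complete (F : set_system completion) :
  ProperFilter F -> cauchy F -> cvg F.
Proof.
move=> FF Fc.
have [h [h0 hmono h_gt0 _]] := @decreasing_null_seq R.
(* The filter is replaced by a sequence whose k-th term is within [h k] of F-almost all points. *)
have /choice[psi psiP] : forall k, exists psi : completion, F [set phi | cnorm (psi - phi) < h k].
  move=> k; have k0 : 0 < (h k)%:C by rewrite ltcR.
  have /cauchyP/(_ _ k0)[psi Fpsi] := Fc; exists psi.
  apply: filterS Fpsi => phi; rewrite -ball_normE /ball_/=.
  by rewrite (nmE (psi - phi)) ltcR.
have d0 : (fun k => 2 * h k : R) @ \oo --> 0.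
  by rewrite -(mulr0 2); exact: cvgMr.
have psid k m : (k <= m)%N -> cnorm (psi m - psi k) <= 2 * h k.
  move=> km; have [phi [pk pm]] := filter_ex (filterI (psiP k) (psiP m)).
  have -> : psi m - psi k = (psi m - phi) - (psi k - phi) by module R[i].
  rewrite (le_trans (cnormD _ _))// -[X in _ + X]nm_cnorm nmN nm_cnorm.
  move: pk pm (hmono _ _ km) => /=.
  by move: (cnorm (psi m - phi)) (cnorm (psi k - phi)) (h k) (h m) => a b x y; lra.
pose d k := 2 * h k : R.
have dk v : (fun k => d k * n v) @ \oo --> (0 : R).
  by rewrite -(mul0r (n v)); exact: cvgMl.
have /choice[f fP] : forall v, exists l : R[i], forall k, cabs (l - psi k v) <= d k * n v *+ 2.
  move=> v; apply: complete_complex_seq (dk v) => k m km.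
  by rewrite (le_trans (le_cnorm (psi m - psi k) v))// ler_wpM2r ?seminorm_ge0// psid.
have fl : antilinear f.
  move=> c u v; apply/eqP; rewrite -subr_eq0; apply/eqP.
  (* 4 = 2 * 2: the sequence has rate [2 * h k], doubled by [complete_complex_seq]. *)
  pose K := 4 * (n (c *: u + v) + cabs c * n u + n v).
  have K0 : 0 <= K by rewrite mulr_ge0// !addr_ge0 ?mulr_ge0 ?cabs_ge0 ?seminorm_ge0.
  apply: (cabs_small (K := K)) => e /andP[e0 _].
  have [k ke] := cvg0_lt h0 e0.
  have [pl _] := completionP (psi k).
  have -> : f (c *: u + v) - (conjc c * f u + f v) =
      (f (c *: u + v) - psi k (c *: u + v)) - conjc c * (f u - psi k u) - (f v - psi k v).
    by rewrite pl; ring.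
  have h1 := fP (c *: u + v) k; have h2 := fP u k; have h3 := fP v k.
  have h4 := cabsD (f (c *: u + v) - psi k (c *: u + v) - conjc c * (f u - psi k u)) (- (f v - psi k v)).
  have h5 := cabsD (f (c *: u + v) - psi k (c *: u + v)) (- (conjc c * (f u - psi k u))).
  rewrite !cabsN cabsM cabsJ in h4 h5.
  have h6 := ler_wpM2l (cabs_ge0 c) h2.
  apply: le_trans (_ : K * h k <= _); last by rewrite ler_wpM2l// ltW.
  have aux (x1 x2 x3 x12 x123 m nw nu nv y : R) : x123 <= x12 + x3 ->
      x12 <= x1 + m * x2 -> x1 <= 2 * y * nw *+ 2 -> m * x2 <= m * (2 * y * nu *+ 2) ->
      x3 <= 2 * y * nv *+ 2 -> x123 <= 4 * (nw + m * nu + nv) * y.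
    by rewrite !mulr2n; lra.
  exact: aux h4 h5 h1 h6 h3.
have fb : f \in bounded_antilinear.
  apply/asboolP; split=> //; exists (d 0%N * 2 + cnorm (psi 0%N)) => v.
  have -> : f v = (f v - psi 0%N v) + psi 0%N v by rewrite subrK.
  rewrite (le_trans (cabsD _ _))// mulrDl lerD ?le_cnorm//.
  by have := fP v 0%N; rewrite -mulr_natr; lra.
apply/cvg_ex; exists (Completion fb); apply/cvgrPdist_lt => e e0.
have [e' e'0 ->] := posC_real e0.
(* 5 = 4 + 1: the limit is within [4 * h k] of [psi k], which is within [h k] of F-almost all
   points. *)
have [k ke] := cvg0_lt h0 (divr_gt0 e'0 (ltr0n R 5)).
apply: filterS (psiP k) => phi /= pphi.
rewrite (nmE (Completion fb - phi)) ltcR nm_cnorm.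
have -> : Completion fb - phi = (Completion fb - psi k) + (psi k - phi) by module R[i].
have h1 : cnorm (Completion fb - psi k) <= d k * 2.
  apply: cnorm_le; first by rewrite /d !mulr_ge0// ltW.
  by move=> v; have := fP v k; rewrite -mulr_natr mulrAC.
have h2 := cnormD (Completion fb - psi k) (psi k - phi).
have aux (x y z w e1 : R) : w < e1 / 5 -> z <= x + y -> x <= 2 * w * 2 -> y < w -> z < e1.
  lra.
exact: aux ke h2 h1 pphi.
Qed.

HB.instance Definition _ := Uniform_isComplete.Build completion completion_complete.

End Completion.

Section CompletionHilbert.
Context {R : realType} {V : lmodType R[i]} (s : semi_inner V).
Implicit Types (u v w : V) (c : R[i]) (r t e C : R) (phi psi : completion s).
Local Notation n := (seminorm s).

Lemma si_bounded_antilinear v : (s v : V -> R[i]^o) \in bounded_antilinear s.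
Proof.
apply/asboolP; split; first exact: si_antilinear.
by exists (n v) => w; exact: si_CS.
Qed.

Definition to_completion v : completion s := Completion (si_bounded_antilinear v).
Local Notation L := to_completion.

Lemma to_completionE v w : L v w = s v w. Proof. by []. Qed.

Lemma to_completionP c u v : L (c *: u + v) = c *: L u + L v.
Proof. by apply: completion_ext => w; rewrite caddE cscaleE !to_completionE si_linear. Qed.
Lemma to_completionD u v : L (u + v) = L u + L v.
Proof. by have := to_completionP 1 u v; rewrite !scale1r. Qed.
Lemma to_completionZ c v : L (c *: v) = c *: L v.
Proof. by apply: completion_ext => w; rewrite cscaleE !to_completionE siZl. Qed.

Lemma cnorm_to_completion v : cnorm (L v) = n v.
Proof.
apply/le_anti/andP; split.
  by apply: cnorm_le; [exact: seminorm_ge0|exact: si_CS].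
have [->|nN0] := eqVneq (n v) 0; first exact: cnorm_ge0.
have n0 : 0 < n v by rewrite lt_neqAle eq_sym nN0 seminorm_ge0.
rewrite -(ler_pM2r n0) -expr2 (le_trans _ (le_cnorm _ _))// to_completionE siE.
by rewrite cabsr ler_norm.
Qed.

(** [J v] stands for |phi - L v|^2 - |phi|^2. At a v within e^2 of its infimum, the discriminant of
    J (v + t w) in t bounds phi - L v by e. *)
Lemma to_completion_dense phi e : 0 < e -> exists v, cnorm (phi - L v) <= e.
Proof.
move=> e0; have [pl _] := completionP phi.
pose J v := n v ^+ 2 - 2 * complex.Re (phi v).
have Rel (z : R[i]) : - cabs z <= complex.Re z <= cabs z.
  by rewrite -ler_norml Re_le_cabs.
have Jinf : has_inf (range J).
  split; first by exists (J 0), 0.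
  exists (- cnorm phi ^+ 2) => _ [v _ <-]; rewrite /J.
  have := le_cnorm phi v; have /andP[_ ] := Rel (phi v).
  move: (complex.Re _) (cabs _) (n v) (cnorm _) => a b x y.
  have := sqr_ge0 (x - y); nra.
have e2 : 0 < e ^+ 2 by rewrite exprn_gt0.
have [_ [v _ <-] vJ] := inf_adherent e2 Jinf.
exists v; apply: cnorm_le; first exact: ltW.
have al : antilinear (phi - L v).
  move=> c x y; rewrite !caddE !coppE !to_completionE pl siDr siZr.
  by move: (phi x) (phi y) (s v x) (s v y) => a1 a2 a3 a4; ring.
apply: (antilinear_bound al) => w.
have h : complex.Re ((phi - L v) w) ^+ 2 <= e ^+ 2 * n w ^+ 2.
  rewrite -sqrrN; apply: discriminant_le; [exact: sqr_ge0|exact: sqr_ge0|move=> t].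
  have : inf (range J) <= J (v + t%:C *: w) by apply: ge_inf; [have [] := Jinf|exists (v + t%:C *: w)].
  have -> : J (v + t%:C *: w) = J v + 2 * t * (- complex.Re ((phi - L v) w)) + t ^+ 2 * n w ^+ 2.
    rewrite /J seminorm_sqrD seminormZ cabsr exprMn real_normK ?num_real//.
    rewrite siZr (antilinearD _ _ pl) (antilinearZ _ _ pl) caddE coppE to_completionE.
    by case: (phi v) (phi w) (s v w) => [a1 b1] [a2 b2] [a3 b3] /=; ring.
  move: vJ; move: (inf _) (J v) (_ * _) (_ * _) => a b x y; lra.
rewrite (le_trans (ler_norm _))// -ler_sqr ?nnegrE ?mulr_ge0 ?seminorm_ge0 ?(ltW e0)//.
by rewrite real_normK ?num_real// exprMn.
Qed.

Lemma cnorm_diff phi psi : `|cnorm phi - cnorm psi| <= cnorm (phi - psi).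
Proof.
rewrite -!nm_cnorm ler_norml.
have := nmD (psi - phi) phi; have := nmD (phi - psi) psi; rewrite !subrK (nmBC psi).
by move: (nm phi) (nm psi) (nm _) => a b c; lra.
Qed.

Lemma cnorm_sqr_diff phi psi e : 0 <= e <= 1 -> cnorm (phi - psi) <= e ->
  `|cnorm phi ^+ 2 - cnorm psi ^+ 2| <= e * (2 * cnorm phi + 1).
Proof.
move=> /andP[e0 e1] pe; have := le_trans (cnorm_diff phi psi) pe.
have := cnorm_ge0 phi; have := cnorm_ge0 psi.
move: (cnorm phi) (cnorm psi) => a b b0 a0 ab.
have -> : a ^+ 2 - b ^+ 2 = (a - b) * (a + b) by ring.
rewrite normrM (ger0_norm (addr_ge0 a0 b0)).
have : b <= a + e by move: ab; rewrite ler_norml; lra.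
have := normr_ge0 (a - b); nra.
Qed.

(** Exact on the image of V and extended by density. It makes polarization against [L v] return the
    evaluation phi v. *)
Lemma cnorm_sqrD phi v :
  cnorm (phi + L v) ^+ 2 = cnorm phi ^+ 2 + 2 * complex.Re (phi v) + n v ^+ 2.
Proof.
apply: complexI; apply/eqP; rewrite -subr_eq0 -rmorphB/=; apply/eqP.
pose K := (2 * cnorm (phi + L v) + 1) + (2 * cnorm phi + 1) + 2 * n v.
apply: (@cabs_small _ _ K) => e /andP[e0 e1].
have [u pu] := to_completion_dense phi e0; rewrite cabsr.
have e01 : 0 <= e <= 1 by rewrite ltW.
have h1 : `|cnorm (phi + L v) ^+ 2 - cnorm (L u + L v) ^+ 2| <= e * (2 * cnorm (phi + L v) + 1).
  apply: cnorm_sqr_diff => //.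
  by have -> : phi + L v - (L u + L v) = phi - L u by module R[i].
have h2 := cnorm_sqr_diff e01 pu.
have h3 : `|complex.Re (phi v) - complex.Re (s u v)| <= e * n v.
  have -> : complex.Re (phi v) - complex.Re (s u v) = complex.Re ((phi - L u) v).
    by rewrite caddE coppE to_completionE; case: (phi v) (s u v) => [a b] [c d].
  rewrite (le_trans (Re_le_cabs _))// (le_trans (le_cnorm _ _))//.
  by rewrite ler_wpM2r ?seminorm_ge0.
move: h1 h2; rewrite -to_completionD !cnorm_to_completion seminorm_sqrD /K.
move: h3; move: (cnorm (phi + L v)) (cnorm phi) (complex.Re (phi v)) (complex.Re (s u v)) (n v) (n u).
move=> a b x y nv nu; rewrite !ler_norml; lra.
Qed.

(** Polarization: on functionals only the dual norm is at hand. *)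
Definition cinner phi psi : R[i] :=
  ((cnorm (phi + psi) ^+ 2 - cnorm (phi - psi) ^+ 2) / 4) +i*
  ((cnorm (phi + 'i%C *: psi) ^+ 2 - cnorm (phi - 'i%C *: psi) ^+ 2) / 4).

Lemma cinner_to_completion phi v : cinner phi (L v) = phi v.
Proof.
have [pl _] := completionP phi.
have LN w : - L w = L (- w) by rewrite -[w in RHS]scale1r -scaleNr to_completionZ scaleN1r.
have pN w : phi (- w) = - phi w.
  by rewrite -scaleN1r antilinearZ// rmorphN rmorph1 mulN1r.
have nN w : n (- w) = n w.
  by rewrite -scaleN1r seminormZ cabsN -(rmorph1 (real_complex R)) cabsr normr1 mul1r.
rewrite /cinner -to_completionZ !LN !cnorm_sqrD !pN !nN antilinearZ//.
move: (cnorm phi) (n v) (n _) => a b d.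
case: (phi v) => x y /=; apply/eqP; rewrite eq_complex/=; by apply/andP; split; apply/eqP; field.
Qed.

(** Replaces the second argument by a vector of V, where the pairing is an evaluation and linearity
    in phi is immediate. *)
Lemma cinner_approx phi psi v e : 0 <= e <= 1 -> cnorm (psi - L v) <= e ->
  cabs (cinner phi psi - phi v) <= e * (2 * cnorm phi + 2 * cnorm psi + 1).
Proof.
move=> e01 pv; rewrite -cinner_to_completion.
have key (z : R[i]) : cabs z = 1 ->
    `|cnorm (phi + z *: psi) ^+ 2 - cnorm (phi + z *: L v) ^+ 2| <= e * (2 * (cnorm phi + cnorm psi) + 1).
  move=> z1; have h : cnorm (phi + z *: psi - (phi + z *: L v)) <= e.
    have -> : phi + z *: psi - (phi + z *: L v) = z *: (psi - L v) by module R[i].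
    by rewrite cnormZ z1 mul1r.
  apply: le_trans (cnorm_sqr_diff e01 h) _; case/andP: e01 => e0 _.
  rewrite ler_wpM2l// lerD2r ler_wpM2l//.
  by rewrite (le_trans (cnormD _ _))// cnormZ z1 mul1r.
have c1 : cabs (1 : R[i]) = 1 by rewrite -(rmorph1 (real_complex R)) cabsr normr1.
have := key 1 c1; have := key (-1); rewrite cabsN c1 => /(_ erefl).
have := key 'i%C (@cabsi R); have := key (- 'i%C); rewrite cabsN cabsi => /(_ erefl).
rewrite !scale1r !scaleN1r !scaleNr => h1 h2 h3 h4.
apply: le_trans (cabs_le _) _; rewrite /cinner/=.
move: h1 h2 h3 h4.
move: (cnorm (phi + psi)) (cnorm (phi - psi)) (cnorm (phi + 'i%C *: psi)) (cnorm (phi - 'i%C *: psi)).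
move: (cnorm (phi + L v)) (cnorm (phi - L v)) (cnorm (phi + 'i%C *: L v)) (cnorm (phi - 'i%C *: L v)).
move: (cnorm phi) (cnorm psi) => a b x1 x2 x3 x4 y1 y2 y3 y4.
have N4 (p q : R) : `|(p - q) / 4| <= (`|p| + `|q|) / 4.
  by rewrite normrM (ger0_norm (_ : 0 <= 4^-1)) ?invr_ge0// ler_wpM2r ?invr_ge0// ler_normB.
have -> : (y1 ^+ 2 - y2 ^+ 2) / 4 - (x1 ^+ 2 - x2 ^+ 2) / 4 =
  ((y1 ^+ 2 - x1 ^+ 2) - (y2 ^+ 2 - x2 ^+ 2)) / 4 by ring.
have -> : (y3 ^+ 2 - y4 ^+ 2) / 4 - (x3 ^+ 2 - x4 ^+ 2) / 4 =
  ((y3 ^+ 2 - x3 ^+ 2) - (y4 ^+ 2 - x4 ^+ 2)) / 4 by ring.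
have := N4 (y1 ^+ 2 - x1 ^+ 2) (y2 ^+ 2 - x2 ^+ 2).
have := N4 (y3 ^+ 2 - x3 ^+ 2) (y4 ^+ 2 - x4 ^+ 2).
by rewrite /=; lra.
Qed.

Lemma cinner_linear psi c phi phi' :
  cinner (c *: phi + phi') psi = c * cinner phi psi + cinner phi' psi.
Proof.
apply/eqP; rewrite -subr_eq0; apply/eqP.
pose K (p : completion s) := 2 * cnorm p + 2 * cnorm psi + 1.
apply: (@cabs_small _ _ (K (c *: phi + phi') + cabs c * K phi + K phi')) => e /andP[e0 e1].
have [v pv] := to_completion_dense psi e0.
have e01 : 0 <= e <= 1 by rewrite ltW.
have h1 := cinner_approx (c *: phi + phi') e01 pv.
have h2 := ler_wpM2l (cabs_ge0 c) (cinner_approx phi e01 pv).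
have h3 := cinner_approx phi' e01 pv.
have -> : cinner (c *: phi + phi') psi - (c * cinner phi psi + cinner phi' psi) =
   (cinner (c *: phi + phi') psi - (c *: phi + phi') v) - c * (cinner phi psi - phi v)
   - (cinner phi' psi - phi' v).
  rewrite caddE cscaleE; move: (phi v) (phi' v) (cinner phi psi) (cinner phi' psi) => a b x y.
  by move: (cinner _ psi) => z; ring.
have h4 := cabsD ((cinner (c *: phi + phi') psi - (c *: phi + phi') v) - c * (cinner phi psi - phi v)) (- (cinner phi' psi - phi' v)).
have h5 := cabsD (cinner (c *: phi + phi') psi - (c *: phi + phi') v) (- (c * (cinner phi psi - phi v))).
rewrite !cabsN cabsM in h4 h5.
have aux (x1 x2 x3 x12 x123 k1 k2 k3 m : R) : x123 <= x12 + x3 -> x12 <= x1 + m * x2 ->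
   x1 <= e * k1 -> m * x2 <= m * (e * k2) -> x3 <= e * k3 ->
   x123 <= (k1 + m * k2 + k3) * e by lra.
exact: aux h4 h5 h1 h2 h3.
Qed.

Lemma cinner_conj phi psi : cinner psi phi = conjc (cinner phi psi).
Proof.
have nN (p : completion s) : cnorm (- p) = cnorm p by rewrite -!nm_cnorm nmN.
have ni (p : completion s) : cnorm ('i%C *: p) = cnorm p by rewrite cnormZ cabsi mul1r.
have i2 (p : completion s) : 'i%C *: ('i%C *: p) = - p by rewrite scalerA -expr2 sqr_i scaleN1r.
have -> : conjc (cinner phi psi) = ((cnorm (phi + psi) ^+ 2 - cnorm (phi - psi) ^+ 2) / 4) +i*
  - ((cnorm (phi + 'i%C *: psi) ^+ 2 - cnorm (phi - 'i%C *: psi) ^+ 2) / 4) by [].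
rewrite /cinner -(nN (phi - psi)) opprB (addrC phi psi).
rewrite -(ni (phi + 'i%C *: psi)) -(ni (phi - 'i%C *: psi)) !scalerDr scalerN !i2 opprK.
rewrite -(nN ('i%C *: phi - psi)) opprB (addrC ('i%C *: phi)).
by congr (_ +i* _); field.
Qed.

Lemma cinner_norm phi : cinner phi phi = `|phi| ^+ 2.
Proof.
rewrite nmE -rmorphXn nm_cnorm /cinner subrr.
have -> : phi + phi = 2%:R%:C *: phi by module R[i].
have -> : phi + 'i%C *: phi = (1 + 'i%C) *: phi by module R[i].
have -> : phi - 'i%C *: phi = (1 - 'i%C) *: phi by module R[i].
rewrite !cnormZ cabsr -[cnorm 0]nm_cnorm nm0 ger0_norm ?ler0n//.
have -> : cabs (1 + 'i%C) = cabs (1 - 'i%C) :> R.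
  by rewrite /cabs/=; congr Num.sqrt; ring.
by rewrite subrr mul0r; congr (_ +i* _); field.
Qed.

HB.instance Definition _ := @isHilbert.Build R (completion s) cinner
  (fun psi c phi phi' => cinner_linear psi c phi phi') cinner_conj cinner_norm.

Lemma inner_to_completion phi v : inner phi (L v) = phi v.
Proof. exact: cinner_to_completion. Qed.

End CompletionHilbert.

(** * Orthogonal projections and quasi-states *)

Section HilbertFacts.
Context {R : realType} {H : hilbertType R}.
Implicit Types (u v w : H) (M : set H).

Lemma inner_ge0 u : 0 <= complex.Re (inner u u).
Proof. by rewrite inner_norm nmE -rmorphXn/= exprn_ge0// nm_ge0. Qed.

Definition hilbert_si : semi_inner H :=
  SemiInner (fun c u v w => inner_linear_l w c u v) (@inner_conj R H) inner_ge0.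

Lemma innerDl u v w : inner (u + v) w = inner u w + inner v w.
Proof. exact: (siDl hilbert_si). Qed.
Lemma innerDr u v w : inner w (u + v) = inner w u + inner w v.
Proof. exact: (siDr hilbert_si). Qed.
Lemma innerZl c u w : inner (c *: u) w = c * inner u w.
Proof. exact: (siZl hilbert_si). Qed.
Lemma innerZr c u w : inner w (c *: u) = conjc c * inner w u.
Proof. exact: (siZr hilbert_si). Qed.
Lemma innerNl u w : inner (- u) w = - inner u w.
Proof. by rewrite -scaleN1r innerZl mulN1r. Qed.
Lemma innerNr u w : inner w (- u) = - inner w u.
Proof. by rewrite -scaleN1r innerZr rmorphN rmorph1 mulN1r. Qed.
Lemma inner_nm u : inner u u = (nm u ^+ 2)%:C.
Proof. by rewrite inner_norm nmE -rmorphXn. Qed.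
Lemma seminorm_hilbert u : seminorm hilbert_si u = nm u.
Proof. by rewrite /seminorm/= inner_nm/= sqrtr_sqr ger0_norm ?nm_ge0. Qed.
Lemma inner_CS u v : cabs (inner u v) <= nm u * nm v.
Proof. by rewrite -!seminorm_hilbert; exact: (si_CS hilbert_si). Qed.
Lemma nm_sqrD u v : nm (u + v) ^+ 2 = nm u ^+ 2 + 2 * complex.Re (inner u v) + nm v ^+ 2.
Proof. by rewrite -!seminorm_hilbert; exact: (seminorm_sqrD hilbert_si). Qed.

Lemma inner0_eq u : (forall v, inner u v = 0) -> u = 0.
Proof.
move=> /(_ u); rewrite inner_nm => /complexI/eqP; rewrite sqrf_eq0 => /eqP.
exact: nm_eq0.
Qed.

Lemma subspaceD M u v : closed_subspace M -> M u -> M v -> M (u + v).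
Proof. by move=> [_ _ Ml] Mu Mv; rewrite -(scale1r u); exact: Ml. Qed.
Lemma subspaceZ M c u : closed_subspace M -> M u -> M (c *: u).
Proof. by move=> [_ M0 Ml] Mu; rewrite -(addr0 (c *: u)); exact: Ml. Qed.

Lemma orthogonal_projection M v : closed_subspace M ->
  exists2 p, M p & forall m, M m -> inner (v - p) m = 0.
Proof.
move=> Ms; have [Mcl M0 _] := Ms.
have inf_d : has_inf [set nm (v - m) ^+ 2 | m in M].
  split; first by exists (nm (v - 0) ^+ 2), 0.
  by exists 0 => _ [m _ <-]; exact: sqr_ge0.
pose d := inf [set nm (v - m) ^+ 2 | m in M].
have d_le m : M m -> d <= nm (v - m) ^+ 2.
  by move=> Mm; apply: ge_inf; [case: inf_d|exists m].
have [h [h0 hmono h_gt0 _]] := @decreasing_null_seq R.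
(* The defect is a square so that the parallelogram law gives distances linear in [h]. *)
have /choice[m mP] : forall k, exists m, M m /\ nm (v - m) ^+ 2 < d + h k ^+ 2.
  move=> k; have hk2 : 0 < h k ^+ 2 by rewrite exprn_gt0.
  by have [_ [m Mm <-] mk] := inf_adherent hk2 inf_d; exists m.
have Mm k : M (m k) by have [] := mP k.
have mh k : nm (v - m k) ^+ 2 < d + h k ^+ 2 by have [] := mP k.
have mcauchy k j : (k <= j)%N -> nm (m j - m k) <= 2 * h k.
  move=> kj; rewrite -ler_sqr ?nnegrE ?mulr_ge0 ?nm_ge0 ?(ltW (h_gt0 k))//.
  have h1 := nm_sqrD (v - m k) (v - m j).
  have h2 := nm_sqrD (v - m k) (- (v - m j)).
  have e1 : v - m k - (v - m j) = m j - m k by module R[i].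
  have e2 : v - m k + (v - m j) = 2%:R%:C *: (v - (2^-1)%:C *: (m k + m j)).
    by module R[i].
  rewrite e1 innerNr nmN in h2; rewrite e2 nmZr ger0_norm ?ler0n// exprMn in h1.
  have := d_le _ (subspaceZ (2^-1)%:C Ms (subspaceD Ms (Mm k) (Mm j))).
  have hh : h j ^+ 2 <= h k ^+ 2.
    by rewrite ler_sqr ?nnegrE ?(ltW (h_gt0 _))//; exact: hmono.
  have := mh k; have := mh j; move: h1 h2.
  have -> : complex.Re (- inner (v - m k) (v - m j)) = - complex.Re (inner (v - m k) (v - m j)).
    by case: (inner _ _) => a b.
  move: (nm (m j - m k)) (nm (v - m k)) (nm (v - m j)) (nm (v - _)) (complex.Re _) hh.
  move: (h j) (h k) => hj hk x y z w b; rewrite exprMn; lra.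
have h2_0 : (fun k => 2 * h k) @ \oo --> 0.
  by rewrite -(mulr0 2); exact: cvgMr.
have [p pP] := complete_seq mcauchy h2_0.
exists p.
  apply: (closed_cvg _ Mcl _ _ (_ : m @ \oo --> p)); first by near=> k; exact: Mm.
  apply/cvgrPdist_lt => e e0.
  have [e' e'0 ->] := posC_real e0.
  near=> k; rewrite nmE ltcR (le_lt_trans (pP k))// (le_lt_trans (ler_norm _))//.
  rewrite -normrN -sub0r; near: k; exact: (cvgrPdist_lt _ _).1 h2_0 _ e'0.
(* 3 = 1 + 2: [h k] from the near-minimality of [m k], through a discriminant, and [2 * h k] from
   its distance to [p]. *)
move=> w Mw; apply: (@cabs_small _ _ (3 * nm w)) => e /andP[e0 _].
have [k ke] := cvg0_lt h0 e0.
have -> : inner (v - p) w = inner (v - m k) w + inner (m k - p) w.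
  by rewrite -innerDl; congr inner; module R[i].
apply: (le_trans (cabsD _ _)).
have h2 := inner_CS (m k - p) w; rewrite nmBC in h2.
have h1 : cabs (inner (v - m k) w) <= h k * nm w.
  have al : antilinear (hilbert_si (v - m k)) := si_antilinear hilbert_si (v - m k).
  rewrite -seminorm_hilbert.
  suff key u : M u -> complex.Re (inner (v - m k) u) <= h k * nm u.
    have [z z1 zE] := phase (inner (v - m k) w).
    have := key (conjc z *: w) (subspaceZ _ Ms Mw).
    by rewrite innerZr conjcK zE nmZ -/(cabs _) cabsJ z1 mul1r seminorm_hilbert.
  move=> Mu; apply: (le_trans (ler_norm _)).
  rewrite -ler_sqr ?nnegrE ?mulr_ge0 ?nm_ge0 ?(ltW (h_gt0 k))//.
  rewrite real_normK ?num_real// exprMn.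
  apply: discriminant_le; [exact: sqr_ge0|exact: sqr_ge0|move=> t].
  have := d_le _ (subspaceD Ms (Mm k) (subspaceZ (- t%:C) Ms Mu)).
  have -> : v - (m k + (- t%:C) *: u) = (v - m k) + t%:C *: u by module R[i].
  rewrite nm_sqrD innerZr conjc_real nmZr exprMn real_normK ?num_real//.
  have -> : complex.Re (t%:C * inner (v - m k) u) = t * complex.Re (inner (v - m k) u).
    by case: (inner _ _) => a b /=; rewrite mul0r subr0.
  have := mh k; move: (nm _) (nm u) (complex.Re _) (h k) => a b c x; lra.
have h3 := ler_wpM2r (nm_ge0 w) (pP k).
have aux (x y q z hk : R) : x <= hk * z -> y <= q * z -> q * z <= 2 * hk * z ->
  hk < e -> 0 <= z -> x + y <= 3 * z * e by nra.
exact: aux h1 h2 h3 ke (nm_ge0 w).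
Unshelve. all: by end_near. Qed.

End HilbertFacts.

Section QuasiStates.
Context {R : realType} {A : cstarAlgType R}.
Implicit Types (a b x y : A) (I : set A) (f g : A -> R).

(** The real part of a positive functional vanishing on I. The last clause is positivity of (1 +
    x)^* (1 + x) when f is extended to the unitization by the value 1 at the unit; it bounds the
    norm of f by 1. *)
Definition quasi_state I f :=
  [/\ rlinear f, forall i, I i -> f i = 0, forall y, f (cstar y) = f y,
      forall y, 0 <= f (cmul (cstar y) y) &
      forall x, -1 <= f (x + cstar x + cmul (cstar x) x)].

Section Representation.
Variables (H : hilbertType R) (pi : A -> H -> H).
Hypothesis rep : representation pi.

Lemma repD a b v : pi (a + b) v = pi a v + pi b v.
Proof. by have := rep_linear_l rep v 1 a b; rewrite !scale1r. Qed.
Lemma rep0l v : pi 0 v = 0.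
Proof. by apply: (addrI (pi 0 v)); rewrite -repD !addr0. Qed.
Lemma repZ c a v : pi (c *: a) v = c *: pi a v.
Proof. by have := rep_linear_l rep v c a 0; rewrite !addr0 rep0l addr0. Qed.
Lemma repN a v : pi (- a) v = - pi a v.
Proof. by rewrite -scaleN1r repZ scaleN1r. Qed.
Lemma repDr a u v : pi a (u + v) = pi a u + pi a v.
Proof. by have := rep_linear rep a 1 u v; rewrite !scale1r. Qed.
Lemma repZr c a v : pi a (c *: v) = c *: pi a v.
Proof. by have := rep_linear rep a c v 0; rewrite !addr0 (rep0 rep) addr0. Qed.
Lemma repNr a v : pi a (- v) = - pi a v.
Proof. by rewrite -scaleN1r repZr scaleN1r. Qed.

(** The last clause expands |pi x v + v|^2 >= 0 and uses |v| <= 1. *)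
Lemma vector_quasi_state I v : (forall i w, I i -> pi i w = 0) -> nm v <= 1 ->
  quasi_state I (fun a => complex.Re (inner (pi a v) v)).
Proof.
move=> piI v1; have starE a w : inner (pi (cmul (cstar a) a) w) w = (nm (pi a w) ^+ 2)%:C.
  by rewrite (repM rep) -inner_nm (rep_star rep) cstarK.
have ReD (z w : R[i]) : complex.Re (z + w) = complex.Re z + complex.Re w by case: z w => a b [].
split.
- split=> [a b|r a]; first by rewrite repD innerDl ReD.
  by rewrite repZ innerZl; case: (inner _ _) => c d /=; rewrite mul0r subr0.
- by move=> i Ii; rewrite piI// -(scale0r 0) innerZl mul0r.
- by move=> y; rewrite (rep_star rep) cstarK inner_conj; case: (inner _ _).
- by move=> y; rewrite starE/= exprn_ge0// nm_ge0.
- move=> x; rewrite !repD !innerDl !ReD starE (rep_star rep (cstar x)) cstarK.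
  rewrite (inner_conj (pi x v)).
  have := sqr_ge0 (nm (pi x v + v)); rewrite nm_sqrD.
  have := nm_ge0 v; move: v1; case: (inner _ _) => a b /=.
  move: (nm v) (nm (pi x v)) => p q; nra.
Qed.

End Representation.

(** |a|^2 - a^* a is the square of a self-adjoint multiplier S, and b^* S^2 b = (S b)^* (S b) is a
    square in A. *)
Lemma quasi_state_mull I f a b : quasi_state I f ->
  f (cmul (cstar (cmul a b)) (cmul a b)) <= nm a ^+ 2 * f (cmul (cstar b) b).
Proof.
move=> [[fD fZ] _ _ fpos _].
have Ta : bnd (mult_of (cmul (cstar a) a)) (nm a ^+ 2).
  by rewrite -nm_starM; exact: bnd_of.
have Ts : mstar (mult_of (cmul (cstar a) a)) = mult_of (cmul (cstar a) a).
  by rewrite mstar_of cstarM cstarK.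
have [S [Ss SS _ _]] := pos_sqrt (pos_of_bnd Ts Ta).
have := fpos (S b); rewrite -{1}Ss mstarP -mulE SS.
rewrite addE scaleE oppE oneE mult_ofE cmulBr cmulZr.
rewrite fD fZ -scaleN1r -(rmorph1 (real_complex R)) -rmorphN fZ mulN1r subr_ge0.
by rewrite cstarM !cmulA.
Qed.

End QuasiStates.

(** * The GNS construction *)

Section GNS.
Context {R : realType} {A : cstarAlgType R}.
Variables (I : set A) (f : A -> R).
Hypothesis fq : quasi_state I f.
Implicit Types (a b x y : A) (r t : R) (c : R[i]).

(** The complex linear functional with real part f. *)
Let F a : R[i] := f a +i* - f ('i%C *: a).

Let fD a b : f (a + b) = f a + f b. Proof. by case: fq => [[fD _] _ _ _ _]. Qed.
Let fZ r a : f (r%:C *: a) = r * f a. Proof. by case: fq => [[_ fZ] _ _ _ _]. Qed.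
Let f_star a : f (cstar a) = f a. Proof. by case: fq => [_ _ fs _ _]. Qed.
Let f_pos a : 0 <= f (cmul (cstar a) a). Proof. by case: fq => [_ _ _ fp _]. Qed.
Let fN a : f (- a) = - f a. Proof. by apply: rlinearN; case: fq. Qed.

Let conji : conjc 'i%C = - 'i%C :> R[i].
Proof. by apply/eqP; rewrite eq_complex/= oppr0 !eqxx. Qed.

Let F_linear c a b : F (c *: a + b) = c * F a + F b.
Proof.
have cE u : c *: u = (complex.Re c)%:C *: u + (complex.Im c)%:C *: ('i%C *: u) :> A.
  by rewrite {1}[c]complexE; module R[i].
have iE u : 'i%C *: ('i%C *: u) = - u :> A by rewrite scalerA -expr2 sqr_i scaleN1r.
rewrite /F scalerDr !scalerA (mulrC 'i%C) -scalerA !(cE _) iE !fD !fZ !fN.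
by case: c {cE} => p q /=; congr (_ +i* _); ring.
Qed.

Let F_star a : F (cstar a) = conjc (F a).
Proof.
have h : f ('i%C *: cstar a) = - f ('i%C *: a).
  by rewrite -f_star cstarZ cstarK conji scaleNr fN.
by rewrite /F f_star h.
Qed.

Let form a b := F (cmul (cstar b) a).

Let form_linear c u v w : form (c *: u + v) w = c * form u w + form v w.
Proof. by rewrite /form cmulDr cmulZr F_linear. Qed.

Let form_conj u v : form v u = conjc (form u v).
Proof. by rewrite /form -F_star cstarM cstarK. Qed.

Definition gns_form : semi_inner A := SemiInner form_linear form_conj f_pos.

Definition gns_space : hilbertType R := completion gns_form.
Implicit Types (phi psi : completion gns_form).
Local Notation n := (seminorm gns_form).

Lemma gns_seminormM a b : n (cmul a b) <= nm a * n b.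
Proof.
rewrite -ler_sqr ?nnegrE ?mulr_ge0 ?nm_ge0 ?seminorm_ge0// exprMn.
by rewrite !seminorm_sqr; exact: quasi_state_mull fq.
Qed.

(** A acts on functionals by transposition, so that no operator has to be extended by continuity. *)
Lemma gns_action_subproof a phi :
  (fun b => phi (cmul (cstar a) b)) \in bounded_antilinear gns_form.
Proof.
have [pl _] := completionP phi; apply/asboolP; split.
  by move=> c u v; rewrite cmulDr cmulZr pl.
exists (cnorm phi * nm a) => b; rewrite (le_trans (le_cnorm _ _))// -mulrA.
by rewrite ler_wpM2l ?cnorm_ge0// -(nm_star a) gns_seminormM.
Qed.

Definition gns_action a (phi : gns_space) : gns_space :=
  Completion (gns_action_subproof a phi).

Lemma gns_actionE a phi b : gns_action a phi b = phi (cmul (cstar a) b).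
Proof. by []. Qed.

Lemma gns_action_bound a phi : cnorm (gns_action a phi) <= nm a * cnorm phi.
Proof.
apply: cnorm_le; first by rewrite mulr_ge0 ?nm_ge0 ?cnorm_ge0.
move=> v; rewrite gns_actionE (le_trans (le_cnorm _ _))//.
rewrite (mulrC (nm a)) -mulrA ler_wpM2l ?cnorm_ge0//.
by rewrite -(nm_star a) gns_seminormM.
Qed.

Lemma gns_action_linear a : linear (gns_action a).
Proof. by move=> c u v; apply: completion_ext. Qed.

Lemma gns_action_to_completion a b :
  gns_action a (to_completion gns_form b) = to_completion gns_form (cmul a b).
Proof.
apply: completion_ext => c; rewrite gns_actionE !to_completionE /=.
by rewrite /form cstarM cstarK cmulA.
Qed.

(** Exact when psi comes from A, where both sides are the same evaluation of phi; the general case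
    follows by density. *)
Lemma gns_action_star a phi psi :
  inner (gns_action a phi) psi = inner phi (gns_action (cstar a) psi).
Proof.
apply/eqP; rewrite -subr_eq0; apply/eqP.
apply: (@cabs_small _ _ (cnorm (gns_action a phi) + cnorm phi * nm a)) => e /andP[e0 _].
have [b pb] := to_completion_dense psi e0.
set L := to_completion gns_form b.
have -> : inner (gns_action a phi) psi - inner phi (gns_action (cstar a) psi) =
    inner (gns_action a phi) (psi - L) - inner phi (gns_action (cstar a) (psi - L)).
  have -> : gns_action (cstar a) (psi - L) = gns_action (cstar a) psi - gns_action (cstar a) L.
    by apply: completion_ext.
  rewrite !innerDr !innerNr /L gns_action_to_completion !inner_to_completion gns_actionE.
  by move: (inner _ psi) (inner phi _) (phi _) => x y z; ring.
rewrite (le_trans (cabsD _ _))// cabsN mulrDl lerD//.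
  by rewrite (le_trans (inner_CS _ _))// !nm_cnorm ler_wpM2l ?cnorm_ge0.
rewrite (le_trans (inner_CS _ _))// !nm_cnorm -mulrA ler_wpM2l ?cnorm_ge0//.
by rewrite (le_trans (gns_action_bound _ _))// nm_star ler_wpM2l ?nm_ge0.
Qed.

Lemma gns_action_continuous a : continuous (gns_action a).
Proof. exact: bounded_linear_continuousC (gns_action_linear a) (gns_action_bound a). Qed.

Lemma gns_representation : representation gns_action.
Proof.
split.
- exact: gns_action_linear.
- exact: gns_action_continuous.
- move=> phi c a b; apply: completion_ext => v.
  have [pl _] := completionP phi.
  by rewrite caddE cscaleE !gns_actionE cstarD cstarZ cmulDl cmulZl pl conjcK.
- by move=> a b phi; apply: completion_ext => v; rewrite !gns_actionE cstarM cmulA.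
- exact: gns_action_star.
Qed.

Lemma gns_ideal_action i phi : (forall a b, I a -> I (cmul a b)) ->
  (forall a b, I b -> I (cmul a b)) -> (forall a, I a -> I (cstar a)) ->
  I i -> gns_action i phi = 0.
Proof.
move=> Ir Il Is Ii; apply: completion_ext => b; rewrite gns_actionE czeroE.
apply/cabs_eq0/le_anti; rewrite cabs_ge0 andbT.
rewrite (le_trans (le_cnorm _ _))//.
have -> : n (cmul (cstar i) b) = 0; last by rewrite mulr0.
rewrite /seminorm /= (_ : f _ = 0) ?sqrtr0//.
by have [_ fI _ _ _] := fq; apply: fI; apply/Il/Ir/Is.
Qed.

(** Cauchy-Schwarz against the missing unit: the last clause of [quasi_state] at t a reads 1 + 2 t f
    a + t^2 f (a^* a) >= 0. *)
Lemma quasi_state_CS a : cabs (F a) <= n a.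
Proof.
have Fl : antilinear (fun b : A => (conjc (F b) : R[i]^o)).
  by move=> c u v; rewrite F_linear rmorphD rmorphM.
rewrite -cabsJ -[leRHS]mul1r; apply: (antilinear_bound Fl) => {}a.
rewrite mul1r (le_trans (ler_norm _))// -ler_sqr ?nnegrE ?seminorm_ge0//.
rewrite real_normK ?num_real// seminorm_sqr/= -[leRHS]mul1r.
apply: discriminant_le => //.
move=> t; have [_ _ _ _ /(_ (t%:C *: a))] := fq.
rewrite cstarZr cmulZl cmulZr !fD !fZ f_star; lra.
Qed.

(** The cyclic vector is the functional that a unit would represent, b |-> F (b^* 1). *)
Lemma gns_vector_subproof :
  (fun b => (conjc (F b) : R[i]^o)) \in bounded_antilinear gns_form.
Proof.
apply/asboolP; split.
  by move=> c u v; rewrite F_linear rmorphD rmorphM.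
by exists 1 => v; rewrite mul1r cabsJ quasi_state_CS.
Qed.

Definition gns_vector : gns_space := Completion gns_vector_subproof.

Lemma nm_gns_vector : nm gns_vector <= 1.
Proof.
rewrite nm_cnorm; apply: cnorm_le => // v.
by rewrite mul1r -[X in cabs X]/(conjc (F v)) cabsJ quasi_state_CS.
Qed.

Lemma gns_cyclic a : gns_action a gns_vector = to_completion gns_form a.
Proof.
apply: completion_ext => b; rewrite gns_actionE to_completionE.
rewrite -[LHS]/(conjc (F (cmul (cstar a) b))) -F_star cstarM cstarK.
by [].
Qed.

Lemma gns_vectorE a : complex.Re (inner (gns_action a gns_vector) gns_vector) = f a.
Proof.
by rewrite gns_cyclic inner_conj inner_to_completion.
Qed.

Hypothesis f_extreme : forall g g' l, quasi_state I g -> quasi_state I g' ->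
  0 < l < 1 -> (forall x, f x = l * g x + (1 - l) * g' x) -> f = g.
Hypothesis f_neq0 : exists a, f a <> 0.
Hypothesis I_r : forall a b, I a -> I (cmul a b).
Hypothesis I_l : forall a b, I b -> I (cmul a b).
Hypothesis I_star : forall a, I a -> I (cstar a).

(** A closed invariant M splits xi into p + q and f accordingly. If neither part is 0, f is a convex
    combination of quasi-states; extremality gives p = s xi with s = |p|^2, so q is a multiple of p,
    hence in M and orthogonal to itself. *)
Lemma gns_irreducible : irreducible gns_action.
Proof.
have rep := gns_representation.
split.
  have [a fa] := f_neq0; exists a, gns_vector; apply/eqP => h; apply: fa.
  by rewrite -gns_vectorE h -(scale0r 0) innerZl mul0r.
move=> M Ms Minv; have [Mcl M0 _] := Ms; pose xi := gns_vector.
have [p Mp qM] := orthogonal_projection xi Ms.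
have [q qE] : exists q, q = xi - p by exists (xi - p).
have xiE : xi = p + q by rewrite qE addrC subrK.
rewrite -qE in qM.
have qM' m : M m -> inner m q = 0 by move=> Mm; rewrite inner_conj qM// conjc0.
have ReD (z w : R[i]) : complex.Re (z + w) = complex.Re z + complex.Re w by case: z w => a b [].
have fE a : f a = complex.Re (inner (gns_action a p) p) + complex.Re (inner (gns_action a q) q).
  rewrite -gns_vectorE -/xi xiE (repDr rep) !innerDl !innerDr.
  rewrite (qM' (gns_action a p)) ?(rep_star rep a q)//; last exact: Minv.
  rewrite (qM (gns_action (cstar a) p)); last exact: Minv.
  by rewrite addr0 add0r ReD.
have npq : nm xi ^+ 2 = nm p ^+ 2 + nm q ^+ 2.
  by rewrite {1}xiE nm_sqrD qM'//= mulr0 addr0.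
have xi1 : nm xi ^+ 2 <= 1.
  have := nm_gns_vector; rewrite -/xi; have := nm_ge0 xi; move: (nm xi) => x; nra.
(* Then M is orthogonal to xi, hence to its dense orbit. *)
have [p0|pN0] := eqVneq p 0.
  left; apply/seteqP; split=> [m Mm|_ ->//]; apply: completion_ext => a.
  have := qM (gns_action (cstar a) m) (Minv _ _ Mm).
  rewrite qE p0 subr0 inner_conj gns_action_star cstarK gns_cyclic inner_to_completion.
  by move=> h; rewrite czeroE -(conjcK (m a)) h conjc0.
(* Then xi lies in M, and so does the closure of its orbit. *)
have [q0|qN0] := eqVneq q 0.
  right; apply/seteqP; split=> // phi _.
  have Mxi : M xi by rewrite xiE q0 addr0.
  apply: Mcl => U Uphi.
  have [e /= e0 eU] := (nbhs_ballP _ _).1 Uphi.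
  have [e' e'0 ee'] := posC_real e0.
  have e2 : 0 < e' / 2 by rewrite divr_gt0.
  have [a pa] := to_completion_dense phi e2.
  exists (to_completion gns_form a); split.
    by rewrite -gns_cyclic; exact: Minv.
  apply: eU; rewrite -ball_normE /ball_/= ee' nmE ltcR nm_cnorm.
  by rewrite (le_lt_trans pa)// ltr_pdivrMr// ltr_pMr// ltr1n.
exfalso.
have nonneg (w : gns_space) : w != 0 -> 0 < nm w ^+ 2.
  move=> wN0; rewrite exprn_gt0// lt_neqAle nm_ge0 andbT eq_sym.
  by apply: contra_neq wN0; exact: nm_eq0.
pose s := nm p ^+ 2; pose t := nm q ^+ 2.
have s0 : 0 < s := nonneg _ pN0.
have t0 : 0 < t := nonneg _ qN0.
have st1 : s + t <= 1 by rewrite /s /t -npq.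
have s1 : 0 < 1 - s by move: (t0) st1; lra.
have I0 i w : I i -> gns_action i w = 0 by move=> Ii; exact: gns_ideal_action.
have scaled w r : 0 <= r -> r * nm w ^+ 2 <= 1 ->
    quasi_state I (fun a => r * complex.Re (inner (gns_action a w) w)).
  move=> r0 rw; have rs : Num.sqrt r ^+ 2 = r by rewrite sqr_sqrtr.
  have -> : (fun a => r * complex.Re (inner (gns_action a w) w)) =
     fun a => complex.Re (inner (gns_action a ((Num.sqrt r)%:C *: w)) ((Num.sqrt r)%:C *: w)).
    apply/funext => a; rewrite (repZr rep) innerZl innerZr conjc_real.
    case: (inner (gns_action a w) w) => x y /=.
    by rewrite !mul0r !subr0 mulrA -expr2 rs.
  apply: vector_quasi_state => //.
  rewrite nmZr -(ler_sqr _ _)//?nnegrE ?mulr_ge0 ?nm_ge0// exprMn.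
  by rewrite real_normK ?num_real// rs expr1n.
have g1 : quasi_state I (fun a => s^-1 * complex.Re (inner (gns_action a p) p)).
  by apply: scaled; rewrite ?invr_ge0 ?(ltW s0)// mulVf// gt_eqF.
(* The weight is 1 - s and not |q|^2, as only |xi| <= 1 is known; |q|^2 <= 1 - s keeps the bound. *)
have g2 : quasi_state I (fun a => (1 - s)^-1 * complex.Re (inner (gns_action a q) q)).
  by apply: scaled; rewrite ?invr_ge0 ?(ltW s1)// mulrC ler_pdivrMr// mul1r lerBrDl.
have fg := f_extreme g1 g2 (l := s) _ _.
have {}fg : f = fun a => s^-1 * complex.Re (inner (gns_action a p) p).
  apply: fg => [|a]; first by rewrite s0 -subr_gt0.
  by rewrite fE !mulrA !divff ?gt_eqF// !mul1r.
have key a : complex.Re (p a) = s * complex.Re (xi a).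
  have h1 : inner (gns_action (cstar a) p) p = inner (gns_action (cstar a) p) xi.
    by rewrite xiE innerDr (qM' (gns_action _ _)) ?addr0//; exact: Minv.
  have := congr1 (fun g => s * g (cstar a)) fg.
  rewrite mulrA divff ?gt_eqF// mul1r h1 gns_action_star cstarK gns_cyclic.
  rewrite inner_to_completion => <-; congr (_ * _).
  by rewrite -[xi a]/(conjc (F a)) f_star.
(* The imaginary part of p a comes from [key] at i a. *)
have pxi : p = s%:C *: xi.
  apply: completion_ext => a; rewrite cscaleE.
  have [pl _] := completionP p; have [xl _] := completionP xi.
  have := key a; have := key ('i%C *: a); rewrite !antilinearZ// conji.
  case: (p a) (xi a) => [x y] [z w] /= h1 h2.
  by apply/eqP; rewrite eq_complex/= h2; apply/andP; split; apply/eqP; move: h1; lra.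
have Mq : M q.
  have -> : q = (s^-1 - 1)%:C *: p.
    rewrite rmorphB rmorph1 scalerBl scale1r {1}pxi scalerA -rmorphM/= mulVf ?gt_eqF//.
    by rewrite scale1r.
  exact: subspaceZ.
have := qM q Mq; rewrite inner_nm => /complexI/eqP.
by rewrite gt_eqF.
Qed.

End GNS.

(** * Existence of irreducible representations *)

Section PositiveCone.
Context {R : realType} {A : cstarAlgType R}.
Variable I : set A.
Implicit Types (a b x y : A) (r t : R) (c : R[i]) (f g : A -> R).

(* cone t a expresses that t - a is positive modulo I in the unitization. *)
Inductive cone : R -> A -> Prop :=
| cone_one x : cone 1 (- (x + cstar x + cmul (cstar x) x))
| cone_sqr y : cone 0 (- cmul (cstar y) y)
| cone_ideal i : I i -> cone 0 i
| cone_skew y : cone 0 (y - cstar y)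
| cone_add t t' a a' : cone t a -> cone t' a' -> cone (t + t') (a + a')
| cone_scale r t a : 0 <= r -> cone t a -> cone (r * t) (r%:C *: a).

Lemma cone_ge0 t a : cone t a -> 0 <= t.
Proof.
by elim=> {t a} // [t t' a a' _ t0 _ t0'|r t a r0 _ t0]; [exact: addr_ge0|exact: mulr_ge0].
Qed.

Lemma cone_eq t t' a a' : cone t a -> t = t' -> a = a' -> cone t' a'.
Proof. by move=> ca <- <-. Qed.

(** For k = h / r: 2 (1 - k) = (1 - k)^2 + (1 - k^2)^2 + (k^2 - k^4). The last term is a multiple of
    (S h)^* (S h) with S^2 = r^2 - h^2, a square in A itself, so only generators of the cone
    occur. *)
Lemma cone_selfadjoint r h : cstar h = h -> 0 < r -> nm h <= r -> cone r h.
Proof.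
move=> hs r0 hr; pose q := r^-1; have rq : r * q = 1 by rewrite divff// gt_eqF.
pose d := q * q.
have hhs : cstar (cmul h h) = cmul h h by rewrite cstarM hs.
have Tb : bnd (mult_of (cmul h h)) (r ^+ 2).
  apply: bndW (bnd_of _) _; rewrite (le_trans (nmM _ _))//.
  by rewrite expr2; apply: ler_pM; rewrite ?nm_ge0.
have Ts : mstar (mult_of (cmul h h)) = mult_of (cmul h h) by rewrite mstar_of hhs.
have [S [Ss SS _ _]] := pos_sqrt (pos_of_bnd Ts Tb).
have c1 := cone_sqr (S h).
have E1 : cmul (cstar (S h)) (S h) = (r ^+ 2)%:C *: cmul h h - cmul (cmul h h) (cmul h h).
  rewrite -{1}Ss mstarP -mulE SS addE scaleE oppE oneE mult_ofE hs cmulBr cmulZr.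
  by rewrite !cmulA.
have c2 := cone_one ((- d)%:C *: cmul h h).
have c3 := cone_one ((- q)%:C *: h).
have d2 : 0 <= d ^+ 2 by rewrite sqr_ge0.
have c1' : cone 0 (- (d%:C *: cmul h h - (d ^+ 2)%:C *: cmul (cmul h h) (cmul h h))).
  apply: cone_eq (cone_scale d2 c1) _ _; first by rewrite mulr0.
  rewrite E1 scalerN scalerBr scalerA -rmorphM/=; congr (- (_%:C *: _ - _)).
  have -> : d ^+ 2 * r ^+ 2 = d * (r * q) ^+ 2 by rewrite /d; ring.
  by rewrite rq expr1n mulr1.
have c4 : cone 2 ((2 * q)%:C *: h).
  apply: cone_eq (cone_add (cone_add c2 c1') c3) _ _; first by ring.
  by rewrite !cstarZr hhs hs !cmulZl !cmulZr /d; module R[i].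
have r2 : 0 <= r / 2 by rewrite divr_ge0// ltW.
apply: cone_eq (cone_scale r2 c4) _ _; first by rewrite divfK.
rewrite scalerA -rmorphM/= (_ : r / 2 * (2 * q) = r * q); last by field.
by rewrite rq scale1r.
Qed.

Lemma cone_nonempty a : exists t, cone t a.
Proof.
pose h := (2^-1)%:C *: (a + cstar a).
have hs : cstar h = h by rewrite cstarZr cstarD cstarK addrC.
have r0 : 0 < nm h + 1 by rewrite ltr_wpDl// nm_ge0.
have hr : nm h <= nm h + 1 by rewrite lerDl.
have i2 : 0 <= 2^-1 :> R by rewrite invr_ge0.
have c := cone_add (cone_selfadjoint hs r0 hr) (cone_scale i2 (cone_skew a)).
exists (nm h + 1 + 2^-1 * 0); apply: cone_eq c _ _ => //.
by rewrite /h; module R[i].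
Qed.

Definition cone_gauge a := inf [set t | cone t a].

Lemma cone_gauge_has_inf a : has_inf [set t | cone t a].
Proof.
split; first by have [t ct] := cone_nonempty a; exists t.
by exists 0 => t /cone_ge0.
Qed.

Lemma cone_gauge_le t a : cone t a -> cone_gauge a <= t.
Proof. by move=> ct; apply: ge_inf => //; case: (cone_gauge_has_inf a). Qed.

Lemma le_cone_gauge r a : (forall t, cone t a -> r <= t) -> r <= cone_gauge a.
Proof. by move=> h; apply: lb_le_inf; first by case: (cone_gauge_has_inf a). Qed.

Lemma cone_gauge_ge0 a : 0 <= cone_gauge a.
Proof. by apply: le_cone_gauge => t /cone_ge0. Qed.

Lemma cone_gauge_sublinear : sublinear cone_gauge.
Proof.
split=> [x y|].
  rewrite -lerBlDr; apply: le_cone_gauge => t ct; rewrite lerBlDl -lerBlDr.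
  apply: le_cone_gauge => t' ct'; rewrite lerBlDr addrC.
  by apply: cone_gauge_le; apply: cone_eq (cone_add ct ct') _ _; rewrite // addrC.
have le r x : 0 <= r -> cone_gauge (r%:C *: x) <= r * cone_gauge x.
  rewrite le_eqVlt => /predU1P[<-|r0].
    rewrite mul0r; apply: cone_gauge_le.
    have [t ct] := cone_nonempty x.
    by apply: cone_eq (cone_scale (lexx 0) ct) _ _; rewrite ?mul0r.
  rewrite -ler_pdivrMl//; apply: le_cone_gauge => t ct.
  by rewrite ler_pdivrMl//; apply: cone_gauge_le; apply: cone_scale => //; exact: ltW.
move=> r x; rewrite le_eqVlt => /predU1P[<-|r0].
  by apply/le_anti; rewrite le//= mul0r cone_gauge_ge0.
apply/le_anti; rewrite le ?(ltW r0)//= -ler_pdivlMl//.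
have := le r^-1 (r%:C *: x); rewrite scalerA -rmorphM/= mulVf ?gt_eqF// scale1r.
by apply; rewrite invr_ge0 ltW.
Qed.

Lemma dominated_quasi_state f : (forall i c, I i -> I (c *: i)) ->
  rlinear f -> dominated f cone_gauge -> quasi_state I f.
Proof.
move=> IZ fl fp; have fc t a : cone t a -> f a <= t.
  by move=> ct; rewrite (le_trans (fp a))// cone_gauge_le.
have [fD fZ] := fl; split=> //.
- move=> i Ii; apply/le_anti; rewrite (fc _ _ (cone_ideal Ii))/=.
  rewrite -oppr_le0 -rlinearN// -scaleN1r.
  by rewrite (fc _ _ (cone_ideal (IZ _ _ Ii))).
- move=> y; have := fc _ _ (cone_skew y); have := fc _ _ (cone_skew (cstar y)).
  by rewrite cstarK !fD !rlinearN//; lra.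
- by move=> y; have := fc _ _ (cone_sqr y); rewrite rlinearN// oppr_le0.
- by move=> x; have := fc _ _ (cone_one x); rewrite rlinearN// lerNl.
Qed.

(** With [dominated_quasi_state] this identifies quasi-states with functionals below the gauge, so
    extremality in one sense is extremality in the other. *)
Lemma quasi_state_dominated g : quasi_state I g -> dominated g cone_gauge.
Proof.
move=> [gl gI gs gp g1] a; apply: le_cone_gauge; have [gD gZ] := gl.
move=> t; elim=> {t a} [x|y|i /gI ->//|y|t t' a a' _ ga _ ga'|r t a r0 _ ga].
- by rewrite rlinearN// lerNl.
- by rewrite rlinearN// oppr_le0.
- by rewrite gD rlinearN// gs subrr.
- by rewrite gD lerD.
- by rewrite gZ ler_wpM2l.
Qed.

Hypothesis I_r : forall a b, I a -> I (cmul a b).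
Hypothesis I_l : forall a b, I b -> I (cmul a b).
Hypothesis I_star : forall a, I a -> I (cstar a).
Hypothesis IZ : forall i c, I i -> I (c *: i).

(** The gauge of k is at least m, and the extreme functional attains the gauge at k. *)
Theorem irreducible_representation k m : 0 < m -> (forall t, cone t k -> m <= t) ->
  exists (H : hilbertType R) (pi : A -> H -> H) (xi : H),
    [/\ representation pi, irreducible pi, forall i v, I i -> pi i v = 0,
        nm xi <= 1 & m <= complex.Re (inner (pi k xi) xi)].
Proof.
move=> m0 mk; have [f [fl fp fk fext]] := extreme_functional k cone_gauge_sublinear.
have fq := dominated_quasi_state IZ fl fp.
have mf : m <= f k by rewrite fk; exact: le_cone_gauge.
exists (gns_space fq), (@gns_action _ _ _ _ fq), (gns_vector fq); split.
- exact: gns_representation.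
- apply: gns_irreducible => //; last by exists k => f0; move: mf; rewrite f0 leNgt m0.
  move=> g g' l gq gq' l01 h; apply: fext l01 h.
  + by case: gq.
  + by case: gq'.
  + exact: quasi_state_dominated.
  + exact: quasi_state_dominated.
- by move=> i v Ii; exact: gns_ideal_action.
- exact: nm_gns_vector.
- by rewrite gns_vectorE.
Qed.

End PositiveCone.

(** * From the cone to norms and primitive ideals *)

Section Existence.
Context {R : realType} {A : cstarAlgType R}.
Implicit Types (a b x y : A) (r t : R) (c : R[i]).
Local Notation M := (mult A).

(** Cone elements need not be self-adjoint. Passing to a + a^* cancels the skew generators at the
    cost of a factor 2, and i collects the contributions of the ideal. *)
Lemma cone_pos I t a : (forall a b, I a -> I b -> I (a + b)) -> I 0 ->
  (forall i c, I i -> I (c *: i)) -> (forall a, I a -> I (cstar a)) ->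
  cone I t a ->
  exists2 i, I i & pos ((2 * t)%:C *: (1 : M) - mult_of (a + cstar a) + mult_of i).
Proof.
move=> ID I0 IZ Is; elim=> {t a} [x|y|i Ii|y|t t' a a' _ [i Ii pi] _ [i' Ii' pi']|r t a r0 _ [i Ii pi]].
- exists 0 => //.
  have -> : (2 * 1)%:C *: (1 : M) - mult_of (- (x + cstar x + cmul (cstar x) x) +
      cstar (- (x + cstar x + cmul (cstar x) x))) + mult_of 0 =
      2%:R%:C *: (mstar (1 + mult_of x) * (1 + mult_of x)).
    rewrite mstarD mstar1 mstar_of cstarN !cstarD cstarM !cstarK.
    rewrite !(mult_ofD, mult_ofN, mult_of0, mult_ofM) !(mulrDl, mulrDr) !(mul1r, mulr1).
    by module R[i].
  by apply: posZ; [exact: ler0n|exact: pos_cstar].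
- exists 0 => //.
  have -> : (2 * 0)%:C *: (1 : M) - mult_of (- cmul (cstar y) y + cstar (- cmul (cstar y) y))
      + mult_of 0 = 2%:R%:C *: (mstar (mult_of y) * mult_of y).
    rewrite mulr0 mstar_of cstarN cstarM cstarK !(mult_ofD, mult_ofN, mult_of0, mult_ofM).
    by module R[i].
  by apply: posZ; [exact: ler0n|exact: pos_cstar].
- exists (i + cstar i); first by apply: ID => //; exact: Is.
  by rewrite mulr0 scale0r add0r addNr; exact: pos0.
- exists 0 => //.
  rewrite mulr0 scale0r add0r mult_of0 addr0 cstarB cstarK.
  by rewrite (_ : _ + _ = 0) ?mult_of0 ?oppr0; [exact: pos0|module R[i]].
- exists (i + i'); first exact: ID.
  have := posD pi pi'; congr pos; rewrite !cstarD !mult_ofD !rmorphM rmorphD.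
  by module R[i].
- exists (r%:C *: i); first exact: IZ.
  have := posZ r0 pi; congr pos; rewrite cstarZr !mult_ofD !mult_ofZ !rmorphM.
  by module R[i].
Qed.

(** With I = 0 the gauge of k = a^* a is at least |k| = |a|^2: if t - k is positive then - t <= k <=
    t, as k is positive, and [bnd_pos_summand] gives |k| <= t. *)
Theorem norm_attained a : a != 0 ->
  exists (H : hilbertType R) (pi : A -> H -> H) (xi : H),
    [/\ representation pi, irreducible pi, nm xi <= 1 & nm a <= nm (pi a xi)].
Proof.
move=> aN0; pose I : set A := [set 0]; pose k := cmul (cstar a) a.
have ks : cstar k = k by rewrite cstarM cstarK.
have a0 : 0 < nm a.
  by rewrite lt_neqAle nm_ge0 andbT eq_sym; apply: contra_neq aN0; exact: nm_eq0.
have [||||||H [pi [xi [rep irr _ xi1 h]]]] :=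
  @irreducible_representation _ _ I _ _ _ _ k (nm a ^+ 2).
- by move=> x y ->; rewrite /I/= cmul0l.
- by move=> x y ->; rewrite /I/= cmul0r.
- by move=> x ->; rewrite /I/= cstar0.
- by move=> x c ->; rewrite /I/= scaler0.
- by rewrite exprn_gt0.
- move=> t ct; have t0 := cone_ge0 ct.
  have [||||i -> p] := @cone_pos I t k _ _ _ _ ct => //.
  + by move=> x y -> ->; rewrite /I/= addr0.
  + by move=> x c ->; rewrite /I/= scaler0.
  + by move=> x ->; rewrite /I/= cstar0.
  have kpos : pos (mult_of k) by rewrite mult_ofM -mstar_of; exact: pos_cstar.
  rewrite -nm_starM; apply: bnd_of_le; apply: bnd_pos_summand => //.
  + have i2 : 0 <= 2^-1 :> R by rewrite invr_ge0.
    have := posZ i2 p; congr pos; rewrite ks -/k mult_of0 mult_ofD rmorphM; module R[i].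
  + by apply: posD => //; apply: posZ => //; rewrite -[1]mulr1 -{1}mstar1; exact: pos_cstar.
  + by rewrite mstar_of ks.
exists H, pi, xi; split=> //.
move: h; rewrite (repM rep) (rep_star rep) cstarK inner_nm/=.
by rewrite ler_sqr ?nnegrE ?nm_ge0.
Qed.

(** Purely algebraic, so that sums of kernels and unions over a filter qualify directly. *)
Definition star_ideal (I : set A) :=
  [/\ I 0, forall a b, I a -> I b -> I (a + b), forall i c, I i -> I (c *: i),
      forall a, I a -> I (cstar a) &
      (forall a b, I a -> I (cmul a b)) /\ (forall a b, I b -> I (cmul a b))].

(** The gauge of e is at least 1: for t < 1 in the cone, D = 2 - e - e^* + i would be bounded below
    by 2 (1 - t) > 0, hence invertible, whereas D maps A into the proper ideal I. *)
Theorem primitive_ideal_above (I : set A) (e : A) : star_ideal I ->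
  (forall a, I (cmul e a - a) /\ I (cmul a e - a)) -> (exists a, ~ I a) ->
  exists P : Prim A, I `<=` prim_ideal P.
Proof.
move=> [I0 ID IZ Is [Ir Il]] eI [a0 Ia0].
have [|H [pi [xi [rep irr piI _ _]]]] :=
  @irreducible_representation _ _ I Ir Il Is IZ e 1 ltr01.
- move=> t ct; rewrite leNgt; apply/negP => t1; apply: Ia0.
  have [i Ii p] := cone_pos ID I0 IZ Is ct.
  pose d := 2 * (1 - t); have d0 : 0 < d by rewrite mulr_gt0// subr_gt0.
  pose D := (2%:R)%:C *: (1 : M) - mult_of (e + cstar e) + mult_of i.
  have Dd : pos (D - d%:C *: (1 : M)).
    move: p; congr pos; rewrite /D /d !rmorphM rmorphB.
    by rewrite !rmorph_nat; module R[i].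
  have [S [DS _ _]] := mult_inverse d0 Dd.
  have DI b : I (D b).
    have -> : D b = (- 1) *: (cmul e b - b) + ((- 1) *: (cmul (cstar e) b - b) + cmul i b).
      rewrite /D !addE oppE scaleE oneE !mult_ofE cmulDl.
      by rewrite rmorph_nat; module R[i].
    have [eb _] := eI b; apply: (ID); first exact: (IZ).
    apply: (ID); last exact: Ir.
    apply: (IZ); rewrite (_ : _ - _ = cstar (cmul (cstar b) e - cstar b)).
      by apply: Is; have [] := eI (cstar b).
    by rewrite cstarB cstarM !cstarK.
  by rewrite -[a0](oneE a0) -DS mulE.
- exists (MkPrim (ex_intro _ H (ex_intro _ pi (And3 rep irr erefl)))) => i Ii v /=.
  exact: piI.
Qed.

End Existence.

(** * The Dauns-Hofmann theorem *)

Section PrimitiveIdeals.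
Context {R : realType} {A : cstarAlgType R}.
Implicit Types (a b x y : A) (r t s : R) (c : R[i]) (P Q : Prim A) (F : set (Prim A)).
Local Notation M := (mult A).

Definition rep_of P (H : hilbertType R) (pi : A -> H -> H) :=
  [/\ representation pi, irreducible pi &
      prim_ideal P = [set a | forall v, pi a v = 0]].

Lemma rep_of_ex P : exists (H : hilbertType R) (pi : A -> H -> H), rep_of P pi.
Proof. by case: P => P PP; have [H [pi pP]] := PP; exists H, pi. Qed.

Lemma rep_nondegenerate (H : hilbertType R) (pi : A -> H -> H) w :
  representation pi -> irreducible pi -> (forall a, pi a w = 0) -> w = 0.
Proof.
move=> rep [[a [v av]] irr] w0.
have [Ns Ni] := annihilated_subspace rep (J := setT) (fun _ _ _ => Logic.I).
have [N0|NT] := irr _ Ns Ni.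
  have : [set v | forall b, [set: A] b -> pi b v = 0] w by move=> b _; exact: w0.
  by rewrite N0.
have : [set v | forall b, [set: A] b -> pi b v = 0] v by rewrite NT.
by move=> /(_ a Logic.I)/eqP; rewrite (negPf av).
Qed.

(** The vector quasi-state at a^* a is at most the gauge, hence at most |a|^2 + e; the e > 0
    provides the positive bound that [cone_selfadjoint] asks for. *)
Lemma rep_contractive (H : hilbertType R) (pi : A -> H -> H) a v :
  representation pi -> nm (pi a v) <= nm a * nm v.
Proof.
move=> rep.
have unit_ball w : nm w <= 1 -> nm (pi a w) <= nm a.
  move=> w1; rewrite -ler_sqr ?nnegrE ?nm_ge0//.
  have kern i u : [set (0 : A)] i -> pi i u = 0 by move=> ->; exact: rep0l.
  have /quasi_state_dominated/(_ (cmul (cstar a) a)) := vector_quasi_state rep kern w1.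
  rewrite (repM rep) (rep_star rep) cstarK inner_nm/= => h; apply: (le_trans h).
  apply/ler_addgt0Pr => e e0; apply: cone_gauge_le; apply: cone_selfadjoint.
  - by rewrite cstarM cstarK.
  - by rewrite ltr_wpDl// sqr_ge0.
  - by rewrite nm_starM lerDl ltW.
have [->|vN0] := eqVneq v 0; first by rewrite (rep0 rep) nm0 mulr0.
have v0 : 0 < nm v.
  by rewrite lt_neqAle nm_ge0 andbT eq_sym; apply: contra_neq vN0; exact: nm_eq0.
have := unit_ball ((nm v)^-1%:C *: v).
rewrite (repZr rep) !nmZr ger0_norm ?invr_ge0 ?(ltW v0)// mulVf ?gt_eqF// lexx => /(_ isT).
by rewrite ler_pdivrMl// mulrC.
Qed.

Lemma nm_le_rep a r : 0 <= r ->
  (forall P (H : hilbertType R) (pi : A -> H -> H), rep_of P pi ->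
     forall v, nm (pi a v) <= r * nm v) -> nm a <= r.
Proof.
move=> r0 ar; have [->|aN0] := eqVneq a 0; first by rewrite nm0.
have [H [pi [xi [rep irr xi1 h]]]] := norm_attained aN0.
pose P := MkPrim (ex_intro _ H (ex_intro _ pi (And3 rep irr erefl))).
have := ar P H pi (And3 rep irr erefl) xi.
have := nm_ge0 xi; move: (nm xi) (nm a) (nm (pi a xi)) xi1 h => x y z; nra.
Qed.

Lemma prim_semisimple a : (forall P, prim_ideal P a) -> a = 0.
Proof.
move=> aP; apply: nm_le0; apply: nm_le_rep => // P H pi [_ _ PE] v.
by have := aP P; rewrite PE => ->; rewrite nm0 mul0r.
Qed.

Lemma prim_star_ideal P : star_ideal (prim_ideal P).
Proof.
have [H [pi [rep irr PE]]] := rep_of_ex P; rewrite PE; split.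
- by move=> v; exact: rep0l.
- by move=> a b a0 b0 v; rewrite (repD rep) a0 b0 addr0.
- by move=> a c a0 v; rewrite (repZ rep) a0 scaler0.
- move=> a a0 v; apply: inner0_eq => w.
  by rewrite (rep_star rep) cstarK a0 inner_conj -(scale0r 0) innerZl mul0r conjc0.
- by split=> a b h v; rewrite (repM rep) h// (rep0 rep).
Qed.

Lemma kernel_star_ideal F : star_ideal (kernel_of F).
Proof.
split.
- by move=> Q _; have [] := prim_star_ideal Q.
- by move=> a b ka kb Q FQ; have [_ D _ _ _] := prim_star_ideal Q; apply: D; [exact: ka|exact: kb].
- by move=> a c ka Q FQ; have [_ _ Z _ _] := prim_star_ideal Q; apply: Z; exact: ka.
- by move=> a ka Q FQ; have [_ _ _ S _] := prim_star_ideal Q; apply: S; exact: ka.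
- by split=> a b k Q FQ; [apply: prim_mulr|apply: prim_mull]; exact: k.
Qed.

Lemma openPrim (U : set (Prim A)) : open U = hk_open U.
Proof. by []. Qed.

Lemma hull_kernel_closed F : closed F -> hull (kernel_of F) `<=` F.
Proof.
move=> cF P; have : hk_open (~` F) by rewrite -openPrim; exact: closed_openC.
by rewrite /hk_open setCK; apply.
Qed.

Lemma closed_hull (I : set A) : closed (hull I).
Proof.
rewrite -[hull I]setCK; apply: open_closedC; rewrite openPrim => P.
by rewrite setCK => PI a Ia; apply: PI => Q; exact.
Qed.

Lemma closure_sub_hull F : closure F `<=` hull (kernel_of F).
Proof.
rewrite ((closure_id (hull _)).1 (@closed_hull _)).
by apply: closureS => P FP a; exact.
Qed.

(** * Realizing functions on Prim(A) by elements of A *)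

Section UnitalQuotient.
Variables (K : set (Prim A)) (e : A).
Hypothesis e_unit : forall a, kernel_of K (cmul e a - a) /\ kernel_of K (cmul a e - a).

Lemma unit_rep P (H : hilbertType R) (pi : A -> H -> H) v :
  rep_of P pi -> K P -> pi e v = v.
Proof.
move=> [rep irr PE] KP; apply/eqP; rewrite -subr_eq0; apply/eqP.
apply: (rep_nondegenerate rep irr) => b.
have [_ /(_ P KP)] := e_unit b; rewrite PE => /(_ v).
by rewrite (repD rep) (repN rep) (repM rep) (repDr rep) (repNr rep).
Qed.

(* The function 2t/(1+t^2) fixes 0 and 1 and is bounded by 1; it is applied to
   an element vanishing on E and equal to the unit on F. *)
Lemma urysohn_element (E F : set (Prim A)) : closed E -> closed F -> F `<=` K ->
  E `&` F = set0 -> exists b, nm b <= 1 /\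
    forall P (H : hilbertType R) (pi : A -> H -> H), rep_of P pi ->
      (E P -> forall v, pi b v = 0) /\ (F P -> forall v, pi b v = v).
Proof.
move=> cE cF FK EF.
pose I := [set a | exists x y, [/\ kernel_of E x, kernel_of F y & a = x + y]].
have [E0 ED EZ ES [Er El]] := kernel_star_ideal E.
have [F0 FD FZ FS [Fr Fl]] := kernel_star_ideal F.
have FI a : kernel_of F a -> I a by exists 0, a; rewrite add0r; split.
have EI a : kernel_of E a -> I a by exists a, 0; rewrite addr0; split.
have KF a : kernel_of K a -> kernel_of F a by move=> ka P /FK; exact: ka.
have Iid : star_ideal I.
  split; first exact: EI.
  - move=> _ _ [x [y [Ex Fy ->]]] [x' [y' [Ex' Fy' ->]]].
    by exists (x + x'), (y + y'); rewrite addrACA; split; [exact: ED|exact: FD|].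
  - move=> _ c [x [y [Ex Fy ->]]].
    by exists (c *: x), (c *: y); rewrite scalerDr; split; [exact: EZ|exact: FZ|].
  - move=> _ [x [y [Ex Fy ->]]].
    by exists (cstar x), (cstar y); rewrite cstarD; split; [exact: ES|exact: FS|].
  - split=> a b.
      move=> [x [y [Ex Fy ->]]]; exists (cmul x b), (cmul y b).
      by rewrite cmulDl; split; [exact: Er|exact: Fr|].
    move=> [x [y [Ex Fy ->]]]; exists (cmul a x), (cmul a y).
    by rewrite cmulDr; split; [exact: El|exact: Fl|].
(* Otherwise a primitive ideal above I = ker E + ker F would belong to the disjoint sets E and F. *)
have [x [y [Ex Fy exy]]] : I e.
  apply: contrapT => nIe.
  have [a||P IP] := @primitive_ideal_above _ _ I e Iid; last 2 first.
  - by exists e.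
  - have : (E `&` F) P; last by rewrite EF.
    split; apply: hull_kernel_closed => // a; first by move=> /EI; exact: IP.
    by move=> /FI; exact: IP.
  by have [k1 k2] := e_unit a; split; apply/FI/KF.
pose j := cmul (cstar x) x; have js : cstar j = j by rewrite cstarM cstarK.
pose J := mult_of j; have Js : mstar J = J by rewrite mstar_of js.
pose D := 1 + J * J.
have [S [DS SD Sc]] : exists S, [/\ D * S = 1, S * D = 1 & forall z, GRing.comm z D -> GRing.comm z S].
  apply: (@mult_inverse _ _ D 1) => //.
  have -> : D - 1%:C *: (1 : M) = J * J by rewrite /D rmorph1; module R[i].
  exact: pos_sqr.
have JD : GRing.comm J D by apply: commrD; [exact: commr1|apply: commrM].
have JS : GRing.comm J S := Sc _ JD.
have Ds : mstar D = D by rewrite mstarD mstar1 mstarM Js.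
have Ss : mstar S = S.
  rewrite -[mstar S]mulr1 -DS mulrA -[D in mstar S * D]Ds -mstarM DS mstar1.
  by rewrite mul1r.
pose b := S (2%:R%:C *: j).
have bE : mult_of b = 2%:R%:C *: (S * J) by rewrite -mul_mult_of mult_ofZ mscaleAr.
have Db : b + cmul j (cmul j b) = 2%:R%:C *: j.
  have := congr1 (fun T : M => T (2%:R%:C *: j)) DS.
  by rewrite mulE oneE addE oneE mulE.
exists b; split.
  (* b^2 + T^2 = 1, from (2 t)^2 + (1 - t^2)^2 = (1 + t^2)^2. *)
  apply: bnd_of_le; pose T := S * (1 - J * J).
  have S1J : GRing.comm S (1 - J * J).
    by apply: commrB; [exact: commr1|apply: commrM; exact: commr_sym].
  apply: (@bnd_summand _ _ _ T) => //.
  - by rewrite bE mstarZr mstarM Js Ss JS.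
  - by rewrite /T mstarM Ss mstarB mstar1 mstarM Js -S1J.
  - rewrite bE; apply: commr_sym; apply: commZr; apply: commr_sym; apply: commrM.
      by apply: commr_sym; apply: commrM; [|exact: commr_sym].
    apply: commrB; first exact: commr1.
    by apply: commrM; apply: commr_sym; apply: commrM.
  have sq (x1 y1 : M) : GRing.comm x1 y1 -> x1 * y1 * (x1 * y1) = x1 * x1 * (y1 * y1).
    by move=> xy; rewrite -!mulrA (mulrA y1) -xy -!mulrA.
  have -> : mult_of b * mult_of b + T * T = S * (S * D) * D.
    rewrite bE mscaleAl mscaleAr (sq S J (commr_sym JS)) (sq S _ S1J).
    have -> : S * (S * D) * D = S * S * (D * D) by rewrite !mulrA.
    rewrite -2!mscaleAr -mulrDr /D; congr (_ * _).
    by rewrite !(mulrBl, mulrBr, mulrDl, mulrDr) !(mul1r, mulr1); module R[i].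
  rewrite SD mulr1 SD expr1n; exact: bnd1.
move=> P H pi [rep irr PE]; have piE := unit_rep _ (And3 rep irr PE).
split=> hP v.
  have jv w : pi j w = 0 by rewrite (repM rep) (_ : pi x w = 0) ?(rep0 rep)//; have := Ex P hP; rewrite PE; apply.
  have := congr1 (pi^~ v) Db; rewrite (repD rep) (repM rep) (repZ rep) !jv.
  by rewrite addr0 scaler0.
have xv w : pi x w = w.
  have := piE w (FK _ hP); rewrite exy (repD rep) (_ : pi y w = 0) ?addr0//.
  by have := Fy P hP; rewrite PE; apply.
have xsv w : pi (cstar x) w = w.
  apply/eqP; rewrite -subr_eq0; apply/eqP/inner0_eq => u.
  by rewrite innerDl innerNl (rep_star rep) cstarK xv subrr.
have jv w : pi j w = w by rewrite (repM rep) xv xsv.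
have := congr1 (pi^~ v) Db; rewrite (repD rep) (repM rep j (cmul j b)) (repM rep j b) (repZ rep) !jv => h.
have -> : pi b v = (2^-1)%:C *: (pi b v + pi b v) by module R[i].
by rewrite h; module R[i].
Qed.

(** A layer-cake sum: [b i] is 0 where N h <= i and 1 where N h >= i + 1. At each P at most one
    summand is intermediate; it costs 1, rounding N h to an integer costs another 1, whence 2 /
    N. *)
Lemma level_approximation (h : Prim A -> R) (N : nat) : (0 < N)%N ->
  continuous h -> (forall P, 0 <= h P <= 1) -> (forall P, h P <> 0 -> K P) ->
  exists a, forall P (H : hilbertType R) (pi : A -> H -> H), rep_of P pi ->
    forall v, nm (pi a v - (h P)%:C *: v) <= 2 / N%:R * nm v.
Proof.
move=> N0 ch h01 hK; have NR : 0 < N%:R :> R by rewrite ltr0n.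
have /choice[b bP] : forall i : nat, exists b, nm b <= 1 /\
    forall P (H : hilbertType R) (pi : A -> H -> H), rep_of P pi ->
    (N%:R * h P <= i%:R -> forall v, pi b v = 0) /\
    (i.+1%:R <= N%:R * h P -> forall v, pi b v = v).
  move=> i; have [||||b [b1 bE]] := @urysohn_element
     (h @^-1` [set r | N%:R * r <= i%:R]) (h @^-1` [set r | i.+1%:R <= N%:R * r]).
  - apply: closed_comp => [P _|]; first exact: ch.
    rewrite (_ : [set r | _] = [set r | r <= i%:R / N%:R]); first exact: closed_le.
    by apply/seteqP; split=> r /=; rewrite ler_pdivlMr// mulrC.
  - apply: closed_comp => [P _|]; first exact: ch.
    rewrite (_ : [set r | _] = [set r | i.+1%:R / N%:R <= r]); first exact: closed_ge.
    by apply/seteqP; split=> r /=; rewrite ler_pdivrMr// mulrC.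
  - move=> P /= iP; apply: hK => h0; move: iP; rewrite h0 mulr0.
    by rewrite leNgt ltr0n.
  - rewrite -subset0 => P [/= h1 h2].
    by have := le_trans h2 h1; rewrite ler_nat ltnn.
  by exists b.
pose S m := \sum_(i < m) b i.
exists ((N%:R^-1)%:C *: S N) => P H pi pP v.
have [rep irr PE] := pP.
have key m : (m%:R <= N%:R * h P -> pi (S m) v = (m%:R)%:C *: v) /\
    (N%:R * h P <= m%:R -> nm (pi (S m) v - (N%:R * h P)%:C *: v) <= 2 * nm v).
  elim: m => [|m [IH1 IH2]].
    rewrite /S big_ord0 (rep0l rep) scale0r; split=> // h0.
    have -> : N%:R * h P = 0.
      by apply/le_anti; rewrite h0 mulr_ge0//; case/andP: (h01 P).
    by rewrite scale0r subrr nm0 mulr_ge0 ?nm_ge0.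
  have [b1 /(_ P H pi pP)[bz bo]] := bP m.
  have SE : pi (S m.+1) v = pi (S m) v + pi (b m) v.
    by rewrite /S big_ord_recr/= (repD rep).
  split=> hm.
    rewrite SE bo// IH1; last by rewrite (le_trans _ hm)// ler_nat.
    by rewrite -natr1 rmorphD rmorph1 scalerDl scale1r.
  have [hm'|hm'] := leP (N%:R * h P) m%:R; first by rewrite SE bz// addr0 IH2.
  rewrite SE IH1 ?(ltW hm')//.
  have -> : m%:R%:C *: v + pi (b m) v - (N%:R * h P)%:C *: v =
     pi (b m) v + (m%:R - N%:R * h P)%:C *: v by rewrite rmorphB; module R[i].
  rewrite (le_trans (nmD _ _))// nmZr (mulrDl 1 1) mul1r lerD//.
    by rewrite (le_trans (rep_contractive _ _ rep))// -[leRHS]mul1r ler_wpM2r ?nm_ge0.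
  rewrite -[leRHS]mul1r ler_wpM2r ?nm_ge0// ler_norml.
  by move: hm hm'; rewrite -natr1; lra.
have [_] := key N; case/andP: (h01 P) => h0 h1.
rewrite ler_piMr ?ler0n// => /(_ isT) kN.
have -> : pi ((N%:R^-1)%:C *: S N) v - (h P)%:C *: v =
   (N%:R^-1)%:C *: (pi (S N) v - (N%:R * h P)%:C *: v).
  rewrite (repZ rep) scalerBr scalerA -rmorphM/= mulrA mulVf ?mul1r//.
  by rewrite gt_eqF.
rewrite nmZr ger0_norm ?invr_ge0 ?(ltW NR)// (mulrC 2) -mulrA.
by rewrite ler_wpM2l ?invr_ge0 ?(ltW NR).
Qed.

(** The limit acts as the scalar h P in every irreducible representation at P; these separate the
    points of A, so z is central. *)
Theorem dauns_hofmann_element (h : Prim A -> R) :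
  continuous h -> (forall P, 0 <= h P <= 1) -> (forall P, h P <> 0 -> K P) ->
  exists z, (forall a, cmul z a = cmul a z) /\
    forall a P, prim_ideal P (cmul z a - (h P)%:C *: a).
Proof.
move=> ch h01 hK.
have /choice[u uP] : forall n : nat, exists a, forall P (H : hilbertType R) (pi : A -> H -> H),
    rep_of P pi -> forall v, nm (pi a v - (h P)%:C *: v) <= 2 / n.+1%:R * nm v.
  by move=> n; exact: level_approximation.
have [d [d0 dmono d_gt0 dE]] := @decreasing_null_seq R.
(* [4 * d n] bounds 2 / n.+1 + 2 / m.+1. *)
have ud n m : (n <= m)%N -> nm (u m - u n) <= 4 * d n.
  move=> lenm; apply: nm_le_rep => [|P H pi pP v]; first by rewrite mulr_ge0// ltW.
  have [rep _ _] := pP.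
  have := uP m P H pi pP v; have := uP n P H pi pP v; rewrite -!dE.
  have := nm_tri ((h P)%:C *: v) (pi (u m) v) (pi (u n) v).
  rewrite (nmBC ((h P)%:C *: v)) (repD rep) (repN rep).
  have := dmono _ _ lenm; have := nm_ge0 v.
  by move: (d n) (d m) (nm v) (nm _) (nm _) (nm _) => a b c x y w; nra.
have d4 : (fun n => 4 * d n) @ \oo --> 0 by rewrite -(mulr0 4); exact: cvgMr.
have [z zu] := complete_seq ud d4.
have zP P (H : hilbertType R) (pi : A -> H -> H) v : rep_of P pi -> pi z v = (h P)%:C *: v.
  move=> pP; have [rep _ _] := pP.
  apply/eqP; rewrite -subr_eq0; apply/eqP/nm_eq0.
  suff : ((nm (pi z v - (h P)%:C *: v))%:C : R[i]) = 0 by move=> /complexI.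
  apply: (@cabs_small _ _ (6 * nm v)) => r /andP[r0 _].
  have [n nr] := cvg0_lt d0 r0; rewrite cabsr ger0_norm ?nm_ge0//.
  have := nm_tri (pi (u n) v) (pi z v) ((h P)%:C *: v).
  have -> : pi z v - pi (u n) v = pi (z - u n) v by rewrite (repD rep) (repN rep).
  have := rep_contractive (z - u n) v rep.
  have := ler_wpM2r (nm_ge0 v) (zu n); have := uP n P H pi pP v; rewrite -dE.
  have := nm_ge0 v; move: (d n) nr => a nr.
  by move: (nm v) (nm _) (nm _) (nm _) (nm _) => c x y w q; nra.
have zl a P : prim_ideal P (cmul z a - (h P)%:C *: a).
  have [H [pi pP]] := rep_of_ex P; have [rep _ ->] := pP => v.
  by rewrite (repD rep) (repN rep) (repM rep) (repZ rep) (zP P)// subrr.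
exists z; split=> // a; apply/eqP; rewrite -subr_eq0; apply/eqP/prim_semisimple => P.
have [H [pi pP]] := rep_of_ex P; have [rep _ ->] := pP => v.
by rewrite (repD rep) (repN rep) !(repM rep) !(zP P)// (repZr rep) subrr.
Qed.

End UnitalQuotient.

End PrimitiveIdeals.

(** * Saturated sets and separation of components *)

Section CompactCovers.
Context {T : topologicalType}.
Implicit Types (S U V : set T).

(** Compactness as an induction principle: if it failed, the sets B with [Pr] on S minus B would
    form a proper filter containing S, without cluster point in S. *)
Lemma compact_local S (Pr : set T -> Prop) : compact S -> Pr set0 ->
  (forall U V, Pr U -> Pr V -> Pr (U `|` V)) ->
  (forall U V, U `<=` V -> Pr V -> Pr U) ->
  (forall p, S p -> exists U, [/\ open U, U p & Pr U]) -> Pr S.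
Proof.
move=> cS P0 PU Psub loc; apply: contrapT => nPS.
pose F := [set B | Pr (S `\` B)].
have FF : ProperFilter F.
  split; first by rewrite /F/= setD0.
  split.
  - by rewrite /F/= setDT.
  - by move=> B C FB FC; rewrite /F/= setDIr; exact: PU.
  - by move=> B C BC; apply: Psub => x [Sx nC]; split=> // /BC.
have FS : F S by rewrite /F/= setDv.
have [p [Sp clp]] := cS F FF FS.
have [U [oU Up PrU]] := loc p Sp.
have FU : F (~` U) by rewrite /F/= setDE setCK; apply: Psub PrU; exact: subIsetr.
have [x []] := clp _ _ FU (open_nbhs_nbhs (conj oU Up)).
by [].
Qed.

Definition conn_nbhd S : set T := [set q | exists2 p, S p & conn p q].
Local Notation N := conn_nbhd.

Lemma conn_refl (p : T) : conn p p.
Proof. by move=> [U [V [_ _ Up Vp UV]]]; have : (U `&` V) p by []; rewrite UV. Qed.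

Lemma conn_sym (p q : T) : conn p q -> conn q p.
Proof. by move=> pq [U [V [oU oV Uq Vp UV]]]; apply: pq; exists V, U; rewrite setIC. Qed.

Lemma separate_point S q : compact S -> (forall p, S p -> ~ conn p q) ->
  exists U V, [/\ open U, open V, S `<=` U, V q & U `&` V = set0].
Proof.
move=> cS h; apply: (compact_local (Pr := fun S' => exists U V,
  [/\ open U, open V, S' `<=` U, V q & U `&` V = set0]) cS).
- by exists set0, setT; split; [exact: open0|exact: openT| | |rewrite set0I].
- move=> S1 S2 [U1 [V1 [oU1 oV1 SU1 V1q UV1]]] [U2 [V2 [oU2 oV2 SU2 V2q UV2]]].
  exists (U1 `|` U2), (V1 `&` V2); split; [exact: openU|exact: openI| | |].
  + by move=> x [/SU1|/SU2]; [left|right].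
  + by [].
  + rewrite -subset0 => x [[U1x|U2x] [V1x V2x]].
      by have : (U1 `&` V1) x by []; rewrite UV1.
    by have : (U2 `&` V2) x by []; rewrite UV2.
- move=> S1 S2 S12 [U [V [oU oV SU Vq UV]]]; exists U, V; split=> //.
  exact: subset_trans S12 SU.
- move=> p /h; rewrite /conn => /contrapT[U [V [oU oV Up Vq UV]]].
  by exists U; split=> //; exists U, V; split.
Qed.

Lemma separate_compact S B : compact S -> compact B ->
  (forall p q, S p -> B q -> ~ conn p q) ->
  exists U V, [/\ open U, open V, S `<=` U, B `<=` V & U `&` V = set0].
Proof.
move=> cS cB h; apply: (compact_local (Pr := fun B' => exists U V,
  [/\ open U, open V, S `<=` U, B' `<=` V & U `&` V = set0]) cB).
- by exists setT, set0; split; [exact: openT|exact: open0| | |rewrite setI0].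
- move=> B1 B2 [U1 [V1 [oU1 oV1 SU1 BV1 UV1]]] [U2 [V2 [oU2 oV2 SU2 BV2 UV2]]].
  exists (U1 `&` U2), (V1 `|` V2); split; [exact: openI|exact: openU| | |].
  + by move=> x Sx; split; [exact: SU1|exact: SU2].
  + by move=> x [/BV1|/BV2]; [left|right].
  + rewrite -subset0 => x [[U1x U2x] [V1x|V2x]].
      by have : (U1 `&` V1) x by []; rewrite UV1.
    by have : (U2 `&` V2) x by []; rewrite UV2.
- move=> B1 B2 B12 [U [V [oU oV SU BV UV]]]; exists U, V; split=> //.
  exact: subset_trans B12 BV.
- move=> q Bq; have [U [V [oU oV SU Vq UV]]] := separate_point cS (fun p Sp => h p q Sp Bq).
  by exists V; split=> //; exists U, V; split.
Qed.

(** A compact S need not be closed itself. A point outside N S has a neighbourhood disjoint from an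
    open set around S, and such a neighbourhood misses N S. *)
Lemma conn_nbhd_closed S : compact S -> closed (N S).
Proof.
move=> cS q clq; apply: contrapT => nq.
have [|U [V [oU oV SU Vq UV]]] := @separate_point S q cS.
  by move=> p Sp pq; apply: nq; exists p.
have [q' [[p Sp pq'] Vq']] := clq V (open_nbhs_nbhs (conj oV Vq)).
by apply: pq'; exists U, V; split=> //; exact: SU.
Qed.

Lemma conn_nbhd_closure S V : open V -> S `<=` V -> N S `<=` closure V.
Proof.
move=> oV SV q [p Sp pq] B /nbhs_interior Bq; apply: contrapT => VB.
apply: pq; exists V, B°; split=> //; [exact: open_interior|exact: SV| |].
  exact: nbhs_singleton.
by rewrite -subset0 => x [Vx /interior_subset Bx]; apply: VB; exists x.
Qed.

Lemma conn_nbhd_mono S U : S `<=` U -> N S `<=` N U.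
Proof. by move=> SU q [p /SU]; exists p. Qed.

Lemma sub_conn_nbhd S : S `<=` N S.
Proof. by move=> p Sp; exists p => //; exact: conn_refl. Qed.

Lemma iter_conn_mono k S U : S `<=` U -> iter k N S `<=` iter k N U.
Proof. by elim: k => [|k IH] //= /IH; exact: conn_nbhd_mono. Qed.

Lemma iter_conn_le k l S : (k <= l)%N -> iter k N S `<=` iter l N S.
Proof.
move=> /subnK <-; elim: (l - k)%N => [|i IH] //=.
by apply: subset_trans IH _; exact: sub_conn_nbhd.
Qed.

Lemma iter_conn_sub k S U : N U `<=` U -> S `<=` U -> iter k N S `<=` U.
Proof.
move=> NU SU; elim: k => [|k IH] //=.
by apply: subset_trans (conn_nbhd_mono IH) NU.
Qed.

Lemma saturatedC U : N U `<=` U -> N (~` U) `<=` ~` U.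
Proof. by move=> NU q [p nUp pq] Uq; apply: nUp; apply: NU; exists q => //; exact: conn_sym. Qed.

Lemma iter_conn_path k S q : iter k N S q <->
  exists p s, [/\ S p, conn_path p q s & size s = k].
Proof.
elim: k q => [|k IH] q /=.
  split=> [Sq|[p [s [Sp [_ pq] /size0nil s0]]]]; first by exists q, [::].
  by rewrite -pq s0.
split=> [[r /IH[p [s [Sp [ps <-] sk]]] rq]|[p [s [Sp [ps <-] sk]]]].
  exists p, (rcons s q); split=> //; last by rewrite size_rcons sk.
  by split; rewrite ?last_rcons// rcons_path ps/=; apply/asboolP.
case/lastP: s sk ps => // s q'; rewrite size_rcons => -[sk].
rewrite rcons_path last_rcons => /andP[ps /asboolP sq].
by exists (last p s) => //; apply/IH; exists p, s.
Qed.

(** All components are exhausted after n steps; the extra step makes the set an N of another one, so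
    that it is closed even when S is not. *)
Lemma conn_nbhd_saturated n S : (forall (p q : T) s, conn_path p q s ->
    exists2 s', conn_path p q s' & (size s' <= n)%N) ->
  N (iter n.+1 N S) `<=` iter n.+1 N S.
Proof.
move=> n_bound q h.
have /iter_conn_path[p [s [Sp ps _]]] : iter n.+2 N S q by [].
have [s' ps' sn] := n_bound _ _ _ ps.
by apply: (iter_conn_le (leqW sn)); apply/iter_conn_path; exists p, s'.
Qed.

End CompactCovers.

(** * Urysohn functions that respect components *)

Section Collapse.
Context {T : topologicalType}.
Implicit Types (U V O : set T).
Local Notation N := conn_nbhd.

(* The topology of saturated open sets for which the complement of O behaves
   like a single point. *)
Definition collapse O : Type := let _ := O in T.

Definition collapse_open O (U : set (collapse O)) : Prop :=
  let U' : set T := U in [/\ open U', N U' `<=` U' & U' `<=` O \/ ~` O `<=` U'].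
Arguments collapse_open O U : clear implicits.

HB.instance Definition _ O := Choice.copy (collapse O) T.

Lemma collapse_openT O : collapse_open O setT.
Proof. by split; [exact: openT| |right]. Qed.

Lemma collapse_openI O : setI_closed (collapse_open O).
Proof.
move=> U V [oU NU UO] [oV NV VO]; split; first exact: openI.
  by move=> q [p [Up Vp] pq]; split; [apply: NU|apply: NV]; exists p.
case: UO => [UO|UO]; first by left=> x [/UO].
by case: VO => [VO|VO]; [left=> x [_ /VO]|right=> x nOx; split; [exact: UO|exact: VO]].
Qed.

Lemma collapse_open_bigU O (I : Type) (f : I -> set (collapse O)) :
  (forall i, collapse_open O (f i)) -> collapse_open O (\bigcup_i f i).
Proof.
move=> fo; split.
- by apply: (@bigcup_open T) => i _; have [] := fo i.
- move=> q [p [i _ fip] pq]; exists i => //.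
  by have [_ Ni _] := fo i; apply: Ni; exists p.
- have [[i fi]|nf] := pselect (exists i, ~` O `<=` f i).
    by right=> x /fi fx; exists i.
  left=> x [i _ fix_]; have [_ _ [fO|fO]] := fo i; first exact: fO.
  by exfalso; apply: nf; exists i.
Qed.

HB.instance Definition _ O := isOpenTopological.Build (collapse O)
  (@collapse_openT O) (@collapse_openI O) (@collapse_open_bigU O).

Lemma openCollapse O (U : set (collapse O)) : open U = collapse_open O U.
Proof. by []. Qed.

End Collapse.
Arguments collapse_open {T} O U.

Section ComponentSeparation.
Context {R : realType} {T : topologicalType}.
Implicit Types (S U V B : set T).
Local Notation N := conn_nbhd.

Variable n : nat.
Hypothesis n_bound : forall (p q : T) s, conn_path p q s ->
  exists2 s', conn_path p q s' & (size s' <= n)%N.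

Let sat S := iter n.+1 N S.

Let sat_sub S : S `<=` sat S.
Proof. exact: (@iter_conn_le _ 0). Qed.

Let sat_saturated S : N (sat S) `<=` sat S.
Proof. exact: conn_nbhd_saturated n_bound. Qed.

Let sat_disjoint S U : N U `<=` U -> (forall x, U x -> ~ S x) -> forall x, U x -> ~ sat S x.
Proof.
move=> NU US x Ux sx; have : (~` U) x; last by [].
move: sx; apply: iter_conn_sub; first exact: saturatedC.
by move=> y Sy Uy; apply: (US y).
Qed.

Variable K : set T.
Hypotheses (Kclosed : closed K) (Kcompact : compact K) (Ksat : N K `<=` K).

Let closed_sub_compact S : closed S -> S `<=` K -> compact S.
Proof. by move=> cS SK; exact: subclosed_compact cS Kcompact SK. Qed.

Let sat_in S : S `<=` K -> sat S `<=` K.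
Proof. exact: iter_conn_sub. Qed.

Let sat_closed S : closed S -> S `<=` K -> closed (sat S).
Proof.
move=> cS SK.
have iter_closed k : closed (iter k N S).
  elim: k => [|k IH] //=; apply: conn_nbhd_closed.
  by apply: closed_sub_compact => //; exact: iter_conn_sub.
exact: iter_closed.
Qed.

Section Collapsed.
Variable O : set T.
Hypotheses (Oopen : open O) (OK : O `<=` K) (Osat : N O `<=` O).

Let closed_collapse (F : set (collapse O)) : closed F ->
  let F' : set T := F in [/\ closed F', N F' `<=` F' & F' `<=` O \/ ~` O `<=` F'].
Proof.
rewrite -openC openCollapse => -[oF NF FO] F'; split.
- by rewrite -[F']setCK; exact: open_closedC.
- by rewrite -[F']setCK; exact: saturatedC.
- case: FO => FO.
    by right=> x nOx; apply: contrapT => nFx; apply: nOx; exact: FO.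
  by left=> x Fx; apply: contrapT => nOx; have := FO _ nOx.
Qed.

(** B' stands for B and the collapsed point inside the compact K, so that A and B' are separated by
    open sets of T. Removing the saturations of the complements of these sets makes them
    saturated. *)
Let normal_aux (A B : set T) : closed A -> N A `<=` A -> closed B -> N B `<=` B ->
  A `&` B = set0 -> A `<=` O ->
  exists U V : set T, [/\ collapse_open O U, collapse_open O V, A `<=` U, B `<=` V & U `&` V = set0].
Proof.
move=> cA NA cB NB AB AO.
pose B' := (B `&` K) `|` (K `\` O).
have cKO : closed (K `\` O) by apply: closedI => //; exact: open_closedC.
have NKO : N (K `\` O) `<=` K `\` O.
  move=> q [p [Kp nOp] pq]; split; first by apply: Ksat; exists p.
  by have := saturatedC Osat; apply; exists p.
have cB' : compact B'.
  apply: closed_sub_compact; last by move=> x [[]|[]].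
  by apply: closedU => //; exact: closedI.
have NB' : N B' `<=` B'.
  move=> q [p [[Bp Kp]|KOp] pq]; [left; split|right].
  - by apply: NB; exists p.
  - by apply: Ksat; exists p.
  - by apply: NKO; exists p.
have cA' : compact A by apply: closed_sub_compact => //; exact: subset_trans AO OK.
have [|U1 [U2 [oU1 oU2 AU1 BU2 U12]]] := separate_compact cA' cB'.
  move=> p q Ap [[Bq _]|[_ nOq]] pq.
    by have : (A `&` B) q; [split=> //; apply: NA; exists p|rewrite AB].
  by apply: nOq; apply: AO; apply: NA; exists p.
pose Y1 := sat (K `\` (U1 `&` O)).
pose Y2 := sat (K `\` U2).
have cY1 : closed Y1.
  by apply: sat_closed => [|x []//]; apply: closedI => //; apply: open_closedC; exact: openI.
have cY2 : closed Y2.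
  by apply: sat_closed => [|x []//]; apply: closedI => //; exact: open_closedC.
exists (O `\` Y1), (~` Y2); split.
- split; last by left=> x [].
    by apply: openI => //; exact: closed_openC.
  move=> q [p [Op nYp] pq]; split; first by apply: Osat; exists p.
  by have := saturatedC (@sat_saturated (K `\` (U1 `&` O))); apply; exists p.
- split; first exact: closed_openC.
    exact/saturatedC/sat_saturated.
  right=> q nOq Yq; have Kq : K q by apply: sat_in Yq => x [].
  have B'q : B' q by right.
  by move: Yq; apply: (sat_disjoint NB') B'q => x /BU2 ? [].
- move=> x Ax; split; first exact: AO.
  apply: (sat_disjoint NA) Ax => y Ay [_ nU]; apply: nU; split; [exact: AU1|exact: AO].
- move=> x Bx Yx; have Kx : K x by apply: sat_in Yx => y [].
  have B'x : B' x by left.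
  by move: Yx; apply: (sat_disjoint NB') B'x => y /BU2 ? [].
- rewrite -subset0 => x [[Ox nY1] nY2]; have Kx := OK Ox.
  have U1x : U1 x.
    by apply: contrapT => nU; apply: nY1; apply: sat_sub; split=> // -[].
  have U2x : U2 x by apply: contrapT => nU; apply: nY2; apply: sat_sub; split.
  by have : (U1 `&` U2) x by []; rewrite U12.
Qed.

(** Of two disjoint closed sets at least one avoids the collapsed point, and [normal_aux] applies
    with that one first. *)
Let collapse_normal : normal_space (collapse O).
Proof.
apply/(@normal_openP R) => A B /closed_collapse[cA NA AO] /closed_collapse[cB NB BO] AB.
have [hA|hA] := pselect ((A : set T) `<=` O); first exact: normal_aux.
have {}AO : ~` O `<=` (A : set T) by case: AO.
have hB : (B : set T) `<=` O.
  case: BO => // BO x Bx; apply: contrapT => nOx.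
  by have : (A `&` B) x; [split=> //; exact: AO|rewrite AB].
have [|U [V [oU oV BU AV UV]]] := @normal_aux B A cB NB cA NA _ hB.
- by rewrite setIC.
- by exists V, U; rewrite setIC.
Qed.

Lemma collapse_separation (C : set T) : closed C -> N C `<=` C -> C `<=` O ->
  exists f : T -> R, [/\ continuous f, range f `<=` `[0, 1],
    forall x, C x -> f x = 0 & forall x, ~ O x -> f x = 1].
Proof.
move=> cC NC CO.
have cC' : closed (C : set (collapse O)).
  rewrite -openC openCollapse; split; first exact: closed_openC.
    exact: saturatedC.
  by right=> x nOx /CO.
have cO' : closed (~` O : set (collapse O)).
  rewrite -openC openCollapse setCK; split=> //; by left.
have CO0 : (C : set (collapse O)) `&` (~` O) = set0.
  by rewrite -subset0 => x [/CO Ox nOx].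
have /(@uniform_separatorP _ R)[f [cf f01 f0 f1]] :=
  (@normal_separatorP R _).1 collapse_normal _ _ cC' cO' CO0.
exists f; split=> //.
- apply/continuousP => U oU; have /continuousP/(_ U oU) := cf.
  by rewrite openCollapse => -[].
- by move=> x Cx; apply: f0; exists x.
- by move=> x nOx; apply: f1; exists x.
Qed.

End Collapsed.
End ComponentSeparation.

Section ComponentUrysohn.
Context {R : realType} {T : topologicalType}.
Implicit Types (S U V B H : set T).
Local Notation N := conn_nbhd.

Variable n : nat.
Hypothesis n_bound : forall (p q : T) s, conn_path p q s ->
  exists2 s', conn_path p q s' & (size s' <= n)%N.

Variable good : set T -> Prop.
Hypothesis good0 : good set0.
Hypothesis good_sub : forall U V, U `<=` V -> good V -> good U.
Hypothesis goodU : forall U V, good U -> good V -> good (U `|` V).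
Hypothesis good_compact : forall V, good V -> compact (closure V).

Let compact_good_nbhd S : compact S ->
  (forall p, S p -> exists V, [/\ open V, V p & good V]) ->
  exists V, [/\ open V, S `<=` V & good V].
Proof.
move=> cS loc; apply: (compact_local (Pr := fun S' => exists V, [/\ open V, S' `<=` V & good V]) cS).
- by exists set0; split; [exact: open0| |].
- move=> S1 S2 [V1 [oV1 SV1 gV1]] [V2 [oV2 SV2 gV2]]; exists (V1 `|` V2).
  by split; [exact: openU|exact: setUSS|exact: goodU].
- move=> S1 S2 S12 [V [oV SV gV]]; exists V; split=> //.
  exact: subset_trans S12 SV.
- by move=> p /loc[V [oV Vp gV]]; exists V; split=> //; exists V; split.
Qed.

Lemma component_urysohn H P0 : H P0 -> N H `<=` H ->
  (forall p, H p -> exists V, [/\ open V, V p & good V]) ->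
  exists f : T -> R, [/\ continuous f, range f `<=` `[0, 1], f P0 = 0 &
    good [set x | f x <> 1]].
Proof.
move=> HP0 NH Hgood; pose C := iter n.+1 N [set P0].
have P0H : [set P0] `<=` H by move=> _ ->.
have iterH k : iter k N [set P0] `<=` H by exact: iter_conn_sub.
have iter_compact k : compact (iter k N [set P0]).
  elim: k => [|k IH] /=; first exact: compact_set1.
  have [|V [oV SV gV]] := compact_good_nbhd IH; first by move=> p /iterH/Hgood.
  apply: subclosed_compact (good_compact gV) (conn_nbhd_closure oV SV).
  exact: conn_nbhd_closed.
have NC : N C `<=` C := conn_nbhd_saturated n_bound.
have cC : compact C := iter_compact n.+1.
have clC : closed C by apply: conn_nbhd_closed; exact: iter_compact.
have CP0 : C P0 by apply: (@iter_conn_le _ 0%N).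
have [|V0 [oV0 CV0 gV0]] := compact_good_nbhd cC.
  by move=> p /(iterH n.+1)/Hgood.
(* C is saturated, so it can be separated from the compact set [closure V] minus [V]. *)
have shrink V : open V -> C `<=` V -> good V ->
    exists V', [/\ open V', C `<=` V' & closure V' `<=` V].
  move=> oV CV gV; pose B := closure V `\` V.
  have cB : compact B.
    apply: subclosed_compact (good_compact gV) _; last by move=> x [].
    by apply: closedI; [exact: closed_closure|exact: open_closedC].
  have [|U [W [oU oW CU BW UW]]] := separate_compact cC cB.
    by move=> p q Cp [_ nVq] pq; apply: nVq; apply: CV; apply: NC; exists p.
  exists (U `&` V); split; [exact: openI|by move=> x Cx; split; [exact: CU|exact: CV]|].
  move=> q clq; apply: contrapT => nVq.
  have Wq : W q by apply: BW; split=> //; apply: closureS clq => x [].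
  have [x [[Ux _] Wx]] := clq W (open_nbhs_nbhs (conj oW Wq)).
  by have : (U `&` W) x by []; rewrite UW.
(* One step out of an open set stays in its closure, so each shrinking pays for one step. *)
have shrinks k : forall V, open V -> C `<=` V -> good V ->
    exists V', [/\ open V', C `<=` V' & forall j, (j <= k)%N -> iter j N (closure V') `<=` V].
  elim: k => [|k IH] V oV CV gV.
    have [V' [oV' CV' clV']] := shrink V oV CV gV.
    by exists V'; split=> // j; rewrite leqn0 => /eqP ->.
  have [V1 [oV1 CV1 h1]] := IH V oV CV gV.
  have V1V : V1 `<=` V by move=> x V1x; apply: (h1 0%N) => //; exact: subset_closure.
  have [V' [oV' CV' clV']] := shrink V1 oV1 CV1 (good_sub V1V gV).
  exists V'; split=> // -[_|j jk]; first exact: subset_trans clV' V1V.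
  rewrite iterSr; apply: subset_trans (h1 j jk); apply: iter_conn_mono.
  exact: conn_nbhd_closure.
have [W [oW CW hW]] := shrinks n.+1 V0 oV0 CV0 gV0.
have clV0 : compact (closure V0) := good_compact gV0.
have iter_closed j : (j <= n.+1)%N -> closed (iter j N (closure W)).
  elim: j => [|j IH] jn; first exact: closed_closure.
  apply: conn_nbhd_closed; apply: subclosed_compact (IH (ltnW jn)) clV0 _.
  by apply: subset_trans (@subset_closure _ V0); apply: hW; exact: ltnW.
(* Closed, saturated and good, but perhaps not open; an open saturated set is cut out of it as [O]
   below. *)
pose K := iter n.+1 N (closure W).
have KV0 : K `<=` V0 by exact: hW.
have clK : closed K by exact: iter_closed.
have cK : compact K.
  by apply: subclosed_compact clK clV0 _; apply: subset_trans KV0 (@subset_closure _ _).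
have NK : N K `<=` K := conn_nbhd_saturated n_bound.
have WK : W `<=` K.
  move=> x Wx; apply: (@iter_conn_le _ 0%N) => //; exact: subset_closure.
pose Z := iter n.+1 N (K `\` W).
have ZK : Z `<=` K by apply: iter_conn_sub => // x [].
have clKW : closed (K `\` W) by apply: closedI => //; exact: open_closedC.
have iterZ_closed j : closed (iter j N (K `\` W)).
  elim: j => [|j IH] //=; apply: conn_nbhd_closed.
  by apply: subclosed_compact IH cK _; apply: iter_conn_sub => // x [].
have NZ : N Z `<=` Z := conn_nbhd_saturated n_bound.
have KWZ : K `\` W `<=` Z by exact: (@iter_conn_le _ 0%N).
(* Removing the closed saturation of K minus W leaves an open saturated set; it contains C, which is
   saturated and disjoint from K minus W. *)
pose O := W `\` Z.
have OW : O `<=` W by move=> x [].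
have oO : open O.
  by apply: openI => //; apply: closed_openC; exact: (iterZ_closed n.+1).
have NO : N O `<=` O.
  move=> q [p [Wp nZp] pq].
  have nZq : ~ Z q by have := saturatedC NZ; apply; exists p.
  split=> //; apply: contrapT => nWq; apply: nZq; apply: KWZ; split=> //.
  by apply: NK; exists p => //; exact: WK.
have CO : C `<=` O.
  move=> x Cx; split; first exact: CW.
  have nC : Z `<=` ~` C.
    apply: iter_conn_sub; first exact: saturatedC.
    by move=> y [_ nWy] /CW.
  by move=> /nC.
have [f [cf f01 f0 f1]] := @collapse_separation R _ n n_bound K clK cK NK O oO
  (subset_trans OW WK) NO C clC NC CO.
exists f; split=> //; first exact: f0.
apply: good_sub gV0 => x /= fx; apply/KV0/WK/OW; apply: contrapT => nOx.
by apply: fx; exact: f1.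
Qed.

End ComponentUrysohn.

(** * Unital quotients and the complete regularization *)

Section GoodSets.
Context {R : realType} {A : cstarAlgType R}.
Implicit Types (a b e : A) (U V : set (Prim A)).

Definition unital_on V := unital_quotient (kernel_of V).

Lemma unital_on0 : unital_on set0.
Proof. by exists 0 => a; split=> Q. Qed.

Lemma unital_on_sub U V : U `<=` V -> unital_on V -> unital_on U.
Proof. by move=> UV [e eV]; exists e => a; have [l r] := eV a; split=> Q /UV; [exact: l|exact: r]. Qed.

(* (1 - e)(1 - e') annihilates A modulo both kernels. *)
Lemma unital_onU U V : unital_on U -> unital_on V -> unital_on (U `|` V).
Proof.
move=> [e eU] [e' eV]; exists (e + e' - cmul e e') => a.
have [lU _] := eU (a - cmul e' a); have [_ rU] := eU a.
have [lV _] := eV a; have [_ rV] := eV (a - cmul a e).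
have [_ UD UZ _ [Ur Ul]] := kernel_star_ideal U.
have [_ VD VZ _ [Vr Vl]] := kernel_star_ideal V.
have E1 : cmul (e + e' - cmul e e') a - a = cmul e (a - cmul e' a) - (a - cmul e' a).
  by rewrite cmulBl cmulDl cmulBr -cmulA; module R[i].
have E2 : cmul a (e + e' - cmul e e') - a = cmul (a - cmul a e) e' - (a - cmul a e).
  by rewrite cmulBr cmulDr cmulBl cmulA; module R[i].
split=> Q [UQ|VQ].
- by rewrite E1; exact: lU.
- have : kernel_of V (cmul (e + e' - cmul e e') a - a); last exact.
  have -> : cmul (e + e' - cmul e e') a - a = (cmul e' a - a) + (- 1) *: cmul e (cmul e' a - a).
    by rewrite cmulBl cmulDl cmulBr -cmulA; module R[i].
  by apply: VD => //; apply/VZ/Vl.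
- have : kernel_of U (cmul a (e + e' - cmul e e') - a); last exact.
  have -> : cmul a (e + e' - cmul e e') - a = (cmul a e - a) + (- 1) *: cmul (cmul a e - a) e'.
    by rewrite cmulBr cmulDr cmulBl cmulA; module R[i].
  by apply: UD => //; apply/UZ/Ur.
- by rewrite E2; exact: rV.
Qed.

Lemma unital_on_closure V : unital_on V -> unital_on (closure V).
Proof.
move=> [e eV]; exists e => a; have [l r] := eV a.
by split=> Q /closure_sub_hull; apply.
Qed.

(** The union I of the kernels of the members of the filter is an ideal with unit e modulo I, and e
    is not in I because every member meets the closure of V. A primitive ideal above I is a cluster
    point. *)
Lemma unital_on_compact V : unital_on V -> compact (closure V).
Proof.
move=> /unital_on_closure[e eV] F FF FV.
pose I := [set a | exists2 B, F B & kernel_of B a].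
have kerI B C a : kernel_of B a -> kernel_of (B `&` C) a by move=> Ba Q [BQ _]; exact: Ba.
have kerIr B C a : kernel_of C a -> kernel_of (B `&` C) a by move=> Ca Q [_ CQ]; exact: Ca.
have Iid : star_ideal I.
  split.
  - by exists setT; [exact: filterT|have [] := kernel_star_ideal (@setT (Prim A))].
  - move=> a b [B FB Ba] [C FC Cb]; exists (B `&` C); first exact: filterI.
    by have [_ D _ _ _] := kernel_star_ideal (B `&` C); apply: D; [exact: kerI|exact: kerIr].
  - move=> a c [B FB Ba]; exists B => //.
    by have [_ _ Z _ _] := kernel_star_ideal B; exact: Z.
  - move=> a [B FB Ba]; exists B => //.
    by have [_ _ _ S _] := kernel_star_ideal B; exact: S.
  - have [] := kernel_star_ideal (@setT (Prim A)) => _ _ _ _ _.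
    split=> a b [B FB Bab]; exists B => //; have [_ _ _ _ [Br Bl]] := kernel_star_ideal B.
      exact: Br.
    exact: Bl.
have [||P IP] := @primitive_ideal_above _ _ I e Iid.
- by move=> a; have [l r] := eV a; split; exists (closure V).
- exists e => -[B FB Be].
  have [Q [BQ VQ]] := filter_ex (filterI FB FV).
  have [a Qa] := prim_proper Q; apply: Qa.
  have [_ D Z _ _] := prim_star_ideal Q.
  have -> : a = cmul e a + (- 1) *: (cmul e a - a) by module R[i].
  apply: D; first exact/prim_mulr/Be.
  by apply: Z; have [l _] := eV a; exact: l.
have cl B : F B -> closure B P.
  move=> FB; apply: (hull_kernel_closed (@closed_closure _ B)) => a Ba.
  by apply: IP; exists B => // Q BQ; apply: Ba; exact: subset_closure.
exists P; split.
  by have := cl _ FV; rewrite -((closure_id _).1 (@closed_closure _ V)).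
by move=> B U FB PU; exact: cl FB _ PU.
Qed.

End GoodSets.

(** * Functions on the complete regularization and on X *)

Section CompleteRegularization.
Context {R : realType} {T X : topologicalType}.

(** f induces one of the functions defining the topology of [creg], so its sublevel set is open
    there; through the homeomorphism it is the trace on the image of phi of an open set of X. *)
Lemma complete_regularization_nbhd (phi : T -> X) (f : T -> R) (r : R) P0 :
  is_complete_regularization R phi -> continuous f -> range f `<=` `[0, 1] ->
  f P0 < r -> exists O, [/\ open O, O (phi P0) & forall P, O (phi P) -> f P < r].
Proof.
move=> [h [[ch [k [hk kh ck]]] hphi]] cf f01 fP0.
have bf : bounded_fun f.
  exists 1; split; first exact: num_real.
  move=> M M1 t _ /=; have /f01 := imageP f (I : setT t); rewrite /= in_itv/= => /andP[f0 f1].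
  by rewrite ger0_norm// (le_trans f1)// ltW.
pose g (y : creg_quot R T) : R := f (repr y).
have gE P : g (creg_map_quot R P) = f P.
  rewrite /g /creg_map_quot; case: piP => Q /eqmodP/asboolP fPQ; symmetry.
  exact: fPQ.
have gE' : g \o creg_map_quot R (T := T) = f by apply/funext => P; exact: gE.
have gP : continuous (g \o creg_map_quot R (T := T)) /\ bounded_fun (g \o creg_map_quot R (T := T)).
  by rewrite gE'.
pose G : creg_fun R T := exist _ g gP.
have cg : continuous (g : creg R T -> R).
  move=> y; have /(@cvg_sup _ _ (fun G : creg_fun R T =>
    Topological.on (initial_topology (projT1 G))))/(_ G) : nbhs y --> (y : creg R T) by [].
  move=> yG U gU; apply: yG; exact: (@initial_continuous _ _ g).
have oW : open [set y : creg R T | g y < r].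
  have /continuousP/(_ [set t | t < r]) := cg; apply; exact: open_lt.
move: ck => /continuousP ck; have [U oU UE] := ck _ oW.
exists U; split=> //.
  rewrite -hphi; have : (set_val @^-1` U) (h (creg_map R P0)); last by [].
  by rewrite UE /= hk gE.
move=> P; rewrite -hphi => UP; have : (k @^-1` [set y : creg R T | g y < r]) (h (creg_map R P)).
  by rewrite -UE.
by rewrite /= hk gE.
Qed.

Lemma locally_compact_urysohn (x : X) (O : set X) : hausdorff_space X ->
  locally_compact [set: X] -> open O -> O x ->
  exists g : X -> R, [/\ continuous g, forall y, 0 <= g y <= 1, g x = 1,
    forall y, g y <> 0 -> O y & forall e, 0 < e -> compact [set y | e <= g y]].
Proof.
move=> hX lX oO Ox.
have [K] := lX x I; rewrite withinET => Kx [cK clK].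
(* Staying in the interior of the compact K makes the level sets of [g] closed subsets of K. *)
pose B := ~` (O `&` K°).
have cB : closed B by apply: open_closedC; apply: openI => //; exact: open_interior.
have nBx : ~ B x by apply; split=> //; exact: nbhs_interior.
have /(@uniform_separatorP _ R)[f [cf f01 f0 f1]] :=
  @locally_compact_completely_regular X R lX hX x B cB nBx.
have f01' y : 0 <= f y <= 1 by have := f01 _ (imageP f (I : setT y)); rewrite /= in_itv.
pose g y := 1 - f y.
have cg : continuous g by move=> y; apply: cvgB; [exact: cvg_cst|exact: cf].
have gB y : g y <> 0 -> (O `&` K°) y.
  move=> gy; apply: contrapT => By; apply: gy; rewrite /g.
  by rewrite (f1 (f y)) ?subrr//; exists y.
exists g; split=> //.
- by move=> y; rewrite /g subr_ge0 gerBl andbC.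
- by rewrite /g (f0 (f x)) ?subr0//; exists x.
- by move=> y /gB[].
- move=> e e0; apply: subclosed_compact cK _.
    by apply: (@closed_comp _ _ g [set t | e <= t]) => [y _|]; [exact: cg|exact: closed_ge].
  move=> y /= ey; apply: interior_subset; have [] // := gB y.
  by move=> gy; move: ey; rewrite gy leNgt e0.
Qed.

End CompleteRegularization.

Section ConnectingOrder.
Context {R : realType} {T : topologicalType}.

Lemma conn_component_bound (n : nat) (p q : T) s :
  (conn_diameter R (conn_component p) <= (n%:R)%:E)%E ->
  conn_path p q s -> exists2 s', conn_path p q s' & (size s' <= n)%N.
Proof.
move=> dn pqs; have Cq : conn_component p q by exists s.
have Cp : conn_component p p by exists [::].
(* For a singleton component the diameter is a convention; there the empty path does. *)
move: dn; rewrite /conn_diameter; case: asboolP => [[r Cr] _|_ dn].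
  move: Cp Cq; rewrite Cr => -> ->; by exists [::].
have : (conn_dist R p q <= n%:R%:E)%E.
  apply: le_trans dn; apply: ereal_sup_ubound; exists (p, q) => //.
(* A strict bound on the infimum passes to some path, whose length is then at most n. *)
move=> h; have : (conn_dist R p q < n.+1%:R%:E)%E.
  by apply: le_lt_trans h _; rewrite lte_fin ltr_nat.
move=> /ereal_inf_lt[_ [s' ps' <-]]; rewrite lte_fin ltr_nat ltnS => sn.
by exists s'.
Qed.

End ConnectingOrder.

Lemma Orc_bound (R : realType) (A : cstarAlgType R) : (Orc A < +oo)%E ->
  exists n : nat, forall (p q : Prim A) s, conn_path p q s ->
    exists2 s', conn_path p q s' & (size s' <= n)%N.
Proof.
move=> Oo; have [n On] : exists n : nat, (Orc A <= n%:R%:E)%E.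
  (* The value -oo is the supremum over an empty Prim(A). *)
  move: Oo; case: (Orc A) => [r _|//|_]; last by exists 0%N; rewrite leNye.
  exists (Num.truncn `|r|).+1; rewrite lee_fin (le_trans (ler_norm _))// ltW//.
  exact: truncnS_gt.
exists n => p q s; apply: (@conn_component_bound R); apply: le_trans On.
by apply: ereal_sup_ubound; exists p.
Qed.

(** * Central multipliers and the conclusion *)

Section Conclusion.
Context {R : realType} {A : cstarAlgType R}.

(** For a multiplier with left part L, z (L a) = (L a) z = L (a z) = L (z a); the right part is
    similar. *)
Lemma central_multiplier (z : A) : (forall a, cmul z a = cmul a z) ->
  multiplier_center (multiplier_of z).
Proof.
move=> zc; split.
  split=> /=.
  - split; first exact: cmul_linear_r.
    by apply: (@bounded_linear_continuousC _ _ _ _ (nm z)) => [|v]; [exact: cmul_linear_r|exact: nmM].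
  - split; first exact: cmul_linear_l.
    apply: (@bounded_linear_continuousC _ _ _ _ (nm z)) => [|v]; first exact: cmul_linear_l.
    by rewrite mulrC nmM.
  - by move=> a b; rewrite cmulA.
  - by move=> a b; rewrite cmulA.
  - by move=> a b; rewrite cmulA.
move=> [L Rm] [_ _ /= LM RM _]; rewrite /multiplier_mul/=; congr pair.
  by apply/funext => a /=; rewrite zc -LM -zc.
by apply/funext => a /=; rewrite -zc RM zc.
Qed.

End Conclusion.

Local Open Scope ereal_scope.

Theorem corollary6p3 (R : realType) (A : cstarAlgType R) (X : topologicalType)
    (X_hausdorff : hausdorff_space X)
    (X_locally_compact : locally_compact [set: X])
    (phi : Prim A -> X) (phi_continuous : continuous phi)
    (phi_creg : is_complete_regularization R phi)
    (Orc_finite : Orc A < +oo)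
    (x : X) (x_in_image : range phi x)
    (Jx_modular : locally_modular phi x) :
  Uphi phi x \/ interior (Hx phi x) !=set0.
Proof.
have [Hx0|HxN0] := pselect (interior (Hx phi x) = set0); last first.
  by right; apply/set0P/eqP.
left; have [P0 _ phiP0] := x_in_image.
have [n n_bound] := Orc_bound Orc_finite.
have NH : conn_nbhd (Hx phi x) `<=` Hx phi x.
  move=> Q [P HP PQ]; rewrite /Hx/=; symmetry; rewrite -HP; apply: X_hausdorff => U V UP VQ.
  apply: contrapT => UV; apply: PQ; exists (phi @^-1` U°), (phi @^-1` V°); split.
  - by apply: open_comp; [move=> ? _; exact: phi_continuous|exact: open_interior].
  - by apply: open_comp; [move=> ? _; exact: phi_continuous|exact: open_interior].
  - exact: UP.
  - exact: VQ.
  - by rewrite -subset0 => S [/interior_subset US /interior_subset VS]; apply: UV; exists (phi S).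
have Hgood P : Hx phi x P -> exists V, [/\ open V, V P & unital_on V].
  move=> HP; have [|V [[W oW VE] VP eV]] := Jx_modular P.
    by split; [exact: subset_closure|rewrite /Ux Hx0].
  by exists V; split=> //; rewrite VE /Ux Hx0 setC0 setIT.
have [f [cf f01 fP0 [e e_unit]]] := @component_urysohn R _ n n_bound unital_on
  unital_on0 unital_on_sub unital_onU unital_on_compact
  (Hx phi x) P0 phiP0 NH Hgood.
have fP1 : (f P0 < 1)%R by rewrite fP0.
have [W [oW Wx Wf]] := complete_regularization_nbhd phi_creg cf f01 fP1.
rewrite phiP0 in Wx.
have [g [cg g01 gx gW gK]] := @locally_compact_urysohn R X x W
  X_hausdorff X_locally_compact oW Wx.
(* [e] is a unit modulo the kernel of the set where f differs from 1, and g o phi is supported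
   there: g (phi P) <> 0 puts phi P in W, so f P < 1. *)
have [|P|P /= gP|z [zc zP]] := @dauns_hofmann_element R A _ e e_unit (g \o phi).
- by move=> P; apply: (@continuous_comp _ _ _ phi g); [exact: phi_continuous|exact: cg].
- exact: g01.
- by move=> /= f1; have := Wf P (gW _ gP); rewrite f1 ltxx.
pose F (y : X) : R[i]^o := (g y)%:C.
have cF : continuous F.
  move=> y; apply/cvgrPdist_lt => r r0.
  have [r' r'0 ->] := posC_real r0.
  have /cvgrPdist_lt/(_ _ r'0) := cg y; apply: filterS => t.
  by rewrite /F -rmorphB norm_complexr ltcR.
have gabs y : (`|g y| = g y)%R by rewrite ger0_norm//; case/andP: (g01 y).
have FC0 : C0 F.
  split=> // r r0.
  have [r' r'0 ->] := posC_real r0.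
  rewrite (_ : [set y | _] = [set y | (r' <= g y)%R]); first exact: gK.
  by apply/seteqP; split=> y /=; rewrite /F norm_complexr gabs lecR.
have zZ : Zprime phi z.
  exists F => //; split.
  - by move=> P; apply: (@continuous_comp _ _ _ phi F); [exact: phi_continuous|exact: cF].
  - exists 1%R; split; first exact: real1.
    move=> r r1 P _ /=; apply: le_trans (ltW r1).
    by rewrite /F norm_complexr gabs lecR; case/andP: (g01 (phi P)).
  - exact: central_multiplier.
  - by move=> a P; exact: zP.
(* z acts at P0 as g x = 1, so z in P0 would make P0 all of A. *)
split=> // /(_ _ zZ)/(_ _ phiP0) Pz.
have [a Pa] := prim_proper P0; apply: Pa.
have [_ D Z _ _] := prim_star_ideal P0.
have := zP a P0; rewrite /= phiP0 gx rmorph1 scale1r => h.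
have -> : a = (cmul z a + (-1)%R *: (cmul z a - a))%R by module R[i].
by apply: D; [exact: prim_mulr|exact: Z].
Qed.
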